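(* Let $d\ge2$, $n=d-1$, and let $G=\mathrm{SO}(d,1)^0$ if $d>2$ and $G=\mathrm{SO}(2,1)\cong\mathrm{PGL}_2(\mathbb R)$ if $d=2$. For $\lambda,\mu,\nu\in\mathfrak a^*\cong\mathbb C$ imaginary, let $$\mathcal T_{\rm st}(\lambda,\mu,\nu)=\int_G\underline a(w_0n_0y)^{\lambda+\rho}\,\underline a(w_0y)^{\mu+\rho}\,\underline a(y)^{\nu+\rho}\,dy .$$ Then there is a positive constant, independent of $\lambda,\mu,\nu$, such that for all imaginary $\lambda,\mu,\nu$ the number $\mathcal T_{\rm st}(\lambda,\mu,\nu)$ equals this constant times $$\frac{\Gamma\left(\frac{2(\lambda+\mu-\nu)+n}4\right)\Gamma\left(\frac{2(\lambda-\mu+\nu)+n}4\right)\Gamma\left(\frac{2(-\lambda+\mu+\nu)+n}4\right)\Gamma\left(\frac{2(\lambda+\mu+\nu)+n}4\right)}{\Gamma\left(\frac{2\lambda+n}2\right)\Gamma\left(\frac{2\mu+n}2\right)\Gamma\left(\frac{2\nu+n}2\right)} .$$ In particular, for fixed imaginary $\mu$ and $\nu$, as $|\lambda|\to\infty$ with $\lambda$ imaginary, one has $$|\mathcal T_{\rm st}(\lambda,\mu,\nu)|=c\,\exp\left(-\frac\pi2|\lambda|\right)|\lambda|^{\frac d2-2}\left(1+O\left(\frac1{|\lambda|}\right)\right)$$ for some constant $c>0$.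
   Context: Let $J=\mathrm{diag}(1,\dots,1,-1)$ of size $d+1$; $\mathrm{SO}(d,1)$ is the group of real matrices $g$ of determinant $1$ with $g^tJg=J$, and $\mathrm{SO}(d,1)^0$ is its identity component. $K$ is the standard maximal compact subgroup ($K\cong\mathrm{SO}(d)$ acting on the first $d$ coordinates if $d>2$, $K\cong \mathrm O(2)$ if $d=2$). Let $H=E_{d,d+1}+E_{d+1,d}$ (matrix units), $A=\{\exp(tH):t\in\mathbb R\}$, and $N=\{n(x):x\in\mathbb R^{d-1}\}$, where, for $x$ a column vector, $$n(x)=\begin{pmatrix} I_{d-1} & -x & x \\ {x^t} & 1-\frac{|x|^2}2 & \frac{|x|^2}2 \\ {x^t} & -\frac{|x|^2}2 & 1+\frac{|x|^2}2 \end{pmatrix}.$$ Then $G=ANK$ (Iwasawa decomposition) and $\underline a:G\to A$ denotes the $A$-component, so $x\in\underline a(x)NK$. Let $w_0=\mathrm{diag}(1,\dots,1,-1,-1,1)$, a representative of the nontrivial Weyl group element, and $n_0=n(1,0,\dots,0)$. $dy$ is a Haar measure on $G$. $\mathfrak a$ is the complexified Lie algebra of $A$; $\mathfrak a^*$ is identified with $\mathbb C$ by $\lambda\mapsto\lambda(H)$, so $\exp(tH)^\lambda=e^{t\lambda}$; under this identification $\rho=\frac{d-1}2$ (where $a^{2\rho}=\det(a|\mathfrak n)$, $\mathfrak n$ the Lie algebra of $N$), ''imaginary'' means $\lambda\in i\mathbb R$, and $|\lambda|$ is the absolute value. The number $\mathcal T_{\rm st}(\lambda,\mu,\nu)$ is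 the value of the standard invariant trilinear form $\mathcal T_{\rm st}(f_1,f_2,f_3)=\int_Gf_1(w_0n_0y)f_2(w_0y)f_3(y)\,dy$ on the class one vectors $e_\lambda,e_\mu,e_\nu$ of the principal series, where $e_\lambda(ank)=a^{\lambda+\rho}$ for $a\in A$, $n\in N$, $k\in K$. The integral converges absolutely for imaginary parameters. *)

(* Defs.v *)
From HB Require Import structures.
From mathcomp Require Import all_boot all_order all_algebra.
From mathcomp Require Import all_classical all_reals all_analysis.
From mathcomp Require Import complex.

Set Implicit Arguments.
Unset Strict Implicit.
Unset Printing Implicit Defensive.

Import Order.TTheory GRing.Theory Num.Theory.
Import numFieldNormedType.Exports.

Local Open Scope classical_set_scope.
Local Open Scope ring_scope.
Local Open Scope complex_scope.

Section ComplexAnalysis.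
Context {R : realType}.

Definition cabs (z : R[i]) : R := ComplexField.Normc.normc z.

Definition imaginary (z : R[i]) : Prop := complex.Re z = 0.

Definition cexp (z : R[i]) : R[i] :=
  (expR (complex.Re z) * cos (complex.Im z))
    +i* (expR (complex.Re z) * sin (complex.Im z)).

Definition cintegral {dT : measure_display} {T : measurableType dT}
    (mu : {measure set T -> \bar R}) (D : set T) (f : T -> R[i]) : R[i] :=
  (Rintegral mu D (fun x => complex.Re (f x)))
    +i* (Rintegral mu D (fun x => complex.Im (f x))).

(* Integrability of the real and of the imaginary part is the same as
   measurability of f together with absolute convergence of the integral. *)
Definition cintegrable {dT : measure_display} {T : measurableType dT}
    (mu : {measure set T -> \bar R}) (D : set T) (f : T -> R[i]) : Prop :=
  mu.-integrable D (fun x => (complex.Re (f x))%:E) /\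
  mu.-integrable D (fun x => (complex.Im (f x))%:E).

(* Euler's integral: this is the Gamma function on the half plane Re z > 0
   only, with no analytic continuation. *)
Definition cGamma (z : R[i]) : R[i] :=
  cintegral lebesgue_measure `]0, +oo[
    (fun t : R => cexp ((z - 1) * (ln t)%:C) * (expR (- t))%:C).

End ComplexAnalysis.

(* For d >= 1 the size d.-1 + 1 + 1 is d + 1; this form of it makes both the
   splitting d + 1 (for J and K) and the splitting (d - 1) + 1 + 1 (for N)
   available as block decompositions. *)
Notation mat R d := 'M[R]_(d.-1 + 1 + 1).

Notation borel_mat R d := (g_sigma_algebraType (@open (mat R d))).

Section LorentzGroup.
Context {R : realType}.
Variable d : nat.

Definition Jmx : mat R d := block_mx 1%:M 0 0 (-1)%:M.

Definition SOd1 : set (mat R d) :=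
  [set g | \det g = 1 /\ g^T *m Jmx *m g = Jmx].

Definition grpG : set (mat R d) :=
  if (2 < d)%N then connected_component SOd1 1%:M else SOd1.

(* SO(d) in the upper left corner if d > 2; for d = 2 the corner entry det k
   identifies O(2) with a subgroup of SO(2,1). *)
Definition grpK : set (mat R d) :=
  [set g | exists k : 'M[R]_(d.-1 + 1),
     [/\ k^T *m k = 1%:M, (2 < d)%N -> \det k = 1
       & g = block_mx k 0 0 (\det k)%:M]].

Definition idx_d : 'I_(d.-1 + 1 + 1) := lshift 1 (rshift d.-1 ord0).
Definition idx_d1 : 'I_(d.-1 + 1 + 1) := rshift (d.-1 + 1) ord0.

Definition Hmx : mat R d := delta_mx idx_d idx_d1 + delta_mx idx_d1 idx_d.

Definition expmx (X : mat R d) : mat R d :=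
  \matrix_(i, j) limn (fun m : nat => \sum_(k < m) (X ^+ k) i j / (k`!)%:R).

Definition grpA : set (mat R d) := range (fun t : R => expmx (t *: Hmx)).

Definition normsq (x : 'cV[R]_(d.-1)) : R := \sum_i x i 0 ^+ 2.

Definition nmx (x : 'cV[R]_(d.-1)) : mat R d :=
  block_mx
    (block_mx 1%:M (- x)
              x^T  (1 - normsq x / 2)%:M)  (col_mx x (normsq x / 2)%:M)
    (row_mx   x^T  (- (normsq x / 2))%:M)  (1 + normsq x / 2)%:M.

Definition grpN : set (mat R d) := range nmx.

Definition in_ANK (g a : mat R d) : Prop :=
  grpA a /\ exists n k, [/\ grpN n, grpK k & g = a *m n *m k].

(* The A-component of g in G = ANK, unique by the Iwasawa decomposition. *)
Definition iwasawaA (g : mat R d) : mat R d := xget 1%:M [set a | in_ANK g a].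

Definition logA (a : mat R d) : R := xget 0 [set t | a = expmx (t *: Hmx)].

Definition powA (a : mat R d) (l : R[i]) : R[i] := cexp ((logA a)%:C * l).

Definition rho : R[i] := (d.-1)%:R / 2.

(* Indices are 0-based: the entries -1 are those in positions d-1 and d. *)
Definition w0 : mat R d :=
  diag_mx (\row_j if (j == d.-2 :> nat) || (j == d.-1 :> nat) then -1 else 1).

Definition n0 : mat R d := nmx (\col_i (i == 0%N :> nat)%:R).

Definition class_one (l : R[i]) (g : mat R d) : R[i] :=
  powA (iwasawaA g) (l + rho).

(* The Haar measures of the closed subgroup G of matrices, seen through the
   Borel subsets of G; the values of mu on sets not contained in G play no
   role. G is unimodular, so left invariance loses no generality, and it is
   second countable and locally compact, so regularity is automatic. *)
Definition is_haar (mu : {measure set (borel_mat R d) -> \bar R}) : Prop :=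
  [/\ forall (g : mat R d) (B : set (mat R d)),
        grpG g -> measurable (B : set (borel_mat R d)) -> B `<=` grpG ->
        mu ((fun y => g *m y) @` B) = mu B,
      forall C : set (mat R d), compact C -> C `<=` grpG -> (mu C < +oo)%E
    & forall U : set (mat R d), open U -> U `&` grpG !=set0 ->
        (0 < mu (U `&` grpG))%E].

Definition Tst_integrand (f1 f2 f3 : mat R d -> R[i]) (y : mat R d) : R[i] :=
  f1 (w0 *m n0 *m y) * f2 (w0 *m y) * f3 y.

Definition Tst_form (mu : {measure set (borel_mat R d) -> \bar R})
    (f1 f2 f3 : mat R d -> R[i]) : R[i] :=
  cintegral mu grpG (Tst_integrand f1 f2 f3).

Definition Tst (mu : {measure set (borel_mat R d) -> \bar R})
    (l m v : R[i]) : R[i] :=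
  Tst_form mu (class_one l) (class_one m) (class_one v).

Definition Tst_converges (mu : {measure set (borel_mat R d) -> \bar R})
    (l m v : R[i]) : Prop :=
  cintegrable mu grpG
    (Tst_integrand (class_one l) (class_one m) (class_one v)).

End LorentzGroup.

(* Main.v *)
From HB Require Import structures.
From mathcomp Require Import all_boot all_order all_algebra.
From mathcomp Require Import all_classical all_reals all_analysis.
From mathcomp Require Import measurable_realfun complex.
From mathcomp Require Import perm ring lra.
Require Import Defs.

Set Implicit Arguments.
Unset Strict Implicit.
Unset Printing Implicit Defensive.

Import Order.TTheory GRing.Theory Num.Theory.
Import numFieldNormedType.Exports.

Local Open Scope classical_set_scope.
Local Open Scope ring_scope.

(** Let (z, a, b) be the last column of y in G, and put p = b - a, q = b + a.
    The A-components of y, w_0 y and w_0 n_0 y are exp(tH) with e^t equal to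
    C = 1/|p|, B = 1/|q| and A = 1/|q'|, where q' belongs to n_0 y.  Left
    translation by N shifts x = z/p and left translation by exp(tH) scales x
    and C by e^t; by invariance of the Haar measure one may therefore
    integrate out x and C one at a time, and Gaussian integrals give, with
    r = rho = (d-1)/2,
      int_G exp(-u/A - v/B - w/C) dy
        = K int_R exp(-r h - e^h - (uv + uw + vw) e^(-h)) dh.
    Take Mellin transforms in u, v, w at r + lambda, r + mu, r + nu.  The left
    side becomes T_st times three Gamma values; on the right side the
    substitution (u, v, w) -> (uv e^(-h), uw e^(-h), vw e^(-h)), of constant
    Jacobian in logarithmic coordinates, separates four Gamma integrals.
    All this is an identity between positive measures on R^3, so Tonelli's
    theorem suffices and the imaginary parameters enter only through the
    Fourier transform of these measures.

    For the asymptotics, the functional equation moves |Gamma(s + it)| to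
    |Gamma(s + N + it)| with N large compared to t^2, where it is compared
    with Gamma(s + N) by a second moment bound; the logarithms of the factors
    |s + k + it| are summed by comparison with Stirling's main term. *)

(** The Haar measure is never written as a product measure. Along each of the d one-parameter
    subgroups a density of mass one on the orbits is inserted, and invariance moves the integration
    over the orbit onto the integrand. What remains is the mass of a single box, finite because the
    box lies in a compact subset of G and positive because it contains a nonempty open subset of G.
    The symmetric form uv + uw + vw comes from completing a square with weights u and v and then
    putting e^h = (u + v) e^t, where e^t = C. Convergence is an output: the side with four Gamma
    weights is finite, hence so is the group side, and its three Gamma weights have positive mass
    and can be split off. For d = 2 the group has two components and p may be negative; K then
    contains elements that reverse the sign of p, hence the absolute values. On a fixed vertical
    line Gamma is exponentially small through cancellation, so estimates under the integral sign are
    useless there. Far to the right the phase is nearly constant where the weight is concentrated,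
    and such estimates become sharp. *)

(** * Affine substitutions in Lebesgue integrals *)

Section AffineSubstitution.
Context {R : realType}.
Local Open Scope ereal_scope.
Local Notation mu := (@lebesgue_measure R).

(** By uniqueness of Lebesgue measure it suffices to compare it with the scaled image measure on
    half-open intervals. *)
Lemma lebesgue_measure_affine (a b : R) (A : set R) : (a != 0)%R ->
  measurable A ->
  mu A = (`|a|)%:E * mu ((fun x : R => a * x + b)%R @^-1` A).
Proof.
move=> a0 mA.
have mphi : measurable_fun [set: measurableTypeR R]
    ((fun x : R => a * x + b)%R : measurableTypeR R -> measurableTypeR R).
  by apply: measurable_funD => //; exact: measurable_funM.
pose phi := (fun x : R => a * x + b)%R : measurableTypeR R -> measurableTypeR R.
pose m : {measure set (measurableTypeR R) -> \bar R} :=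
  mscale (NngNum (normr_ge0 a)) (pushforward mu phi).
apply: (lebesgue_measure_unique (mu := m mphi)) => // _ [[c e]] _ <-.
rewrite /m /= /mscale /= /pushforward.
pose c' := ((c - b) / a)%R; pose e' := ((e - b) / a)%R.
(* For [a < 0] the map reverses the order, so the preimage is closed on the left and open on the
   right; its length is unaffected. *)
have -> : phi @^-1` `]c, e]%classic =
    if (0 < a)%R then `]c', e']%classic else `[e', c'[%classic.
  apply/seteqP; split => x; case: ifPn => a1;
    rewrite /= !in_itv /= /c' /e' /phi ?ltr_pdivrMr// ?ler_pdivlMr//.
  - by rewrite mulrC => /andP[? ?]; apply/andP; split; lra.
  - have an : (a < 0)%R by rewrite lt_neqAle a0 leNgt.
    rewrite ltr_ndivlMr// ler_ndivrMr// mulrC => /andP[? ?].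
    by apply/andP; split; lra.
  - by rewrite mulrC => /andP[? ?]; apply/andP; split; lra.
  - have an : (a < 0)%R by rewrite lt_neqAle a0 leNgt.
    rewrite ltr_ndivlMr// ler_ndivrMr// mulrC => /andP[? ?].
    by apply/andP; split; lra.
case: ifPn => a1; rewrite !lebesgue_measure_itv /= !lte_fin.
  rewrite ltr_pM2r ?invr_gt0// ltrD2r; case: ifPn => _; last by rewrite mule0.
  by rewrite -!EFinB -EFinM gtr0_norm//; congr EFin; rewrite /c' /e'; field.
have an : (a < 0)%R by rewrite lt_neqAle a0 leNgt.
rewrite ltr_nM2r ?invr_lt0// ltrD2r; case: ifPn => _; last by rewrite mule0.
by rewrite -!EFinB -EFinM ltr0_norm//; congr EFin; rewrite /c' /e'; field.
Qed.

Lemma ge0_integral_affine (a b : R) (f : R -> \bar R) : (a != 0)%R ->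
  measurable_fun [set: R] f -> (forall x, 0 <= f x) ->
  \int[mu]_x f (a * x + b)%R = (`|a|^-1)%:E * \int[mu]_x f x.
Proof.
move=> a0 mf f0.
have mphi : measurable_fun [set: measurableTypeR R]
    ((fun x : R => a * x + b)%R : measurableTypeR R -> measurableTypeR R).
  by apply: measurable_funD => //; exact: measurable_funM.
pose phi := (fun x : R => a * x + b)%R : measurableTypeR R -> measurableTypeR R.
pose m : {measure set (measurableTypeR R) -> \bar R} :=
  mscale (NngNum (normr_ge0 a)) (pushforward mu phi).
rewrite [in RHS](eq_measure_integral (m mphi)); last first.
  by move=> A mA _; exact: lebesgue_measure_affine.
rewrite ge0_integral_mscale//= ge0_integral_pushforward//.
by rewrite muleA -EFinM mulVf ?normr_eq0// mul1e preimage_setT.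
Qed.

Lemma ge0_integral_shift (b : R) (f : R -> \bar R) :
  measurable_fun [set: R] f -> (forall x, 0 <= f x) ->
  \int[mu]_x f (x + b)%R = \int[mu]_x f x.
Proof.
move=> mf f0; have := @ge0_integral_affine 1 b f (oner_neq0 _) mf f0.
by under eq_integral do rewrite mul1r; rewrite normr1 invr1 mul1e.
Qed.

Lemma ge0_integral_reflect (b : R) (f : R -> \bar R) :
  measurable_fun [set: R] f -> (forall x, 0 <= f x) ->
  \int[mu]_x f (b - x)%R = \int[mu]_x f x.
Proof.
move=> mf f0; have := @ge0_integral_affine (-1) b f _ mf f0.
under eq_integral do rewrite mulN1r addrC.
by rewrite normrN1 invr1 mul1e; apply; rewrite oppr_eq0 oner_neq0.
Qed.

End AffineSubstitution.

(** * The substitution t = exp a on the half line *)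

Section ExpSubstitution.
Context {R : realType}.
Local Notation mu := (@lebesgue_measure R).

Lemma bigcup_itv_expR :
  \bigcup_n `[expR (- n%:R), expR n%:R]%classic = `]0, +oo[%classic :> set R.
Proof.
apply/seteqP; split => x /=.
  move=> [n _] /=; rewrite !in_itv /= andbT => /andP[+ _].
  exact/lt_le_trans/expR_gt0.
rewrite in_itv /= andbT => x0; exists (Num.trunc `|ln x|).+1 => //=.
have h : `|ln x| <= (Num.trunc `|ln x|).+1%:R by apply/ltW/truncnS_gt.
move: h; rewrite ler_norml => /andP[h1 h2].
rewrite in_itv /=.
by rewrite -[X in _ <= X <= _](lnK x0) !ler_expR h1 h2.
Qed.

Lemma bigcup_itv_sym : \bigcup_n `[- n%:R, n%:R]%classic = setT :> set R.
Proof.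
apply/seteqP; split => x //= _; exists (Num.trunc `|x|).+1 => //=.
by rewrite in_itv /= -ler_norml; apply/ltW/truncnS_gt.
Qed.

(** The substitution rule is applied on the compact intervals [-n, n] and [exp(-n), exp n]; monotone
    convergence gives the half line. *)
Lemma ge0_integral_expR (f : R -> R) : {in `]0, +oo[, continuous f} ->
  (forall x : R, 0 < x -> 0 <= f x) ->
  (\int[mu]_(t in `]0%R, +oo[) (f t)%:E =
   \int[mu]_a (f (expR a) * expR a)%:E)%E.
Proof.
move=> cf f0.
have mf : measurable_fun (`]0%R, +oo[ : set R) f.
  apply: open_continuous_measurable_fun => //.
  by move=> x; rewrite inE; exact: cf.
have cg : continuous (fun a : R => f (expR a) * expR a).
  move=> x; apply: cvgM; last exact: continuous_expR.
  by apply: continuous_comp; [exact: continuous_expR|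
    apply: cf; rewrite in_itv /= expR_gt0].
have mg := continuous_measurable_fun cg.
have sub n : `[expR (- n%:R), expR n%:R]%classic `<=` (`]0, +oo[%classic : set R).
  by move=> x xn; rewrite -bigcup_itv_expR; exists n.
rewrite -bigcup_itv_expR -bigcup_itv_sym.
have h1 : (\int[mu]_(x in `[(- n%:R)%R, n%:R%R]) (f (expR x) * expR x)%:E)%E
    @[n --> \oo] --> (\int[mu]_(a in \bigcup_n `[(- n%:R)%R, n%:R%R]%classic)
                        (f (expR a) * expR a)%:E)%E.
  apply: ge0_nondecreasing_set_cvg_integral => //=.
  - move=> m n mn; apply/subsetPset => x /=; rewrite !in_itv /= -!ler_norml.
    by move=> /le_trans; apply; rewrite ler_nat.
  - by move=> n; apply/measurable_EFinP; exact: measurable_funTS.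
  - by move=> n x _; rewrite lee_fin mulr_ge0 ?expR_ge0// f0// expR_gt0.
have h2 : (\int[mu]_(x in `[expR (- n%:R)%R, expR n%:R%R]) (f x)%:E)%E
    @[n --> \oo] --> (\int[mu]_(a in \bigcup_n `[expR (- n%:R)%R, expR n%:R%R]%classic)
                        (f a)%:E)%E.
  apply: ge0_nondecreasing_set_cvg_integral => //=.
  - move=> m n mn; apply/subsetPset => x /=; rewrite !in_itv /=.
    move=> /andP[h3 h4]; apply/andP; split.
      by apply: le_trans h3; rewrite ler_expR lerN2 ler_nat.
    by apply: le_trans h4 _; rewrite ler_expR ler_nat.
  - by move=> n; apply/measurable_EFinP; apply: measurable_funS mf.
  - by move=> n x /sub; rewrite /= in_itv /= andbT lee_fin; exact: f0.
rewrite -(cvg_lim _ h1)// -(cvg_lim _ h2)//; congr (limn _); apply/funext => n.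
have dE : expR^`()%classic = expR :> (R -> R).
  by apply/funext => y; rewrite derive1E derive_val.
rewrite integration_by_substitution_increasing ?dE//.
- by rewrite -subr_ge0 opprK addr_ge0.
- by move=> x y _ _; rewrite ltr_expR.
- by move=> x _; exact: continuous_expR.
- by apply: (cvgP (expR _)); apply: cvg_at_right_filter; exact: continuous_expR.
- by apply: (cvgP (expR _)); apply: cvg_at_left_filter; exact: continuous_expR.
- split => [x _||]; first exact: derivable_expR.
    by apply: cvg_at_right_filter; exact: continuous_expR.
  by apply: cvg_at_left_filter; exact: continuous_expR.
- by apply: continuous_in_subspaceT => x; rewrite inE => /sub /= h; exact: cf.
Qed.

(** Positive and negative parts are substituted separately, so no integrability is assumed. *)
Lemma integral_expR (f : R -> R) : {in `]0, +oo[, continuous f} ->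
  (\int[mu]_(t in `]0%R, +oo[) (f t)%:E =
   \int[mu]_a (f (expR a) * expR a)%:E)%E.
Proof.
move=> cf; rewrite integralE [RHS]integralE; congr (_ - _)%E.
  rewrite (_ : (fun x => _) = (fun x => (Num.max (f x) 0)%:E)); last first.
    by apply/funext => x; rewrite funeposE EFin_max.
  rewrite ge0_integral_expR//.
  - by apply: eq_integral => x _; rewrite funeposE -EFin_max maxr_pMl ?expR_ge0// mul0r.
  - by move=> x x0; apply: continuous_max; [exact: cf|exact: cst_continuous].
  - by move=> x _; rewrite le_max lexx orbT.
rewrite (_ : (fun x => _) = (fun x => (Num.max (- f x) 0)%:E)); last first.
  by apply/funext => x; rewrite funenegE EFin_max.
rewrite ge0_integral_expR//.
- by apply: eq_integral => x _; rewrite funenegE -EFinN -EFin_max maxr_pMl ?expR_ge0// mul0r mulNr.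
- move=> x x0; apply: (@continuous_max _ R (fun t => - f t) (cst 0)); last exact: cst_continuous.
  by apply: cvgN; exact: cf.
- by move=> x _; rewrite le_max lexx orbT.
Qed.

End ExpSubstitution.

(** * The Gamma integral in logarithmic coordinates *)

Section GammaWeight.
Context {R : realType}.
Local Open Scope complex_scope.
Local Notation mu := (@lebesgue_measure R).

(** Euler's integrand t^s e^(-t) with respect to dt/t, read at t = exp a. In this coordinate a
    Mellin transform is a Fourier transform and dt/t is Lebesgue measure. *)
Definition gweight (s a : R) : R := expR (s * a - expR a).

Lemma gweight_ge0 s a : 0 <= gweight s a.
Proof. exact: expR_ge0. Qed.

Lemma continuous_gweight s : continuous (gweight s).
Proof.
move=> x; apply: continuous_comp; last exact: continuous_expR.
apply: cvgB; last exact: continuous_expR.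
by apply: cvgM; [exact: cvg_cst|exact: cvg_id].
Qed.

Lemma measurable_gweight s : measurable_fun [set: R] (gweight s).
Proof. by apply: continuous_measurable_fun; exact: continuous_gweight. Qed.

Lemma gweightD1 s a : gweight (s + 1) a = gweight s a * expR a.
Proof. by rewrite /gweight -expRD; congr expR; ring. Qed.

Lemma gweight_le_expRM s a : gweight s a <= expR (s * a).
Proof. by rewrite ler_expR gerBl expR_ge0. Qed.

(** The function (s + 1) a - exp a is largest at a = ln(s + 1); the tangent line of exp at that
    point gives the bound. *)
Lemma gweight_le_expRN s a : 0 < s ->
  gweight s a <= expR ((s + 1) * (ln (s + 1) - 1)) * expR (- a).
Proof.
move=> s0; rewrite -expRD ler_expR.
have s1 : 0 < s + 1 by rewrite addr_gt0.
have := expR_ge1Dx (a - ln (s + 1)); rewrite expRB lnK//.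
rewrite ler_pdivlMr// => h; nra.
Qed.

Lemma exponential_pdf_ifE (c a : R) :
  exponential_pdf c a = if 0 <= a then c * expR (- (c * a)) else 0.
Proof.
rewrite /exponential_pdf patchE; case: ifPn.
  by rewrite inE /= in_itv /= andbT => ->; rewrite mulNr.
by rewrite notin_setE /= in_itv /= andbT => /negP/negbTE ->.
Qed.

Lemma integrable_exponential_pdfN (c : R) : 0 < c ->
  mu.-integrable [set: R] (fun a => (exponential_pdf c (- a))%:E).
Proof.
move=> c0; have h0 x : 0 <= exponential_pdf c x by exact: exponential_pdf_ge0 (ltW c0) x.
have mpdf : measurable_fun [set: R] (exponential_pdf c) by exact: measurable_exponential_pdf.
apply/integrableP; split.
  apply/measurable_EFinP; apply: (measurableT_comp mpdf); exact: measurable_funN.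
under eq_integral do rewrite gee0_abs ?lee_fin//.
under eq_integral do rewrite -sub0r.
rewrite (@ge0_integral_reflect R 0 (fun x => (exponential_pdf c x)%:E))//.
  by rewrite integral_exponential_pdf// ltry.
exact/measurable_EFinP.
Qed.

Definition gweight_const (s : R) : R := 1 + expR ((s + 1) * (ln (s + 1) - 1)).

Lemma gweight_const_ge1 s : 1 <= gweight_const s.
Proof. by rewrite lerDl expR_ge0. Qed.

(** Integrability of the weight is reduced to the mass of two exponential densities, one for each
    half line; dividing by [s] undoes the normalisation of the left one. *)
Lemma gweight_le_pdf (s a : R) : 0 < s ->
  gweight s a <= gweight_const s * exponential_pdf 1 a
                 + gweight_const s / s * exponential_pdf s (- a).
Proof.
move=> s0; have C1 := gweight_const_ge1 s.
have C2 : expR ((s + 1) * (ln (s + 1) - 1)) <= gweight_const s by rewrite lerDr.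
rewrite !exponential_pdf_ifE oppr_ge0 !mul1r mulrN opprK.
have h1 := gweight_le_expRM s a; have h2 := gweight_le_expRN a s0.
have e1 := expR_gt0 (- a); have e2 := expR_gt0 (s * a).
have [a0|a0] := leP 0 a; last first.
  rewrite (ltW a0) mulr0 add0r mulrA divfK ?gt_eqF//.
  by apply: le_trans h1 _; rewrite ler_peMl// ltW.
apply: le_trans h2 _.
apply: (@le_trans _ _ (gweight_const s * expR (- a))).
  by rewrite ler_wpM2r// ltW.
rewrite lerDl mulr_ge0 ?divr_ge0 ?(ltW s0) ?(le_trans _ C1)//.
by case: ifP => // _; rewrite mulr_ge0 ?(ltW s0)// ltW.
Qed.

Lemma integrable_gweight (s : R) : 0 < s ->
  mu.-integrable [set: R] (fun a => (gweight s a)%:E).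
Proof.
move=> s0; pose C := gweight_const s.
have C0 : 0 <= C by exact: le_trans (gweight_const_ge1 s).
apply: (@le_integrable _ _ R mu _ _ _ (fun a : R =>
    ((C * exponential_pdf 1 a)%:E + (C / s * exponential_pdf s (- a))%:E)%E)) => //.
- by apply/measurable_EFinP; exact: measurable_gweight.
- move=> a _; rewrite -EFinD !abse_EFin lee_fin ger0_norm ?gweight_ge0//.
  by apply: le_trans (ler_norm _); exact: gweight_le_pdf.
- apply: integrableD => //.
  + exact: (integrableZl measurableT C (integrable_exponential_pdf ltr01)).
  + exact: (integrableZl measurableT (C / s) (integrable_exponential_pdfN s0)).
Qed.

Lemma Rintegral_gweight_gt0 (s : R) : 0 < s -> 0 < Rintegral mu setT (gweight s).
Proof.
move=> s0; have i1 := integrable_gweight s0; rewrite /Rintegral.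
rewrite fine_gt0//; apply/andP; split; last first.
  by rewrite ltey_eq (integrable_fin_num measurableT i1).
have : (\int[mu]_(x in `[0%R, 1%R]) (expR (- expR 1))%:E <= \int[mu]_x (gweight s x)%:E)%E.
  apply: (@le_trans _ _ (\int[mu]_(x in `[0%R, 1%R]) (gweight s x)%:E)%E).
    apply: ge0_le_integral => //.
    - by apply/measurable_EFinP; exact: measurable_funTS (measurable_gweight s).
    - move=> x /=; rewrite in_itv /= => /andP[x0 x1]; rewrite lee_fin ler_expR.
      have h1 : expR x <= expR 1 by rewrite ler_expR.
      have h2 : 0 <= s * x by rewrite mulr_ge0// ltW.
      by apply: le_trans (_ : - expR x <= _); [rewrite lerN2|rewrite lerDr].
  apply: ge0_subset_integral => //.
  - by apply/measurable_EFinP; exact: measurable_gweight.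
  - by move=> x _; rewrite lee_fin gweight_ge0.
apply: lt_le_trans; rewrite integral_cst//= lebesgue_measure_itv/= lte_fin ltr01.
by rewrite sube0 mule1 lte_fin expR_gt0.
Qed.

(** There is no condition on [z]: [integral_expR] is valid whether or not the integral converges. *)
Lemma cGammaE (z : R[i]) : cGamma z =
  (\int[mu]_a (gweight (complex.Re z) a * cos (complex.Im z * a)))%R +i*
  (\int[mu]_a (gweight (complex.Re z) a * sin (complex.Im z * a)))%R.
Proof.
case: z => x y; rewrite /cGamma /cintegral /=.
have E (f : R -> R) : continuous f ->
  (\int[mu]_(t in `]0%R, +oo[) (expR ((x - 1) * ln t) * f (y * ln t) * expR (- t)))%R
  = (\int[mu]_a (gweight x a * f (y * a)))%R.
  move=> cf; rewrite /Rintegral integral_expR; last first.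
    move=> t; rewrite in_itv /= andbT => t0.
    have cl : {for t, continuous (@ln R)} by exact: continuous_ln.
    apply: cvgM; last first.
      apply: continuous_comp; last exact: continuous_expR.
      exact: opp_continuous.
    apply: cvgM.
      apply: continuous_comp; last exact: continuous_expR.
      by apply: cvgM => //; exact: cvg_cst.
    apply: continuous_comp; last exact: cf.
    by apply: cvgM => //; exact: cvg_cst.
  congr fine; apply: eq_integral => a _; congr EFin.
  rewrite expRK /gweight.
  have -> : x * a - expR a = (x - 1) * a - expR a + a by ring.
  by rewrite !expRD; ring.
congr (_ +i* _).
  rewrite -(E cos) ; last exact: continuous_cos.
  by apply: eq_Rintegral => t _ /=; rewrite !(mulr0, mul0r, subr0, addr0, add0r, oppr0).
rewrite -(E sin) ; last exact: continuous_sin.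
by apply: eq_Rintegral => t _ /=; rewrite !(mulr0, mul0r, subr0, addr0, add0r, oppr0).
Qed.

End GammaWeight.

(** * Products of sigma-finite measures *)

Section SigmaFiniteProduct.
Context {d1 d2 : measure_display} {T1 : measurableType d1}
  {T2 : measurableType d2} {R : realType}.
Variables (m1 : {sigma_finite_measure set T1 -> \bar R}).
Variables (m2 : {sigma_finite_measure set T2 -> \bar R}).
Local Open Scope ereal_scope.

Lemma sigma_finite_product : sigma_finite setT (m1 \x m2).
Proof.
have /sigma_finiteP[F [FT ndF Foo]] := sigma_finiteT m1.
have /sigma_finiteP[G [GT ndG Goo]] := sigma_finiteT m2.
exists (fun n => F n `*` G n) => [|n]; last first.
  have [mF Fn] := Foo n; have [mG Gn] := Goo n; split; first exact: measurableX.
  by rewrite product_measure1E// lte_mul_pinfty// ge0_fin_numE.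
apply/seteqP; split => // -[x y] _.
have [i _ Fx] : (\bigcup_n F n) x by rewrite -FT.
have [j _ Gy] : (\bigcup_n G n) y by rewrite -GT.
exists (maxn i j) => //; split => /=.
- by have /subsetPset := ndF _ _ (leq_maxl i j); exact.
- by have /subsetPset := ndG _ _ (leq_maxr i j); exact.
Qed.

(** A named product measure to which sigma-finiteness is attached, so that products can be
    iterated. *)
Definition sfprod : set (T1 * T2) -> \bar R := m1 \x m2.
HB.instance Definition _ := Measure.on sfprod.
HB.instance Definition _ :=
  Measure_isSigmaFinite.Build _ _ _ sfprod sigma_finite_product.

Lemma sfprod_tonelli (f : T1 * T2 -> \bar R) :
  measurable_fun setT f -> (forall z, 0 <= f z) ->
  \int[sfprod]_z f z = \int[m1]_x \int[m2]_y f (x, y).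
Proof. by move=> mf f0; exact: fubini_tonelli1. Qed.

End SigmaFiniteProduct.
Arguments sfprod_tonelli {d1 d2 T1 T2 R m1 m2} [f].

(** * Complex integrals and Fourier transforms of weighted measures *)

Section ComplexIntegral.
Context {R : realType}.
Local Open Scope complex_scope.

Definition cis (t : R) : R[i] := cos t +i* sin t.

Lemma cisD s t : cis (s + t) = cis s * cis t.
Proof. by rewrite /cis cosD sinD; congr (_ +i* _); ring. Qed.

Lemma complex_eqP (x y : R[i]) :
  complex.Re x = complex.Re y -> complex.Im x = complex.Im y -> x = y.
Proof. by case: x => a b; case: y => c e /= -> ->. Qed.

Section ProductMeasure.
Context {d1 d2 : measure_display} {T1 : measurableType d1} {T2 : measurableType d2}.
Variables (m1 : {sigma_finite_measure set T1 -> \bar R}).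
Variables (m2 : {sigma_finite_measure set T2 -> \bar R}).

Lemma integrable_prodM (f : T1 -> R) (g : T2 -> R) :
  m1.-integrable setT (fun x => (f x)%:E) ->
  m2.-integrable setT (fun x => (g x)%:E) ->
  (sfprod m1 m2).-integrable setT (fun z => (f z.1 * g z.2)%:E).
Proof.
move=> /integrableP[mf intf] /integrableP[mg intg].
have mf' : measurable_fun setT f by exact/measurable_EFinP.
have mg' : measurable_fun setT g by exact/measurable_EFinP.
have mfg : measurable_fun setT (fun z : T1 * T2 => (f z.1 * g z.2)%:E).
  apply/measurable_EFinP; apply: measurable_funM.
    exact: (measurableT_comp mf' measurable_fst).
  exact: (measurableT_comp mg' measurable_snd).
apply/integrable12ltyP => //=.
under eq_integral => x _.
  under eq_integral => y _ do rewrite normrM EFinM -!abse_EFin.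
  rewrite ge0_integralZl//; last exact: measurableT_comp.
  over.
rewrite ge0_integralZr//; last 2 first.
- exact: measurableT_comp.
- by apply: integral_ge0.
by apply: lte_mul_pinfty => //; [exact: integral_ge0| rewrite ge0_fin_numE//; exact: integral_ge0].
Qed.

Lemma Rintegral_prodM (f : T1 -> R) (g : T2 -> R) :
  m1.-integrable setT (fun x => (f x)%:E) ->
  m2.-integrable setT (fun x => (g x)%:E) ->
  Rintegral (sfprod m1 m2) setT (fun z => f z.1 * g z.2) =
  Rintegral m1 setT f * Rintegral m2 setT g.
Proof.
move=> intf intg; rewrite /Rintegral -integral12_prod_meas1; last exact: integrable_prodM.
rewrite /fubini_F /=.
under eq_integral => x _.
  under eq_integral => y _ do rewrite EFinM.
  rewrite integralZl//; over.
have fing : (\int[m2]_x (g x)%:E)%E \is a fin_num by exact: integrable_fin_num.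
have finf : (\int[m1]_x (f x)%:E)%E \is a fin_num by exact: integrable_fin_num.
rewrite -(fineK fing) integralZr//.
by rewrite -(fineK finf) -EFinM.
Qed.

Lemma cintegrable_prodM (f : T1 -> R[i]) (g : T2 -> R[i]) :
  cintegrable m1 setT f -> cintegrable m2 setT g ->
  cintegrable (sfprod m1 m2) setT (fun z => f z.1 * g z.2).
Proof.
move=> [rf imf] [rg img]; split.
- have := integrableB measurableT (integrable_prodM rf rg) (integrable_prodM imf img).
  apply: eq_integrable => // z _ /=.
  by case: (f z.1) => a b; case: (g z.2) => c e.
- have := integrableD measurableT (integrable_prodM rf img) (integrable_prodM imf rg).
  apply: eq_integrable => // z _ /=.
  by case: (f z.1) => a b; case: (g z.2) => c e.
Qed.

Lemma cintegral_prodM (f : T1 -> R[i]) (g : T2 -> R[i]) :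
  cintegrable m1 setT f -> cintegrable m2 setT g ->
  cintegral (sfprod m1 m2) setT (fun z => f z.1 * g z.2) =
  cintegral m1 setT f * cintegral m2 setT g.
Proof.
move=> [rf imf] [rg img].
have E1 : Rintegral (sfprod m1 m2) setT (fun z => complex.Re (f z.1 * g z.2)) =
    Rintegral m1 setT (fun x => complex.Re (f x)) * Rintegral m2 setT (fun x => complex.Re (g x))
    - Rintegral m1 setT (fun x => complex.Im (f x)) * Rintegral m2 setT (fun x => complex.Im (g x)).
  rewrite -!Rintegral_prodM// -RintegralB//; last 2 first.
  - exact: (integrable_prodM rf rg).
  - exact: (integrable_prodM imf img).
  by apply: eq_Rintegral => z _ /=; case: (f z.1) => a b; case: (g z.2) => c e.
have E2 : Rintegral (sfprod m1 m2) setT (fun z => complex.Im (f z.1 * g z.2)) =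
    Rintegral m1 setT (fun x => complex.Re (f x)) * Rintegral m2 setT (fun x => complex.Im (g x))
    + Rintegral m1 setT (fun x => complex.Im (f x)) * Rintegral m2 setT (fun x => complex.Re (g x)).
  rewrite -!Rintegral_prodM// -RintegralD//; last 2 first.
  - exact: (integrable_prodM rf img).
  - exact: (integrable_prodM imf rg).
  by apply: eq_Rintegral => z _ /=; case: (f z.1) => a b; case: (g z.2) => c e.
by rewrite /cintegral E1 E2.
Qed.

End ProductMeasure.

(* Two weighted measures with proportional images have proportional Fourier
   transforms; only nonnegative test functions are needed, as h = (h + 1) - 1. *)
Section Transfer.
Context {d1 d2 d3 : measure_display} {T1 : measurableType d1}
  {T2 : measurableType d2} {Y : measurableType d3}.
Variables (m1 : {measure set T1 -> \bar R}) (m2 : {measure set T2 -> \bar R}).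
Variables (W1 : T1 -> R) (W2 : T2 -> R) (p1 : T1 -> Y) (p2 : T2 -> Y) (C : R).
Hypothesis W1_ge0 : forall x, 0 <= W1 x.
Hypothesis W2_ge0 : forall x, 0 <= W2 x.
Hypothesis mW1 : measurable_fun setT W1.
Hypothesis mp1 : measurable_fun setT p1.
Hypothesis mp2 : measurable_fun setT p2.
Hypothesis intW2 : m2.-integrable setT (fun x => (W2 x)%:E).
Hypothesis transfer : forall phi : Y -> R, measurable_fun setT phi ->
  (forall y, 0 <= phi y) ->
  (\int[m1]_x (phi (p1 x) * W1 x)%:E = C%:E * \int[m2]_x (phi (p2 x) * W2 x)%:E)%E.

(** The test function 1 carries finiteness from the second measure to the first. Absolute
    convergence on the group comes from here. *)
Lemma transfer_integrable : m1.-integrable setT (fun x => (W1 x)%:E).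
Proof.
have mone : measurable_fun [set: Y] (fun=> 1 : R) by [].
have E := transfer mone (fun=> ler01).
apply/integrableP; split; first exact/measurable_EFinP.
under eq_integral => x _ do rewrite gee0_abs ?lee_fin// -(mul1r (W1 x)).
rewrite E; under eq_integral do rewrite mul1r.
by rewrite -(fineK (integrable_fin_num _ intW2))// -EFinM ltry.
Qed.

Lemma integrable_bounded_weight (d : measure_display) (T : measurableType d)
    (m : {measure set T -> \bar R}) (h W : T -> R) :
  measurable_fun setT h -> (forall x, `|h x| <= 1) ->
  m.-integrable setT (fun x => (W x)%:E) ->
  m.-integrable setT (fun x => (h x * W x)%:E).
Proof.
move=> mh h1 intW; have mW : measurable_fun setT W.
  by apply/measurable_EFinP; exact: measurable_int intW.
apply: (le_integrable measurableT _ _ intW).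
  by apply/measurable_EFinP; exact: measurable_funM.
move=> x _ /=; rewrite lee_fin normrM -[leRHS]mul1r.
by rewrite ler_wpM2r.
Qed.

Lemma transfer_Rintegral (h : Y -> R) : measurable_fun setT h ->
  (forall y, `|h y| <= 1) ->
  Rintegral m1 setT (fun x => h (p1 x) * W1 x) =
  C * Rintegral m2 setT (fun x => h (p2 x) * W2 x).
Proof.
move=> mh h1.
have intW1 := transfer_integrable.
have i1 : m1.-integrable setT (fun x => (h (p1 x) * W1 x)%:E).
  by apply: integrable_bounded_weight => //; exact: measurableT_comp.
have i2 : m2.-integrable setT (fun x => (h (p2 x) * W2 x)%:E).
  by apply: integrable_bounded_weight => //; exact: measurableT_comp.
have mh1 : measurable_fun [set: Y] (fun y => h y + 1) by exact: measurable_funD.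
have h10 y : 0 <= h y + 1.
  by have := h1 y; rewrite ler_norml => /andP[+ _]; lra.
have E1 : Rintegral m1 setT (fun x => (h (p1 x) + 1) * W1 x) =
    C * Rintegral m2 setT (fun x => (h (p2 x) + 1) * W2 x).
  rewrite /Rintegral (transfer mh1 h10) fineM//.
  have := integrableD measurableT i2 intW2; move/(integrable_fin_num measurableT).
  by under eq_integral => x _ do rewrite /= -EFinD -[X in _ + X]mul1r -mulrDl.
have E2 : Rintegral m1 setT W1 = C * Rintegral m2 setT W2.
  rewrite /Rintegral.
  under eq_integral do rewrite -[W1 _]mul1r.
  rewrite (@transfer (cst 1))//; under eq_integral do rewrite mul1r.
  by rewrite fineM//; exact: integrable_fin_num.
have D1 : Rintegral m1 setT (fun x => (h (p1 x) + 1) * W1 x) =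
    Rintegral m1 setT (fun x => h (p1 x) * W1 x) + Rintegral m1 setT W1.
  by rewrite -RintegralD//; apply: eq_Rintegral => x _; rewrite mulrDl mul1r.
have D2 : Rintegral m2 setT (fun x => (h (p2 x) + 1) * W2 x) =
    Rintegral m2 setT (fun x => h (p2 x) * W2 x) + Rintegral m2 setT W2.
  by rewrite -RintegralD//; apply: eq_Rintegral => x _; rewrite mulrDl mul1r.
by move: E1; rewrite D1 D2 E2 mulrDr => /addIr.
Qed.

Lemma transfer_cis (t : Y -> R) : measurable_fun setT t ->
  cintegral m1 setT (fun x => cis (t (p1 x)) * (W1 x)%:C) =
  C%:C * cintegral m2 setT (fun x => cis (t (p2 x)) * (W2 x)%:C).
Proof.
move=> mt.
have mc : measurable_fun setT (fun y => cos (t y)).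
  by apply: measurableT_comp mt; apply: continuous_measurable_fun; exact: continuous_cos.
have ms : measurable_fun setT (fun y => sin (t y)).
  by apply: measurableT_comp mt; apply: continuous_measurable_fun; exact: continuous_sin.
have c1 y : `|cos (t y)| <= 1 by rewrite ler_norml cos_geN1 cos_le1.
have s1 y : `|sin (t y)| <= 1 by rewrite ler_norml sin_geN1 sin_le1.
rewrite /cintegral /=.
under eq_Rintegral do rewrite mulr0 subr0.
under [X in _ +i* X]eq_Rintegral do rewrite mulr0 add0r.
under [X in _ = _ * (X +i* _)]eq_Rintegral do rewrite mulr0 subr0.
under [X in _ = _ * (_ +i* X)]eq_Rintegral do rewrite mulr0 add0r.
rewrite (transfer_Rintegral mc c1) (transfer_Rintegral ms s1).
by apply: complex_eqP; rewrite /= !(mul0r, subr0, addr0).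
Qed.

End Transfer.

Lemma cintegrable_cis (d : measure_display) (T : measurableType d)
    (m : {measure set T -> \bar R}) (t W : T -> R) :
  measurable_fun setT t -> m.-integrable setT (fun x => (W x)%:E) ->
  cintegrable m setT (fun x => cis (t x) * (W x)%:C).
Proof.
move=> mt iW.
have c1 y : `|cos (t y)| <= 1 by rewrite ler_norml cos_geN1 cos_le1.
have s1 y : `|sin (t y)| <= 1 by rewrite ler_norml sin_geN1 sin_le1.
have mc : measurable_fun setT (fun y => cos (t y)).
  by apply: measurableT_comp mt; apply: continuous_measurable_fun; exact: continuous_cos.
have ms : measurable_fun setT (fun y => sin (t y)).
  by apply: measurableT_comp mt; apply: continuous_measurable_fun; exact: continuous_sin.
split.
- apply: eq_integrable (integrable_bounded_weight mc c1 iW) => // x _ /=.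
  by rewrite mulr0 subr0.
- apply: eq_integrable (integrable_bounded_weight ms s1 iW) => // x _ /=.
  by rewrite mulr0 add0r.
Qed.

Lemma cintegrable_gamma (s t : R) : 0 < s ->
  cintegrable (@lebesgue_measure R) setT (fun a => cis (t * a) * (gweight s a)%:C).
Proof.
move=> s0; apply: cintegrable_cis; last exact: integrable_gweight.
exact: measurable_funM.
Qed.

Lemma cGamma_cintegral (s t : R) : cGamma (s +i* t) =
  cintegral (@lebesgue_measure R) setT (fun a => cis (t * a) * (gweight s a)%:C).
Proof.
rewrite cGammaE /cintegral /=; congr (_ +i* _); apply: eq_Rintegral => x _ /=.
  by rewrite mulr0 subr0 mulrC.
by rewrite mulr0 add0r mulrC.
Qed.

End ComplexIntegral.

Global Opaque sfprod.

(** * The triple Mellin transform *)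

(* Purely syntactic: letting unification try [measurable_funM] on [expR _]
   unfolds the exponential series. *)
Ltac mfun := repeat
  match goal with
  | |- measurable_fun _ (fun z => z) => exact: measurable_id
  | |- measurable_fun _ (fun z => fst z) => exact: measurable_fst
  | |- measurable_fun _ (fun z => snd z) => exact: measurable_snd
  | |- measurable_fun _ (fun z => ?c) => exact: measurable_cst
  | |- measurable_fun _ (fun z => (_, _)) => apply: measurable_fun_pair
  | |- measurable_fun _ (fun z => (_ + _)%R) => apply: measurable_funD
  | |- measurable_fun _ (fun z => (_ * _)%R) => apply: measurable_funM
  | |- measurable_fun _ (fun z => (- _)%R) => apply: measurable_funN
  | |- measurable_fun _ (fun z => expR _) =>
      apply: (measurableT_comp (@measurable_expR _))
  | |- measurable_fun _ (fun z => gweight _ _) =>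
      apply: (measurableT_comp (measurable_gweight _))
  | |- measurable_fun _ (fun z => fst _) => apply: (measurableT_comp measurable_fst)
  | |- measurable_fun _ (fun z => snd _) => apply: (measurableT_comp measurable_snd)
  | H : measurable_fun _ ?g |- measurable_fun _ ?g => exact: H
  | H : measurable_fun _ ?g |- measurable_fun _ (fun z => ?g _) =>
      apply: (measurableT_comp H)
  | |- measurable_fun _ (+%R _) => apply: measurable_funD
  | |- measurable_fun _ ( *%R _) => apply: measurable_funM
  | |- measurable_fun _ (gweight _) => exact: measurable_gweight
  | |- measurable_fun _ expR => exact: measurable_expR
  | |- measurable_fun _ -%R => apply: measurable_funN
  | |- measurable_fun _ _ => first
      [exact: measurable_id | exact: measurable_fst | exact: measurable_snd
      | exact: measurable_cst]
  end.

Section IteratedIntegrals.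
Context {R : realType}.
Local Open Scope ereal_scope.
Local Notation L := (@lebesgue_measure R).
Local Notation L3 := (sfprod L (sfprod L L)).
Implicit Types F : R * (R * R) -> \bar R.

Lemma tonelli3 F : measurable_fun setT F -> (forall z, 0 <= F z) ->
  \int[L3]_z F z = \int[L]_u \int[L]_v \int[L]_w F (u, (v, w)).
Proof.
move=> mF F0; rewrite sfprod_tonelli//.
apply: eq_integral => u _; rewrite (@sfprod_tonelli _ _ _ _ R L L (fun z => F (u, z)))//.
by apply: (measurableT_comp mF); mfun.
Qed.

Lemma ge0_integral3_shift (a b c : R) F :
  measurable_fun setT F -> (forall z, 0 <= F z) ->
  \int[L3]_z F (z.1 + a, (z.2.1 + b, z.2.2 + c))%R = \int[L3]_z F z.
Proof.
move=> mF F0.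
have mF' : measurable_fun setT (fun z : R * (R * R) =>
    F (z.1 + a, (z.2.1 + b, z.2.2 + c))%R).
  by apply: (measurableT_comp mF); mfun.
rewrite (tonelli3 mF F0) (tonelli3 mF' (fun=> F0 _)) /=.
under eq_integral => u _.
  under eq_integral => v _.
    rewrite (@ge0_integral_shift R c (fun w => F (u + a, (v + b, w))%R))//; last first.
      by apply: (measurableT_comp mF); mfun.
    over.
  rewrite (@ge0_integral_shift R b (fun v => \int[L]_w F (u + a, (v, w))%R)); last 2 first.
  - apply: (@measurable_fun_fubini_tonelli_F _ _ _ _ R L
      (fun z : R * R => F (u + a, z)%R)) => //.
    by apply: (measurableT_comp mF); mfun.
  - by move=> v; exact: integral_ge0.
  over.
rewrite (@ge0_integral_shift R a (fun u => \int[L]_v \int[L]_w F (u, (v, w))%R))//.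
- apply: (@measurable_fun_fubini_tonelli_F _ _ _ _ R L
      (fun z : R * R => \int[L]_w F (z.1, (z.2, w)))) => //.
  + apply: (@measurable_fun_fubini_tonelli_F _ _ _ _ R L
      (fun z : (R * R) * R => F (z.1.1, (z.1.2, z.2)))) => //.
    by apply: (measurableT_comp mF); mfun.
  + by move=> z; exact: integral_ge0.
- by move=> u; apply: integral_ge0 => v _; exact: integral_ge0.
Qed.

(* The linear map has determinant 2 up to sign. *)
Lemma ge0_integral3_pairsums (p : R) F :
  measurable_fun setT F -> (forall z, 0 <= F z) ->
  \int[L3]_z F z =
  2%:E * \int[L3]_z F (z.1 + z.2.1 - p, (z.1 + z.2.2 - p, z.2.1 + z.2.2 - p))%R.
Proof.
move=> mF F0.
have mF' : measurable_fun setT (fun z : R * (R * R) =>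
    F (z.1 + z.2.1 - p, (z.1 + z.2.2 - p, z.2.1 + z.2.2 - p))%R).
  by apply: (measurableT_comp mF); mfun.
rewrite (tonelli3 mF F0) (tonelli3 mF' (fun=> F0 _)) /=.
(* Shifting [w], then [v], turns the third and the first sum into coordinates. The second sum is
   then affine in [u] with slope 2, so [u] is moved to the innermost place and rescaled. *)
under [in RHS]eq_integral => u _.
  under eq_integral => v _.
    rewrite (_ : (fun w : R => F (u + v - p, (u + w - p, v + w - p))%R) =
      (fun w => (fun w => F (u + v - p, (u - v + w, w))%R) (w + (v - p))%R)); last first.
      by apply/funext => w /=; congr (F (_, (_, _))); ring.
    rewrite (@ge0_integral_shift R (v - p) (fun w => F (u + v - p, (u - v + w, w))%R))//; last first.
      by apply: (measurableT_comp mF); mfun.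
    over.
  rewrite (_ : (fun v : R => \int[L]_w F (u + v - p, (u - v + w, w))%R) =
      (fun v => (fun v => \int[L]_w F (v, (2 * u - p - v + w, w))%R) (v + (u - p))%R)); last first.
    apply/funext => v /=; apply: eq_integral => w _; congr (F (_, (_, _))); ring.
  rewrite (@ge0_integral_shift R (u - p) (fun v => \int[L]_w F (v, (2 * u - p - v + w, w))%R)); last 2 first.
  - apply: (@measurable_fun_fubini_tonelli_F _ _ _ _ R L
      (fun z : R * R => F (z.1, (2 * u - p - z.1 + z.2, z.2))%R)) => //.
    by apply: (measurableT_comp mF); mfun.
  - by move=> v; exact: integral_ge0.
  over.
rewrite /= (@fubini_tonelli _ _ _ _ R L L (fun z : R * R => \int[L]_w F (z.2, (2 * z.1 - p - z.2 + w, w))%R)); last 2 first.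
- apply: (@measurable_fun_fubini_tonelli_F _ _ _ _ R L
      (fun z : (R * R) * R => F (z.1.2, (2 * z.1.1 - p - z.1.2 + z.2, z.2))%R)) => //.
  by apply: (measurableT_comp mF); mfun.
- by move=> z; exact: integral_ge0.
rewrite /fubini_G /= -ge0_integralZl//; last 2 first.
- apply: (@measurable_fun_fubini_tonelli_G _ _ _ _ R L
      (fun z : R * R => \int[L]_w F (z.2, (2 * z.1 - p - z.2 + w, w))%R)) => //.
  + apply: (@measurable_fun_fubini_tonelli_F _ _ _ _ R L
      (fun z : (R * R) * R => F (z.1.2, (2 * z.1.1 - p - z.1.2 + z.2, z.2))%R)) => //.
    by apply: (measurableT_comp mF); mfun.
  + by move=> z; exact: integral_ge0.
- by move=> v _; apply: integral_ge0 => u _; exact: integral_ge0.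
apply: eq_integral => v _.
rewrite (@fubini_tonelli _ _ _ _ R L L (fun z : R * R => F (v, (2 * z.1 - p - v + z.2, z.2))%R))//; last first.
  by apply: (measurableT_comp mF); mfun.
rewrite (@fubini_tonelli _ _ _ _ R L L (fun z : R * R => F (v, z)))//; last first.
  by apply: (measurableT_comp mF); mfun.
rewrite /fubini_G /= -ge0_integralZl//; last 2 first.
- apply: (@measurable_fun_fubini_tonelli_G _ _ _ _ R L
      (fun z : R * R => F (v, (2 * z.1 - p - v + z.2, z.2))%R)) => //.
  by apply: (measurableT_comp mF); mfun.
- by move=> w _; exact: integral_ge0.
apply: eq_integral => w _.
rewrite (_ : (fun u : R => F (v, (2 * u - p - v + w, w))%R) =
   (fun u => (fun u => F (v, (u, w))) (2 * u + (w - p - v))%R)); last first.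
  by apply/funext => u /=; congr (F (_, (_, _))); ring.
rewrite (@ge0_integral_affine R 2 (w - p - v) (fun u => F (v, (u, w))))//; last first.
  by apply: (measurableT_comp mF); mfun.
by rewrite muleA -EFinM gtr0_norm// mulfV// mul1e.
Qed.

End IteratedIntegrals.

(** * From the Laplace transform on the group to seven Gamma values *)

Section TripleGamma.
Context {R : realType} {d : measure_display} {X : measurableType d}.
Variable nu : {sigma_finite_measure set X -> \bar R}.
Variables (LA LB LC : X -> R) (r K : R).
Hypothesis mLA : measurable_fun setT LA.
Hypothesis mLB : measurable_fun setT LB.
Hypothesis mLC : measurable_fun setT LC.
Hypothesis r_gt0 : 0 < r.
Hypothesis K_ge0 : 0 <= K.
Local Notation L := (@lebesgue_measure R).
Local Notation L3 := (sfprod L (sfprod L L)).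

(** With u = exp a, v = exp b, w = exp c and X = uv + uw + vw, the integral over [p] is 2 X^(-r/2)
    K_r(2 sqrt X), where K_r is the Macdonald function. *)
Definition bessel_kernel (a b c p : R) : R :=
  expR (- (r * p) - expR p - (expR (a + b) + expR (a + c) + expR (b + c)) * expR (- p)).

Hypothesis laplace : forall a b c : R,
  (\int[nu]_y (expR (- expR (a - LA y) - expR (b - LB y) - expR (c - LC y)))%:E =
   K%:E * \int[L]_p (bessel_kernel a b c p)%:E)%E.

(** The meeting point of the two computations: up to constants, both weighted measures are mapped to
    the measure on R^3 whose density is the integral of this kernel over [p]. *)
Definition tg_kernel (z : R * (R * R)) (p : R) : R :=
  expR (r * (z.1 + z.2.1 + z.2.2)) * bessel_kernel z.1 z.2.1 z.2.2 p.

Definition tg_weight1 (z : X * (R * (R * R))) : R :=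
  expR (r * (LA z.1 + LB z.1 + LC z.1)) *
  (gweight r z.2.1 * (gweight r z.2.2.1 * gweight r z.2.2.2)).

Definition tg_map1 (z : X * (R * (R * R))) : R * (R * R) :=
  (z.2.1 + LA z.1, (z.2.2.1 + LB z.1, z.2.2.2 + LC z.1)).

Definition tg_weight2 (z : R * (R * (R * R))) : R :=
  gweight (r / 2) z.1 *
  (gweight (r / 2) z.2.1 * (gweight (r / 2) z.2.2.1 * gweight (r / 2) z.2.2.2)).

(** For fixed p = [z.1] this inverts (a, b, c) -> (a + b - p, a + c - p, b + c - p). *)
Definition tg_map2 (z : R * (R * (R * R))) : R * (R * R) :=
  ((z.2.1 + z.2.2.1 - z.2.2.2 + z.1) / 2,
   ((z.2.1 - z.2.2.1 + z.2.2.2 + z.1) / 2,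
    (- z.2.1 + z.2.2.1 + z.2.2.2 + z.1) / 2)).

Lemma tg_weight1_ge0 z : 0 <= tg_weight1 z.
Proof. by apply/mulr_ge0/mulr_ge0/mulr_ge0; exact: expR_ge0. Qed.

Lemma tg_weight2_ge0 z : 0 <= tg_weight2 z.
Proof. by apply/mulr_ge0/mulr_ge0/mulr_ge0; exact: gweight_ge0. Qed.

Section TestFunction.
Variable phi : R * (R * R) -> R.
Hypothesis mphi : measurable_fun setT phi.
Hypothesis phi_ge0 : forall z, 0 <= phi z.

Lemma measurable_tg_kernel :
  measurable_fun setT (fun z : (R * (R * R)) * R => (phi z.1 * tg_kernel z.1 z.2)%:E).
Proof.
apply/measurable_EFinP; apply: measurable_funM; first exact: (measurableT_comp mphi).
by rewrite /tg_kernel /bessel_kernel; mfun.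
Qed.

Lemma tg_kernel_ge0 z p : (0 <= (phi z * tg_kernel z p)%:E)%E.
Proof. by rewrite lee_fin mulr_ge0// mulr_ge0 ?expR_ge0. Qed.

(** Shifting (a, b, c) by the logarithms [LA], [LB], [LC] absorbs the factor exp(r (LA + LB + LC))
    and turns the three Gamma weights into exp(r (a + b + c)) times the Laplace integrand;
    exchanging the integrals then allows [laplace] to be used. *)
Lemma tg_transfer1 :
  (\int[sfprod nu L3]_z (phi (tg_map1 z) * tg_weight1 z)%:E =
   K%:E * \int[L3]_z \int[L]_p (phi z * tg_kernel z p)%:E)%E.
Proof.
have m1 : measurable_fun setT (fun z => (phi (tg_map1 z) * tg_weight1 z)%:E).
  apply/measurable_EFinP; apply: measurable_funM.
    by apply: (measurableT_comp mphi); rewrite /tg_map1; mfun.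
  by rewrite /tg_weight1; mfun.
have p1 z : (0 <= (phi (tg_map1 z) * tg_weight1 z)%:E)%E.
  by rewrite lee_fin mulr_ge0 ?tg_weight1_ge0.
etransitivity; first exact: (@sfprod_tonelli _ _ _ _ R nu L3 _ m1 p1).
pose G (z : X * (R * (R * R))) : R := phi z.2 * (expR (r * (z.2.1 + z.2.2.1 + z.2.2.2)) *
  expR (- expR (z.2.1 - LA z.1) - expR (z.2.2.1 - LB z.1) - expR (z.2.2.2 - LC z.1))).
have mG : measurable_fun setT (fun z => (G z)%:E).
  apply/measurable_EFinP; apply: measurable_funM; first exact: (measurableT_comp mphi).
  by mfun.
have G0 z : (0 <= (G z)%:E)%E by rewrite lee_fin mulr_ge0// mulr_ge0 ?expR_ge0.
transitivity (\int[nu]_y \int[L3]_z (G (y, z))%:E)%E.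
  apply: eq_integral => y _.
  have mGy : measurable_fun setT (fun z => (G (y, z))%:E).
    by apply: (measurableT_comp mG); mfun.
  rewrite -(ge0_integral3_shift (LA y) (LB y) (LC y) mGy (fun=> G0 _)).
  apply: eq_integral => z _; congr EFin; rewrite /G /tg_map1 /tg_weight1 /gweight /=.
  congr (_ * _); rewrite !addrK -!expRD; congr expR; ring.
rewrite (@fubini_tonelli _ _ _ _ R nu L3 (fun z => (G z)%:E) mG G0) /fubini_G.
rewrite -ge0_integralZl ?lee_fin//; last 2 first.
- exact: (@measurable_fun_fubini_tonelli_F _ _ _ _ R L
    (fun z => (phi z.1 * tg_kernel z.1 z.2)%:E) measurable_tg_kernel (fun=> tg_kernel_ge0 _ _)).
- by move=> z _; apply: integral_ge0 => p _; exact: tg_kernel_ge0.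
apply: eq_integral => z _; rewrite /G /tg_kernel /=.
under eq_integral => y _ do rewrite mulrA EFinM.
rewrite ge0_integralZl//; last 2 first.
- by apply/measurable_EFinP; mfun.
- by rewrite lee_fin mulr_ge0 ?expR_ge0.
rewrite laplace muleCA; congr (_ * _)%E.
under [RHS]eq_integral => p _ do rewrite mulrA EFinM.
rewrite ge0_integralZl//; last 2 first.
- by move=> p _; rewrite lee_fin expR_ge0.
- by rewrite lee_fin mulr_ge0 ?expR_ge0.
by apply/measurable_EFinP; rewrite /bessel_kernel; mfun.
Qed.

(** In the coordinates of pair sums the terms of [bessel_kernel] separate. The parameter r/2 is
    forced by p + (a + b - p) + (a + c - p) + (b + c - p) = 2 (a + b + c) - 2 p. *)
Lemma tg_transfer2 :
  (\int[sfprod L L3]_z (phi (tg_map2 z) * tg_weight2 z)%:E =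
   2%:E * \int[L3]_z \int[L]_p (phi z * tg_kernel z p)%:E)%E.
Proof.
have m1 : measurable_fun setT (fun z => (phi (tg_map2 z) * tg_weight2 z)%:E).
  apply/measurable_EFinP; apply: measurable_funM.
    by apply: (measurableT_comp mphi); rewrite /tg_map2; mfun.
  by rewrite /tg_weight2; mfun.
have p1 z : (0 <= (phi (tg_map2 z) * tg_weight2 z)%:E)%E.
  by rewrite lee_fin mulr_ge0 ?tg_weight2_ge0.
etransitivity; first exact: (@sfprod_tonelli _ _ _ _ R L L3 _ m1 p1).
transitivity (2%:E * \int[L]_p \int[L3]_z (phi z * tg_kernel z p)%:E)%E; last first.
  congr (_ * _)%E; symmetry.
  exact: (@fubini_tonelli _ _ _ _ R L3 L (fun z => (phi z.1 * tg_kernel z.1 z.2)%:E)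
    measurable_tg_kernel (fun=> tg_kernel_ge0 _ _)).
rewrite -ge0_integralZl ?lee_fin//; last 2 first.
- exact: (@measurable_fun_fubini_tonelli_G _ _ _ _ R L3
    (fun z => (phi z.1 * tg_kernel z.1 z.2)%:E) measurable_tg_kernel (fun=> tg_kernel_ge0 _ _)).
- by move=> p _; apply: integral_ge0 => z _; exact: tg_kernel_ge0.
apply: eq_integral => p _.
have mp : measurable_fun setT (fun z => (phi (tg_map2 (p, z)) * tg_weight2 (p, z))%:E).
  by apply: (measurableT_comp m1); mfun.
rewrite (ge0_integral3_pairsums p mp (fun=> p1 _)); congr (_ * _)%E.
apply: eq_integral => -[u [v w]] _; congr EFin; congr (_ * _).
  by congr phi; rewrite /tg_map2 /=; congr (_, (_, _)); field.
rewrite /tg_weight2 /tg_kernel /bessel_kernel /gweight /= -!expRD; congr expR.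
have E (x y : R) : expR (x + y - p) = expR (x + y) * expR (- p) by rewrite -expRD.
by rewrite !E; field.
Qed.

End TestFunction.
Local Open Scope complex_scope.

Lemma tg_transfer (phi : R * (R * R) -> R) : measurable_fun setT phi ->
  (forall z, 0 <= phi z) ->
  (\int[sfprod nu L3]_z (phi (tg_map1 z) * tg_weight1 z)%:E =
   (K / 2)%:E * \int[sfprod L L3]_z (phi (tg_map2 z) * tg_weight2 z)%:E)%E.
Proof.
move=> mphi phi0; rewrite tg_transfer1// tg_transfer2// muleA -EFinM.
by rewrite divfK// pnatr_eq0.
Qed.

Lemma measurable_tg_weight1 : measurable_fun setT tg_weight1.
Proof. by rewrite /tg_weight1; mfun. Qed.

Lemma measurable_tg_map1 : measurable_fun setT tg_map1.
Proof. by rewrite /tg_map1; mfun. Qed.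

Lemma measurable_tg_map2 : measurable_fun setT tg_map2.
Proof. by rewrite /tg_map2; mfun. Qed.

Lemma integrable_tg_weight2 :
  (sfprod L L3).-integrable setT (fun z => (tg_weight2 z)%:E).
Proof.
have r2 : 0 < r / 2 by rewrite divr_gt0.
have i1 := integrable_gweight r2.
have i2 := integrable_prodM i1 i1.
have i3 := integrable_prodM i1 i2.
exact: (integrable_prodM i1 i3).
Qed.

Lemma integrable_tg_weight1 :
  (sfprod nu L3).-integrable setT (fun z => (tg_weight1 z)%:E).
Proof.
exact: (@transfer_integrable R _ _ _ _ _ _ (sfprod nu L3) (sfprod L L3)
  tg_weight1 tg_weight2 tg_map1 tg_map2 (K / 2) tg_weight1_ge0
  measurable_tg_weight1 integrable_tg_weight2 tg_transfer).
Qed.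

(** By Tonelli the finite integral of [tg_weight1] is the integral of this density times the mass of
    three Gamma weights. That mass is positive, so the other factor cannot be infinite. *)
Lemma integrable_tg_density :
  nu.-integrable setT (fun y => (expR (r * (LA y + LB y + LC y)))%:E).
Proof.
have mE : measurable_fun setT (fun y => expR (r * (LA y + LB y + LC y))) by mfun.
have i1 := integrable_gweight r_gt0.
have i3 := integrable_prodM i1 (integrable_prodM i1 i1).
pose c := (\int[L3]_z (gweight r z.1 * (gweight r z.2.1 * gweight r z.2.2))%:E)%E.
have c_gt0 : (0 < c)%E.
  rewrite /c -(fineK (integrable_fin_num measurableT i3)).
  have := Rintegral_prodM i1 (integrable_prodM i1 i1).
  rewrite /Rintegral => ->; have := Rintegral_prodM i1 i1.
  rewrite /Rintegral => ->; rewrite lte_fin.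
  by have := Rintegral_gweight_gt0 r_gt0; rewrite /Rintegral => h; rewrite !mulr_gt0.
apply/integrableP; split; first exact/measurable_EFinP.
have /integrableP[mW iW] := integrable_tg_weight1.
move: iW; under eq_integral => z _ do rewrite gee0_abs ?lee_fin ?tg_weight1_ge0//.
rewrite (_ : (\int[_]_z _)%E = (\int[nu]_y (expR (r * (LA y + LB y + LC y)))%:E * c)%E); last first.
  etransitivity; first exact: (@sfprod_tonelli _ _ _ _ R nu L3 _ mW (fun z => tg_weight1_ge0 z)).
  rewrite -ge0_integralZr//; last 2 first.
  - exact/measurable_EFinP.
  - exact: ltW.
  apply: eq_integral => y _; rewrite /tg_weight1 /=.
  under eq_integral => z _ do rewrite EFinM.
  rewrite ge0_integralZl//.
  - by move/integrableP : i3 => [].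
  - by move=> z _; rewrite lee_fin !mulr_ge0 ?gweight_ge0.
move=> h; under eq_integral => y _ do rewrite gee0_abs ?lee_fin ?expR_ge0//.
rewrite ltNge leye_eq; apply/negP => /eqP Eoo.
by move: h; rewrite Eoo gt0_mulye.
Qed.

Definition tg_integrand (l m v : R) (y : X) : R[i] :=
  cis (l * LA y + m * LB y + v * LC y) * (expR (r * (LA y + LB y + LC y)))%:C.

Lemma cintegrable_tg_integrand l m v : cintegrable nu setT (tg_integrand l m v).
Proof.
have mt : measurable_fun setT (fun y => l * LA y + m * LB y + v * LC y) by mfun.
exact: (cintegrable_cis mt integrable_tg_density).
Qed.

(* Both sides are Fourier transforms of the measures compared by [tg_transfer]. *)
Lemma cintegral_tg_integrand l m v :
  cintegral nu setT (tg_integrand l m v) *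
    (cGamma (r +i* l) * (cGamma (r +i* m) * cGamma (r +i* v))) =
  (K / 2)%:C *
    (cGamma ((r / 2) +i* ((l + m + v) / 2)) *
     (cGamma ((r / 2) +i* ((l + m - v) / 2)) *
      (cGamma ((r / 2) +i* ((l - m + v) / 2)) *
       cGamma ((r / 2) +i* ((- l + m + v) / 2))))).
Proof.
have r2 : 0 < r / 2 by rewrite divr_gt0.
have mt : measurable_fun setT (fun z : R * (R * R) => l * z.1 + m * z.2.1 + v * z.2.2).
  by mfun.
have := @transfer_cis R _ _ _ _ _ _ (sfprod nu L3) (sfprod L L3)
  tg_weight1 tg_weight2 tg_map1 tg_map2 (K / 2) tg_weight1_ge0
  measurable_tg_weight1 measurable_tg_map1 measurable_tg_map2
  integrable_tg_weight2 tg_transfer _ mt.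
pose g s t (a : R) : R[i] := cis (t * a) * (gweight s a)%:C.
have gi s t : 0 < s -> cintegrable L setT (g s t) by exact: cintegrable_gamma.
have -> : (fun x => cis (l * (tg_map1 x).1 + m * (tg_map1 x).2.1 + v * (tg_map1 x).2.2) *
    (tg_weight1 x)%:C) =
  (fun z => tg_integrand l m v z.1 * (g r l z.2.1 * (g r m z.2.2.1 * g r v z.2.2.2))).
  apply/funext => -[y [a [b c]]]; rewrite /tg_integrand /tg_weight1 /tg_map1 /g /=.
  rewrite (_ : _ + _ + _ = (l * LA y + m * LB y + v * LC y) + (l * a + (m * b + v * c))); last ring.
  by rewrite cisD (cisD (l * a)) (cisD (m * b)) !rmorphM /=; ring.
(* The transpose of [tg_map2] applied to (l, m, v) gives the imaginary parts of the four Gamma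
   arguments. *)
have -> : (fun x => cis (l * (tg_map2 x).1 + m * (tg_map2 x).2.1 + v * (tg_map2 x).2.2) *
    (tg_weight2 x)%:C) =
  (fun z => g (r / 2) ((l + m + v) / 2) z.1 * (g (r / 2) ((l + m - v) / 2) z.2.1 *
     (g (r / 2) ((l - m + v) / 2) z.2.2.1 * g (r / 2) ((- l + m + v) / 2) z.2.2.2))).
  apply/funext => -[p [a [b c]]]; rewrite /tg_weight2 /tg_map2 /g /=.
  rewrite (_ : _ + _ + _ = (l + m + v) / 2 * p + ((l + m - v) / 2 * a +
     ((l - m + v) / 2 * b + (- l + m + v) / 2 * c))); last by field.
  rewrite (cisD (_ * p)) (cisD (_ * a)) (cisD (_ * b)) !rmorphM /=; ring.
have j2 := cintegrable_prodM (gi _ m r_gt0) (gi _ v r_gt0).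
have j3 := cintegrable_prodM (gi _ l r_gt0) j2.
have k2 := cintegrable_prodM (gi _ ((l - m + v) / 2) r2) (gi _ ((- l + m + v) / 2) r2).
have k3 := cintegrable_prodM (gi _ ((l + m - v) / 2) r2) k2.
have E1 := cintegral_prodM (cintegrable_tg_integrand l m v) j3.
have E2 := cintegral_prodM (gi _ l r_gt0) j2.
have E3 := cintegral_prodM (gi _ m r_gt0) (gi _ v r_gt0).
have F1 := cintegral_prodM (gi _ ((l + m + v) / 2) r2) k3.
have F2 := cintegral_prodM (gi _ ((l + m - v) / 2) r2) k2.
have F3 := cintegral_prodM (gi _ ((l - m + v) / 2) r2) (gi _ ((- l + m + v) / 2) r2).
rewrite E2 E3 in E1; rewrite F2 F3 in F1.
rewrite !cGamma_cintegral => H.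
etransitivity; first exact: (esym E1).
by rewrite H; congr (_ * _).
Qed.

End TripleGamma.

(** * Growth of the Gamma function on vertical lines *)

Section GammaFunctionalEquation.
Context {R : realType}.
Local Notation L := (@lebesgue_measure R).

(** The fundamental theorem on growing symmetric intervals, with |f| as the dominating function in
    the limit. *)
Lemma Rintegral_derive_eq0 (F f : R -> R) :
  (forall x : R, is_derive x 1 F (f x)) -> continuous f ->
  L.-integrable setT (fun x => (f x)%:E) ->
  F n%:R @[n --> \oo] --> 0 -> F (- n%:R) @[n --> \oo] --> 0 ->
  Rintegral L setT f = 0.
Proof.
move=> dF cf intf Fp Fm.
have mf : measurable_fun setT f by exact: continuous_measurable_fun.
(* The successor keeps the interval nondegenerate at n = 0. *)
pose A n : set R := `[- n.+1%:R, n.+1%:R]%classic.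
have E n : (\int[L]_x ((f \_ (A n)) x)%:E = (F n.+1%:R - F (- n.+1%:R))%:E)%E.
  rewrite (_ : (fun x => _) = ((fun x => (f x)%:E) \_ (A n))); last first.
    by apply/funext => x; rewrite !patchE; case: ifP.
  rewrite -integral_mkcond (@continuous_FTC2 _ f F)//.
  - by rewrite -subr_gt0 opprK addr_gt0.
  - by apply: continuous_subspaceT.
  - split => [x _||]; first by apply: ex_derive.
      apply: cvg_at_right_filter; apply: differentiable_continuous.
      by apply/derivable1_diffP; apply: ex_derive.
    apply: cvg_at_left_filter; apply: differentiable_continuous.
    by apply/derivable1_diffP; apply: ex_derive.
  - by move=> x _; rewrite derive1E; apply: derive_val.
have mfA n : measurable_fun [set: R] (f \_ (A n)).
  apply: (measurable_restrictT f _).1; first exact: measurable_itv.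
  exact: measurable_funTS mf.
have h1 : (\int[L]_x ((f \_ (A n)) x)%:E)%E @[n --> \oo] --> (\int[L]_x (f x)%:E)%E.
  apply: (@dominated_cvg _ _ R L _ _ _ _ (fun x => `|(f x)%:E|)%E) => //.
  - by move=> n; apply/measurable_EFinP; exact: mfA.
  - move=> x _; apply: cvg_near_cst; near=> n.
    rewrite patchE mem_set// /A /= in_itv /= -ler_norml.
    apply: (@le_trans _ _ n%:R); last by rewrite ler_nat.
    by near: n; apply: nbhs_infty_ger.
  - exact: integrable_abse.
  - move=> n x _; rewrite patchE; case: ifPn => //= _.
    by rewrite normr0 lee_fin.
have h2 : (\int[L]_x ((f \_ (A n)) x)%:E)%E @[n --> \oo] --> 0%E.
  under eq_fun do rewrite E.
  apply: cvg_EFin; first by near=> n.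
  rewrite /= -[X in _ --> X]subr0; apply: cvgB.
    by rewrite (cvg_shiftS (fun n => F n%:R)).
  by rewrite (cvg_shiftS (fun n => F (- n%:R))).
by rewrite /Rintegral -(cvg_lim _ h1)// (cvg_lim _ h2).
Unshelve. all: by end_near. Qed.

Lemma is_derive_gweight (s x : R) :
  is_derive x 1 (gweight s) ((s - expR x) * gweight s x).
Proof.
have d1 : is_derive x 1 (fun a : R => s * a - expR a) (s - expR x).
  by apply: is_derive_eq; rewrite /GRing.scale /= mulr1.
have h := @is_derive1_comp R expR (fun a : R => s * a - expR a) x _ _ (is_derive_expR _) d1.
by apply: is_derive_eq; rewrite mulrC.
Qed.

Lemma is_derive_comp_scale (h h' : R -> R) (t x : R) :
  (forall y : R, is_derive y 1 h (h' y)) ->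
  is_derive x 1 (fun a => h (t * a)) (t * h' (t * x)).
Proof.
move=> dh; have d1 : is_derive x 1 (fun a : R => t * a) t.
  by apply: is_derive_eq; rewrite /GRing.scale /= mulr1.
have h1 := @is_derive1_comp R h (fun a : R => t * a) x _ _ (dh (t * x)) d1.
by apply: is_derive_eq; rewrite mulrC.
Qed.

(** By [cGammaE], [gcos s t] and [gsin s t] are the real and imaginary parts of Gamma(s + it). *)
Definition gcos (s t : R) : R := Rintegral L setT (fun a => gweight s a * cos (t * a)).
Definition gsin (s t : R) : R := Rintegral L setT (fun a => gweight s a * sin (t * a)).

Lemma integrable_gweightM (s : R) (h : R -> R) : 0 < s -> continuous h ->
  (forall x, `|h x| <= 1) -> L.-integrable setT (fun a => (gweight s a * h a)%:E).
Proof.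
move=> s0 ch h1.
have mh : measurable_fun setT h by exact: continuous_measurable_fun.
have := @integrable_bounded_weight R _ _ L h _ mh h1 (integrable_gweight s0).
by apply: eq_integrable => // a _ /=; rewrite mulrC.
Qed.

Lemma continuous_scale_comp (h : R -> R) (t : R) :
  continuous h -> continuous (fun a : R => h (t * a)).
Proof.
move=> ch x; apply: continuous_comp; last exact: ch.
by apply: cvgM; [exact: cvg_cst|exact: cvg_id].
Qed.

Lemma integrable_gcos s t : 0 < s ->
  L.-integrable setT (fun a => (gweight s a * cos (t * a))%:E).
Proof.
move=> s0; apply: integrable_gweightM => //.
  exact/continuous_scale_comp/continuous_cos.
by move=> x; rewrite ler_norml cos_geN1 cos_le1.
Qed.

Lemma integrable_gsin s t : 0 < s ->
  L.-integrable setT (fun a => (gweight s a * sin (t * a))%:E).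
Proof.
move=> s0; apply: integrable_gweightM => //.
  exact/continuous_scale_comp/continuous_sin.
by move=> x; rewrite ler_norml sin_geN1 sin_le1.
Qed.

Lemma cvg_expRMN (c : R) : 0 < c -> expR (- (c * n%:R)) @[n --> \oo] --> (0 : R).
Proof.
move=> c0; have E : (fun n : nat => expR (- (c * n%:R))) = (fun n => (expR (- c)) ^+ n).
  by apply/funext => n; rewrite -mulNr -expRM_natr mulrC.
by rewrite E; apply: cvg_expr; rewrite ger0_norm ?expR_ge0// expR_lt1 oppr_lt0.
Qed.

Lemma cvg_gweightM_p (s : R) (h : R -> R) : 0 < s -> (forall x, `|h x| <= 1) ->
  (gweight s n%:R * h n%:R) @[n --> \oo] --> (0 : R).
Proof.
move=> s0 h1; apply/cvgr0Pnorm_lt => /= e e0.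
pose C := expR ((s + 1) * (ln (s + 1) - 1)).
have hC : C * expR (- (1 * n%:R)) @[n --> \oo] --> (0 : R).
  by rewrite -[X in _ --> X](mulr0 C); apply: cvgM; [exact: cvg_cst|exact: cvg_expRMN].
move/cvgr0Pnorm_lt : hC => /(_ e e0); apply: filterS => n; apply: le_lt_trans.
rewrite normrM ger0_norm ?gweight_ge0// [leRHS]ger0_norm ?mulr_ge0 ?expR_ge0//.
rewrite -[leRHS]mulr1 ler_pM ?gweight_ge0// mul1r.
exact: gweight_le_expRN.
Qed.

Lemma cvg_gweightM_m (s : R) (h : R -> R) : 0 < s -> (forall x, `|h x| <= 1) ->
  (gweight s (- n%:R) * h (- n%:R)) @[n --> \oo] --> (0 : R).
Proof.
move=> s0 h1; apply/cvgr0Pnorm_lt => /= e e0.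
have := cvg_expRMN s0; move/cvgr0Pnorm_lt => /(_ e e0); apply: filterS => n; apply: le_lt_trans.
rewrite normrM ger0_norm ?gweight_ge0// [leRHS]ger0_norm ?expR_ge0//.
by rewrite -[leRHS]mulr1 ler_pM ?gweight_ge0// -mulrN; exact: gweight_le_expRM.
Qed.

(** The derivative of [gweight s a * h (t * a)] integrates to zero, and [expR a * gweight s a] is
    [gweight (s + 1) a]. An abstract [h] treats cosine and sine at once. *)
Lemma gamma_by_parts (s t : R) (h h' : R -> R) : 0 < s ->
  (forall y : R, is_derive y 1 h (h' y)) -> continuous h -> continuous h' ->
  (forall x, `|h x| <= 1) -> (forall x, `|h' x| <= 1) ->
  Rintegral L setT (fun a => gweight (s + 1) a * h (t * a)) =
  s * Rintegral L setT (fun a => gweight s a * h (t * a)) +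
  t * Rintegral L setT (fun a => gweight s a * h' (t * a)).
Proof.
move=> s0 dh ch ch' h1 h1'.
have s1 : 0 < s + 1 by rewrite addr_gt0.
have i1 : L.-integrable setT (fun a => (gweight s a * h (t * a))%:E).
  by apply: integrable_gweightM => //; exact: continuous_scale_comp.
have i2 : L.-integrable setT (fun a => (gweight s a * h' (t * a))%:E).
  by apply: integrable_gweightM => //; exact: continuous_scale_comp.
have i3 : L.-integrable setT (fun a => (gweight (s + 1) a * h (t * a))%:E).
  by apply: integrable_gweightM => //; exact: continuous_scale_comp.
pose f a := (s * (gweight s a * h (t * a)) + t * (gweight s a * h' (t * a)))
  - gweight (s + 1) a * h (t * a).
have i12 : L.-integrable setT
    (fun a => (s * (gweight s a * h (t * a)) + t * (gweight s a * h' (t * a)))%:E).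
  exact: (integrableD measurableT (integrableZl measurableT s i1) (integrableZl measurableT t i2)).
have intf : L.-integrable setT (fun x => (f x)%:E) := integrableB measurableT i12 i3.
have dF (x : R) : is_derive x 1 (fun a => gweight s a * h (t * a)) (f x).
  have d1 := is_derive_gweight s x; have d2 := is_derive_comp_scale t x dh.
  have d3 := is_deriveM d1 d2.
  by apply: is_derive_eq; rewrite /GRing.scale /= /f gweightD1; ring.
have cg u : continuous (gweight u) := @continuous_gweight R u.
have cf : continuous f.
  move=> x; apply: cvgB; last by apply: cvgM; [exact: cg|exact: continuous_scale_comp].
  by apply: cvgD; (apply: cvgM; first exact: cvg_cst);
    apply: cvgM; [exact: cg|exact: continuous_scale_comp|exact: cg|exact: continuous_scale_comp].
have := Rintegral_derive_eq0 dF cf intf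
  (cvg_gweightM_p s0 (fun x => h1 (t * x))) (cvg_gweightM_m s0 (fun x => h1 (t * x))).
rewrite /f RintegralB// RintegralD//; last 2 first.
- exact: (integrableZl measurableT s i1).
- exact: (integrableZl measurableT t i2).
by rewrite !RintegralZl// => /eqP; rewrite subr_eq0 => /eqP <-.
Qed.

(** Together with [gsinS] this is Gamma(z + 1) = z Gamma(z). *)
Lemma gcosS s t : 0 < s -> gcos (s + 1) t = s * gcos s t - t * gsin s t.
Proof.
move=> s0; rewrite /gcos (@gamma_by_parts s t cos (fun x => - sin x))//.
- congr (_ + _); rewrite -mulrN; congr (_ * _); rewrite /gsin -mulN1r -RintegralZl//; last first.
    exact: integrable_gsin.
  by apply: eq_Rintegral => a _; rewrite mulN1r mulrN.
- exact: continuous_cos.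
- by move=> x; apply: cvgN; exact: continuous_sin.
- by move=> x; rewrite ler_norml cos_geN1 cos_le1.
- by move=> x; rewrite normrN ler_norml sin_geN1 sin_le1.
Qed.

Lemma gsinS s t : 0 < s -> gsin (s + 1) t = s * gsin s t + t * gcos s t.
Proof.
move=> s0; rewrite /gsin (@gamma_by_parts s t sin cos)//.
- exact: continuous_sin.
- exact: continuous_cos.
- by move=> x; rewrite ler_norml sin_geN1 sin_le1.
- by move=> x; rewrite ler_norml cos_geN1 cos_le1.
Qed.

End GammaFunctionalEquation.

(** * Upper and lower bounds for the modulus of Gamma *)

Section GammaModulus.
Context {R : realType}.
Local Notation L := (@lebesgue_measure R).

(** By cos u = 1 - 2 sin(u/2)^2 it is enough that |sin v| <= |v|, which the mean value theorem
    gives. *)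
Lemma cos_ge_1Bsqr (u : R) : 1 - u ^+ 2 / 2 <= cos u.
Proof.
have sle (v : R) : 0 <= v -> `|sin v| <= v.
  rewrite le_eqVlt => /orP[/eqP <-|v0]; first by rewrite sin0 normr0.
  have [c _] := @MVT R sin cos 0 v v0 (fun x _ => is_derive_sin x)
    (continuous_subspaceT (@continuous_sin R)).
  rewrite sin0 !subr0 => ->; rewrite normrM (gtr0_norm v0).
  by rewrite -[leRHS]mul1r ler_wpM2r ?(ltW v0)// ler_norml cos_geN1 cos_le1.
have key : sin (u / 2) ^+ 2 <= (u / 2) ^+ 2.
  rewrite -real_normK ?num_real// -[leRHS]real_normK ?num_real//.
  rewrite ler_sqr ?nnegrE//.
  have [u0|u0] := leP 0 (u / 2); first by rewrite (ger0_norm u0); exact: sle.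
  by rewrite -[sin _]opprK -sinN normrN (ltr0_norm u0); apply: sle; rewrite oppr_ge0 ltW.
have -> : cos u = 1 - 2 * sin (u / 2) ^+ 2.
  have {1}-> : u = (u / 2) *+ 2 by rewrite -mulr_natr; field.
  by rewrite cos_mulr2n cos2sin2 -mulr_natr; ring.
move: key; rewrite exprMn; lra.
Qed.

(** Replaces the square of a logarithmic variable by exponentials, whose moments under [gweight] are
    again Gamma values and hence rational multiples of one another. *)
Lemma sqr_le_expR (h : R) : h ^+ 2 <= (expR h - 1) ^+ 2 + (1 - expR (- h)) ^+ 2.
Proof.
have [h0|h0] := leP 0 h.
  have := expR_ge1Dx h; have := sqr_ge0 (1 - expR (- h)); nra.
have := expR_ge1Dx (- h); have := sqr_ge0 (expR h - 1); nra.
Qed.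

Definition rgamma (s : R) : R := Rintegral L setT (gweight s).

Lemma rgamma_gt0 s : 0 < s -> 0 < rgamma s.
Proof. exact: Rintegral_gweight_gt0. Qed.

Lemma rgammaE s : rgamma s = gcos s 0.
Proof. by apply: eq_Rintegral => a _; rewrite mul0r cos0 mulr1. Qed.

Lemma rgammaS s : 0 < s -> rgamma (s + 1) = s * rgamma s.
Proof. by move=> s0; rewrite !rgammaE gcosS// mul0r subr0. Qed.

Definition gmod2 (s t : R) : R := gcos s t ^+ 2 + gsin s t ^+ 2.

Lemma gmod2_ge0 s t : 0 <= gmod2 s t.
Proof. by rewrite addr_ge0 ?sqr_ge0. Qed.

Lemma gmod2S s t : 0 < s -> gmod2 (s + 1) t = (s ^+ 2 + t ^+ 2) * gmod2 s t.
Proof. by move=> s0; rewrite /gmod2 gcosS// gsinS//; ring. Qed.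

Lemma gmod2N s t : 0 < s -> gmod2 s (- t) = gmod2 s t.
Proof.
move=> s0; rewrite /gmod2; have -> : gcos s (- t) = gcos s t.
  by apply: eq_Rintegral => a _; rewrite mulNr cosN.
suff -> : gsin s (- t) ^+ 2 = gsin s t ^+ 2 by [].
rewrite -[in RHS]sqrrN; congr (_ ^+ 2).
have E := @RintegralZl _ _ R L setT _ (-1) measurableT (@integrable_gsin R s t s0).
rewrite /gsin -mulN1r -E; apply: eq_Rintegral => a _.
by rewrite mulNr sinN mulrN mulN1r.
Qed.

Lemma Rintegral_gcomb s t p q : 0 < s ->
  Rintegral L setT (fun a => gweight s a * (p * cos (t * a) + q * sin (t * a))) =
  p * gcos s t + q * gsin s t.
Proof.
move=> s0; have i1 := @integrable_gcos R s t s0; have i2 := @integrable_gsin R s t s0.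
rewrite /gcos /gsin -!RintegralZl// -RintegralD//.
- by apply: eq_Rintegral => a _; ring.
- exact: (integrableZl measurableT p i1).
- exact: (integrableZl measurableT q i2).
Qed.

(** Writing |Gamma|^2 as the integral of [gweight] against the projection on the direction of Gamma
    and applying Cauchy-Schwarz pointwise gives m^2 <= m [rgamma s]; then m is cancelled. *)
Lemma gmod2_le s t : 0 < s -> gmod2 s t <= rgamma s ^+ 2.
Proof.
move=> s0; set m := Num.sqrt (gmod2 s t).
have mE : m ^+ 2 = gmod2 s t by rewrite sqr_sqrtr// gmod2_ge0.
have m0 : 0 <= m by rewrite sqrtr_ge0.
have G0 := rgamma_gt0 s0.
have h : gmod2 s t <= m * rgamma s.
  rewrite /gmod2 2!expr2 -Rintegral_gcomb// /rgamma -RintegralZl//; last exact: integrable_gweight.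
  apply: le_Rintegral => //.
  - have i1 := @integrable_gcos R s t s0; have i2 := @integrable_gsin R s t s0.
    have := integrableD measurableT (integrableZl measurableT (gcos s t) i1)
      (integrableZl measurableT (gsin s t) i2).
    by apply: eq_integrable => // a _ /=; rewrite -EFinD; congr EFin; ring.
  - exact: (integrableZl measurableT m (integrable_gweight s0)).
  - move=> a _; rewrite [leRHS]mulrC ler_wpM2l ?gweight_ge0//.
    have := cos2Dsin2 (t * a); set c := cos _; set e := sin _ => ce.
    apply: le_trans (ler_norm _) _; rewrite -ler_sqr ?nnegrE// real_normK ?num_real// mE.
    have := sqr_ge0 (gcos s t * e - gsin s t * c); rewrite /gmod2; nra.
rewrite -mE in h *; rewrite ler_sqr ?nnegrE ?(ltW G0)//.
have [m1|m1] := leP m 0; first by apply: le_trans m1 (ltW G0).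
by rewrite -(ler_pM2l m1) -expr2.
Qed.

Lemma integrable_lin (p q : R) (f g : R -> R) :
  L.-integrable setT (fun a => (f a)%:E) -> L.-integrable setT (fun a => (g a)%:E) ->
  L.-integrable setT (fun a => (p * f a + q * g a)%:E).
Proof.
move=> i1 i2.
exact: (integrableD measurableT (integrableZl measurableT p i1) (integrableZl measurableT q i2)).
Qed.

Lemma Rintegral_lin (p q : R) (f g : R -> R) :
  L.-integrable setT (fun a => (f a)%:E) -> L.-integrable setT (fun a => (g a)%:E) ->
  Rintegral L setT (fun a => p * f a + q * g a) =
  p * Rintegral L setT f + q * Rintegral L setT g.
Proof.
move=> i1 i2; rewrite -!RintegralZl// -RintegralD//.
- exact: (integrableZl measurableT p i1).
- exact: (integrableZl measurableT q i2).
Qed.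

(** The source of the 7 in [gmod2_ge]: with it the linear terms cancel and 5 y^2 >= 8 remains. The
    left side is the numerator of the second moment computed there. *)
Lemma gmod2_ge_aux (y : R) : 2 <= y -> 2 * y ^+ 2 + 7 * y + 8 <= 7 * ((y + 1) * y).
Proof. by move=> y2; nra. Qed.

(* The second moments of a log-gamma variable around [ln x] bound the defect
   of [cos (t (a - ln x))] from 1. *)
Lemma gmod2_ge (y t : R) : 2 <= y -> 7 * t ^+ 2 / (2 * (y + 2)) <= 1 ->
  (rgamma (y + 2) * (1 - 7 * t ^+ 2 / (2 * (y + 2)))) ^+ 2 <= gmod2 (y + 2) t.
Proof.
move=> y2 ht; set x := y + 2; have y0 : 0 < y by lra.
have x0 : 0 < x by rewrite /x; lra.
pose b := ln x; pose k := t ^+ 2 / 2.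
have k0 : 0 <= k by rewrite divr_ge0 ?sqr_ge0.
(* The real part of Gamma(x + it) after rotation by the angle -tb, that is, the integral of
   [gweight x a * cos (t * (a - b))]; it is at most the modulus. *)
pose rot := cos (t * b) * gcos x t + sin (t * b) * gsin x t.
have rot_le : rot ^+ 2 <= gmod2 x t.
  have := cos2Dsin2 (t * b); rewrite /rot /gmod2.
  set c := cos _; set s := sin _ => cs.
  have := sqr_ge0 (c * gsin x t - s * gcos x t); nra.
apply: le_trans rot_le.
have G0 := rgamma_gt0 y0.
have gi j : 0 <= j -> L.-integrable setT (fun a => (gweight (y + j) a)%:E).
  by move=> j0; apply: integrable_gweight; rewrite ltr_wpDr.
(* [h4] is [gweight x] times (exp(b - a) - 1)^2 + (exp(a - b) - 1)^2, expanded with exp b = x. The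
   expansion uses the parameters y, ..., y + 4, which is why x lies two steps above y > 0. [h5] is
   the resulting minorant of the integrand of [rot]. *)
pose h1 a := x ^+ 2 * gweight (y + 0) a + - (2 * x) * gweight (y + 1) a.
pose h2 a := 1 * h1 a + 2 * gweight (y + 2) a.
pose h3 a := 1 * h2 a + - (2 / x) * gweight (y + 3) a.
pose h4 a := 1 * h3 a + x ^- 2 * gweight (y + 4) a.
have i1 : L.-integrable setT (fun a => (h1 a)%:E) by apply: integrable_lin; exact: gi.
have i2 : L.-integrable setT (fun a => (h2 a)%:E) by apply: integrable_lin => //; exact: gi.
have i3 : L.-integrable setT (fun a => (h3 a)%:E) by apply: integrable_lin => //; exact: gi.
have i4 : L.-integrable setT (fun a => (h4 a)%:E) by apply: integrable_lin => //; exact: gi.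
pose h5 a := 1 * gweight (y + 2) a + - k * h4 a.
have i5 : L.-integrable setT (fun a => (h5 a)%:E) by apply: integrable_lin => //; exact: gi.
have G1 : rgamma (y + 1) = y * rgamma y by rewrite rgammaS.
have G2 : rgamma (y + 2) = (y + 1) * y * rgamma y.
  have -> : y + 2 = (y + 1) + 1 by ring.
  by rewrite rgammaS ?G1 ?mulrA// addr_gt0.
have G3 : rgamma (y + 3) = (y + 2) * (y + 1) * y * rgamma y.
  have -> : y + 3 = (y + 2) + 1 by ring.
  by rewrite rgammaS ?G2 ?mulrA// addr_gt0.
have G4 : rgamma (y + 4) = (y + 3) * (y + 2) * (y + 1) * y * rgamma y.
  have -> : y + 4 = (y + 3) + 1 by ring.
  by rewrite rgammaS ?G3 ?mulrA// addr_gt0.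
have I4 : Rintegral L setT h4 = rgamma y * ((2 * y ^+ 2 + 7 * y + 8) / x).
  rewrite Rintegral_lin//; last exact: gi.
  rewrite Rintegral_lin//; last exact: gi.
  rewrite Rintegral_lin//; last exact: gi.
  rewrite Rintegral_lin//; try exact: gi.
  rewrite -!/(rgamma _) addr0 G1 G2 G3 G4 /x; field.
  by rewrite -/x gt_eqF.
have I5 : Rintegral L setT h5 = rgamma (y + 2) - k * Rintegral L setT h4.
  by rewrite Rintegral_lin//; [rewrite -/(rgamma _); ring|exact: gi].
have le_rot : Rintegral L setT h5 <= rot.
  rewrite /rot -Rintegral_gcomb//; apply: le_Rintegral => //.
    have := integrable_lin (cos (t * b)) (sin (t * b)) (@integrable_gcos R x t x0)
      (@integrable_gsin R x t x0).
    by apply: eq_integrable => // a _ /=; congr EFin; ring.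
  move=> a _; rewrite -cosB -mulrBr.
  apply: (@le_trans _ _ (h5 a)); first exact: lexx.
  have -> : h5 a = gweight x a * (1 - k * ((expR (b - a) * expR (b - a) - 2 * expR (b - a) + 1)
      + (expR (a - b) * expR (a - b) - 2 * expR (a - b) + 1))).
    have e0 := expR_gt0 a; have eb : expR b = x by rewrite lnK.
    have E j : gweight (y + j%:R) a = gweight y a * expR a ^+ j.
      by rewrite -expRM_natr /gweight -expRD; congr expR; ring.
    have := E 0%N; have := E 1%N; have := E 2%N; have := E 3%N; have := E 4%N.
    rewrite /h5 /h4 /h3 /h2 /h1 => -> -> -> -> ->.
    rewrite !expRB eb; field.
    by rewrite !gt_eqF.
  rewrite ler_wpM2l ?gweight_ge0//; apply: le_trans (cos_ge_1Bsqr _).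
  rewrite exprMn lerD2l lerN2 mulrAC -/k ler_wpM2l//.
  apply: le_trans (sqr_le_expR (b - a)) _; rewrite opprB le_eqVlt; apply/orP; left.
  by apply/eqP; ring.
have low : rgamma x * (1 - 7 * t ^+ 2 / (2 * x)) <= rot.
  apply: le_trans le_rot; rewrite I5 I4 /x G2 -/x.
  have -> : (y + 1) * y * rgamma y * (1 - 7 * t ^+ 2 / (2 * x)) =
    (y + 1) * y * rgamma y - k * (rgamma y * ((7 * ((y + 1) * y)) / x)).
    by rewrite /k; field; rewrite gt_eqF.
  rewrite lerD2l lerN2 ler_wpM2l// ler_wpM2l ?(ltW G0)//.
  by rewrite ler_pM2r ?invr_gt0// gmod2_ge_aux.
have Gx := rgamma_gt0 x0.
have u0 : 0 <= rgamma x * (1 - 7 * t ^+ 2 / (2 * x)).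
  by rewrite mulr_ge0 ?(ltW Gx)// subr_ge0.
by rewrite ler_sqr// nnegrE// (le_trans u0).
Qed.

End GammaModulus.

(** * Stirling's formula along horizontal shifts *)

Section GammaAsymptotics.
Context {R : realType}.

Definition lognorm (t x : R) : R := ln (x ^+ 2 + t ^+ 2) / 2.

(* The real part of the leading term [(z - 1/2) log z - z] of Stirling's
   formula at [z = x + it], up to the constant [- pi t / 2]. *)
Definition stirling_main (t x : R) : R :=
  (x - 1 / 2) * lognorm t x - x - t * atan (t / x).

Lemma sqrD_gt0 (t x : R) : 0 < x -> 0 < x ^+ 2 + t ^+ 2.
Proof. by move=> x0; rewrite ltr_pwDl ?exprn_gt0 ?sqr_ge0. Qed.

Lemma is_derive_lognorm (t x : R) : 0 < x ->
  is_derive x 1 (lognorm t) (x / (x ^+ 2 + t ^+ 2)).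
Proof.
move=> x0; have p0 := sqrD_gt0 t x0.
have d1 : is_derive x 1 (fun y : R => y ^+ 2 + t ^+ 2) (2 * x).
  by apply: is_derive_eq; rewrite /GRing.scale /=; ring.
have d2 := @is_derive1_comp R (@ln R) (fun y => y ^+ 2 + t ^+ 2) x _ _ (is_derive1_ln p0) d1.
have d3 : is_derive x 1 (fun y => (@ln R \o (fun y => y ^+ 2 + t ^+ 2)) y * 2^-1)
   (x / (x ^+ 2 + t ^+ 2)).
  apply: is_derive_eq; rewrite /GRing.scale /=; field.
  by rewrite gt_eqF.
exact: d3.
Qed.

(** The function is the real part of z log z - z at z = x + it, an antiderivative of log z, and
    [lognorm t x] is the real part of log z. *)
Lemma is_derive_stirling (t x : R) : 0 < x ->
  is_derive x 1 (fun y => y * lognorm t y - y - t * atan (t / y)) (lognorm t x).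
Proof.
move=> x0; have p0 := sqrD_gt0 t x0.
have xn0 : x != 0 by rewrite gt_eqF.
have d1 := is_derive_lognorm t x0.
have d2 : is_derive x 1 (fun y : R => t / y) (- t / x ^+ 2).
  have d3 : is_derive x 1 (fun y : R => y^-1) (- x ^- 2 *: 1).
    exact: (@is_deriveV R id x 1 1 xn0 (is_derive_id x 1)).
  by apply: is_derive_eq; rewrite /GRing.scale /=; field.
have d4 := @is_derive1_comp R atan (fun y : R => t / y) x _ _ (is_derive1_atan (t / x)) d2.
have d5 : is_derive x 1 (fun y => y * lognorm t y - y - t * (atan \o (fun y : R => t / y)) y)
  (lognorm t x).
  apply: is_derive_eq; rewrite /GRing.scale /=; field.
  by rewrite xn0 !gt_eqF// addr_gt0// ?exprn_gt0// exprn_gt0.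
exact: d5.
Qed.

(** The difference has the factor w - y and the numerator yw - t^2, whose absolute value is at most
    w^2 + t^2; this cancels one of the two denominators. *)
Lemma dlognorm_lipschitz (t x y w : R) : 0 < x -> x <= y -> y <= w ->
  `|y / (y ^+ 2 + t ^+ 2) - w / (w ^+ 2 + t ^+ 2)| <= (w - y) / (x ^+ 2 + t ^+ 2).
Proof.
move=> x0 xy yw; have y0 : 0 < y by exact: lt_le_trans xy.
have w0 : 0 < w by exact: lt_le_trans yw.
have px := sqrD_gt0 t x0; have py := sqrD_gt0 t y0; have pw := sqrD_gt0 t w0.
have -> : y / (y ^+ 2 + t ^+ 2) - w / (w ^+ 2 + t ^+ 2) =
    (w - y) * ((y * w - t ^+ 2) / ((y ^+ 2 + t ^+ 2) * (w ^+ 2 + t ^+ 2))).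
  by field; rewrite !gt_eqF.
rewrite normrM ger0_norm ?subr_ge0// ler_wpM2l ?subr_ge0//.
rewrite normrM normfV [X in _ / X]gtr0_norm ?mulr_gt0//.
rewrite ler_pdivrMr ?mulr_gt0//.
have h1 : `|y * w - t ^+ 2| <= w ^+ 2 + t ^+ 2.
  rewrite ler_norml; apply/andP; split; nra.
apply: le_trans h1 _; rewrite mulrA ler_peMl ?(ltW pw)//.
rewrite mulrC ler_pdivlMr// mul1r lerD2r ler_sqr ?nnegrE ?(ltW x0) ?(ltW y0)//.
Qed.

(** The left side is the error of the trapezoidal rule for [lognorm t] on [x, x + 1]; the -1/2 in
    [stirling_main] produces the trapezoid. With [E] the error on [x, y], the mean value theorem is
    used for [E] and then for [lognorm], leaving a difference of values of the derivative of
    [lognorm]. *)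
Lemma stirling_step (t x : R) : 0 < x ->
  `|stirling_main t (x + 1) - stirling_main t x - lognorm t x| <=
  (x ^+ 2 + t ^+ 2)^-1 / 2.
Proof.
move=> x0; have px := sqrD_gt0 t x0.
pose Phi y := y * lognorm t y - y - t * atan (t / y).
pose E y := Phi y - (y - x) / 2 * (lognorm t x + lognorm t y).
pose dE y := (lognorm t y - lognorm t x) / 2 - (y - x) / 2 * (y / (y ^+ 2 + t ^+ 2)).
have dEP (y : R) : x <= y -> is_derive y 1 E (dE y).
  move=> xy; have y0 : 0 < y by exact: lt_le_trans xy.
  have d1 := is_derive_stirling t y0; have d2 := is_derive_lognorm t y0.
  by apply: is_derive_eq; rewrite /GRing.scale /= /dE; field; rewrite gt_eqF ?sqrD_gt0.
have derc (f df : R -> R) (a b : R) : (forall y : R, a <= y -> is_derive y 1 f (df y)) ->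
    {within `[a, b], continuous f}.
  move=> h; apply: continuous_in_subspaceT => y; rewrite inE /= in_itv /= => /andP[ay _].
  by apply: differentiable_continuous; apply/derivable1_diffP; have [] := h y ay.
have [c] := @MVT R E dE x (x + 1) (ltac:(by rewrite ltrDl))
  (fun y yin => dEP y (ltac:(by move: yin; rewrite in_itv /= => /andP[/ltW]))) (derc _ _ _ _ dEP).
rewrite in_itv /= => /andP[xc cx1].
have dl (y : R) : x <= y -> is_derive y 1 (lognorm t) (y / (y ^+ 2 + t ^+ 2)).
  by move=> xy; apply: is_derive_lognorm; exact: lt_le_trans xy.
have [e] := @MVT R (lognorm t) _ x c xc
  (fun y yin => dl y (ltac:(by move: yin; rewrite in_itv /= => /andP[/ltW]))) (derc _ _ _ _ dl).
rewrite in_itv /= => /andP[xe ec] He HE.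
have -> : stirling_main t (x + 1) - stirling_main t x - lognorm t x = dE c.
  have -> : dE c = dE c * (x + 1 - x) by ring.
  by rewrite -HE /E /Phi /stirling_main; field.
have -> : dE c = (c - x) / 2 * (e / (e ^+ 2 + t ^+ 2) - c / (c ^+ 2 + t ^+ 2)).
  by rewrite /dE He; field; rewrite !gt_eqF ?sqrD_gt0//; lra.
have := dlognorm_lipschitz t x0 (ltW xe) (ltW ec).
set q := e / _ - _ => hq.
have cx : 0 <= c - x <= 1 by apply/andP; split; lra.
have ce : 0 <= c - e <= 1 by apply/andP; split; lra.
rewrite normrM [X in X * _]ger0_norm; last by rewrite divr_ge0//; case/andP: cx.
have hq1 : `|q| <= (x ^+ 2 + t ^+ 2)^-1.
  apply: le_trans hq _; rewrite ler_piMl ?invr_ge0 ?(ltW px)//; by case/andP: ce.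
rewrite mulrAC ler_pM2r ?invr_gt0//.
by case/andP: cx => c0 c1; apply: le_trans hq1; rewrite ler_piMl.
Qed.

Lemma gmod2_shift (s t : R) (n : nat) : 0 < s ->
  0 < gmod2 (s + n%:R) t -> 0 < gmod2 s t.
Proof.
move=> s0; elim: n => [|n IHn]; first by rewrite addr0.
have sn : 0 < s + n%:R by rewrite ltr_wpDr.
by rewrite -natr1 addrA gmod2S// (pmulr_rgt0 _ (sqrD_gt0 t sn)).
Qed.

Lemma natr_ge_exists (x : R) : exists n : nat, x <= n%:R.
Proof.
exists (Num.trunc `|x|).+1; apply: le_trans (ler_norm x) _.
exact/ltW/truncnS_gt.
Qed.

(** Far to the right [gmod2_ge] gives a positive bound, and the functional equation carries
    nonvanishing back to [s]. *)
Lemma gmod2_gt0 (s t : R) : 0 < s -> 0 < gmod2 s t.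
Proof.
move=> s0; have [n hn] := natr_ge_exists (4 + 7 * t ^+ 2).
have t0 := sqr_ge0 t.
apply: (@gmod2_shift _ _ n) => //.
have y2 : 2 <= s + n%:R - 2 by lra.
have u1 : 7 * t ^+ 2 / (2 * (s + n%:R - 2 + 2)) < 1.
  by rewrite ltr_pdivrMr; lra.
have := gmod2_ge y2 (ltW u1); rewrite subrK; apply: lt_le_trans.
by rewrite exprn_gt0// mulr_gt0 ?rgamma_gt0 ?subr_gt0//; [lra|move: u1; rewrite subrK].
Qed.

(** Only its convergence as t grows is established; the constant ln(2 pi)/2 of Stirling's formula is
    never computed. *)
Definition stirling_defect (t x : R) : R := ln (gmod2 x t) / 2 - stirling_main t x.

Lemma stirling_defect_step (t x : R) : 0 < x ->
  `|stirling_defect t (x + 1) - stirling_defect t x| <= (x ^+ 2 + t ^+ 2)^-1 / 2.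
Proof.
move=> x0; rewrite distrC; apply: le_trans (stirling_step t x0).
rewrite /stirling_defect gmod2S// lnM ?posrE; [|exact: sqrD_gt0|exact: gmod2_gt0].
rewrite le_eqVlt; apply/orP; left; apply/eqP; congr `| _ |.
by rewrite /lognorm; field.
Qed.

(** Each step costs at most 1/((t - 1 + N)(t + N)), because (t + N)^2 <= 2 (t^2 + N^2); these bounds
    telescope. *)
Lemma stirling_defect_sum (s t : R) (n : nat) : 0 < s -> 2 <= t ->
  `|stirling_defect t (s + n%:R) - stirling_defect t s| <=
  (t - 1)^-1 - (t - 1 + n%:R)^-1.
Proof.
move=> s0 t2; elim: n => [|n IHn]; first by rewrite !addr0 !subrr normr0.
have n0 : 0 <= n%:R :> R by [].
have sn : 0 < s + n%:R by rewrite ltr_wpDr.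
rewrite -natr1 addrA -(subrKA (stirling_defect t (s + n%:R))).
apply: le_trans (ler_normD _ _) _.
apply: le_trans (lerD (stirling_defect_step t sn) IHn) _.
set N := n%:R in n0 sn *; clearbody N; clear IHn n.
have : (t - 1 + N)^-1 - (t - 1 + (N + 1))^-1 = ((t - 1 + N) * (t + N))^-1.
  by field; rewrite !gt_eqF//; lra.
suff : ((s + N) ^+ 2 + t ^+ 2)^-1 / 2 <= ((t - 1 + N) * (t + N))^-1 by lra.
have h1 : 0 <= s * N by rewrite mulr_ge0// ltW.
have h2 := sqr_ge0 (t - N); have h3 := sqr_ge0 s.
rewrite -invfM lef_pV2 ?posrE; [lra|by rewrite mulr_gt0 ?sqrD_gt0|].
by rewrite mulr_gt0//; lra.
Qed.

Lemma atan_bounds (y : R) : 0 <= y -> y / (1 + y ^+ 2) <= atan y <= y.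
Proof.
rewrite le_eqVlt => /orP[/eqP <-|y0]; first by rewrite atan0 mul0r lexx.
have cat : {within `[0, y], continuous (@atan R)}.
  by apply: continuous_subspaceT => x; exact: continuous_atan.
have [c] := @MVT R atan (fun x => (1 + x ^+ 2)^-1) 0 y y0 (fun x _ => is_derive1_atan x) cat.
rewrite in_itv /= atan0 !subr0 => /andP[c0 cy] ->.
have h1 : 0 < 1 + c ^+ 2 by rewrite ltr_pwDl ?sqr_ge0.
apply/andP; split.
  rewrite mulrC ler_pM2r// lef_pV2 ?posrE ?ltr_pwDl ?sqr_ge0// lerD2l.
  by rewrite ler_sqr ?nnegrE ltW.
by rewrite ler_piMl ?(ltW y0)// invf_le1// lerDl sqr_ge0.
Qed.

Lemma atanV (y : R) : 0 < y -> atan y^-1 = pi / 2 - atan y.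
Proof.
move=> y0; have [/andP[a1 a2] ta] := atan_def y.
have a0 : 0 < atan y by rewrite -[X in X < _](atan0 R) lt_atan.
rewrite -[RHS]tanK; last by rewrite in_itv /=; apply/andP; split; lra.
congr atan; rewrite /tan sinB cosB sin_pihalf cos_pihalf !mul0r !mul1r subr0 add0r.
by rewrite -[X in X^-1]ta /tan invf_div.
Qed.

(* The subtracted term does not depend on [t]: it cancels when two values of
   [t] are compared. *)
Lemma stirling_defect_far (t x : R) : 0 < t -> 4 <= x -> 7 * t ^+ 2 <= x ->
  `|stirling_defect t x - (ln (rgamma x) - (x - 1 / 2) * ln x + x)| <= 9 * t ^+ 2 / x.
Proof.
move=> t0 x4 hx; have x0 : 0 < x by lra.
have t20 : 0 < t ^+ 2 by rewrite exprn_gt0.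
set u := t ^+ 2 / x; have u0 : 0 < u by rewrite divr_gt0.
have u7 : 7 * u <= 1 by rewrite /u mulrA ler_pdivrMr// mul1r.
have G0 := rgamma_gt0 x0; have M0 := gmod2_gt0 t x0.
have up : ln (gmod2 x t) / 2 <= ln (rgamma x).
  rewrite ler_pdivrMr// mulr_natr -lnXn// ler_ln ?posrE ?exprn_gt0//.
  exact: gmod2_le.
have lo : ln (rgamma x) - 7 * u <= ln (gmod2 x t) / 2.
  have y2 : 2 <= x - 2 by lra.
  have uE : 7 * t ^+ 2 / (2 * x) = 7 / 2 * u by rewrite /u; field; rewrite gt_eqF.
  have := @gmod2_ge R (x - 2) t y2; rewrite subrK uE => /(_ _) h.
  have {h} := h (ltac:(lra)).
  have h2 : 0 < 1 - 7 / 2 * u by lra.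
  rewrite -ler_ln ?posrE ?exprn_gt0 ?mulr_gt0// lnXn ?mulr_gt0// lnM ?posrE// [(ln _ + ln _) *+ 2]mulr2n.
  (* For w = 7u/2 <= 1/2 one has -ln(1 - w) <= w/(1 - w) <= 2w. *)
  have h3 : - (7 * u) <= ln (1 - 7 / 2 * u).
    have h4 : ln (1 - 7 / 2 * u)^-1 <= 7 * u.
      have -> : (1 - 7 / 2 * u)^-1 = 1 + (7 / 2 * u) / (1 - 7 / 2 * u).
        by move: h2; set w := 7 / 2 * u => h2; field; rewrite gt_eqF.
      have h5 : 0 <= (7 / 2 * u) / (1 - 7 / 2 * u) by rewrite divr_ge0//; lra.
      apply: le_trans (le_ln1Dx (lt_le_trans _ h5)) _; first lra.
      by rewrite ler_pdivrMr//; nra.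
    by rewrite -lerN2 opprK -lnV ?posrE.
  lra.
have l1 : 0 <= lognorm t x - ln x <= t ^+ 2 / x ^+ 2 / 2.
  have -> : lognorm t x - ln x = ln (1 + t ^+ 2 / x ^+ 2) / 2.
    have -> : 1 + t ^+ 2 / x ^+ 2 = (x ^+ 2 + t ^+ 2) / x ^+ 2 by field; rewrite gt_eqF.
    by rewrite ln_div ?posrE ?sqrD_gt0 ?exprn_gt0// lnXn// /lognorm [ln x *+ 2]mulr2n; field.
  have h : 0 <= t ^+ 2 / x ^+ 2 by rewrite divr_ge0 ?sqr_ge0.
  apply/andP; split; first by rewrite divr_ge0// ln_ge0// lerDl.
  by rewrite ler_pM2r ?invr_gt0// le_ln1Dx// (lt_le_trans _ h).
have l2 : 0 <= (x - 1 / 2) * (lognorm t x - ln x) <= u / 2.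
  case/andP: l1 => l1 l1'; apply/andP; split; first by rewrite mulr_ge0//; lra.
  have -> : u / 2 = x * (t ^+ 2 / x ^+ 2 / 2) by rewrite /u; field; rewrite gt_eqF.
  by apply: ler_pM => //; lra.
have l3 : 0 <= t * atan (t / x) <= u.
  have tx : 0 <= t / x by rewrite divr_ge0 ?ltW.
  have /andP[b1 b2] := atan_bounds tx; apply/andP; split.
    rewrite mulr_ge0 ?(ltW t0)//; apply: le_trans b1.
    by rewrite divr_ge0// addr_ge0 ?sqr_ge0.
  by rewrite /u expr2 -mulrA ler_pM2l.
(* The errors 7u, u/2 and u of the three terms add up to less than 9u. *)
rewrite -mulrA -/u /stirling_defect /stirling_main.
move: up lo l2 l3; clear.
set a := ln (gmod2 x t) / 2; set b := ln (rgamma x); set c := lognorm t x.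
set l := ln x; set p := t * _ => up lo /andP[l2 l2'] /andP[l3 l3'].
by rewrite ler_norml; apply/andP; split; nra.
Qed.

End GammaAsymptotics.

(** * The modulus of Gamma on a vertical line *)

Section GammaVertical.
Context {R : realType}.

Lemma stirling_defect_le (s t : R) (n : nat) : 0 < s -> 2 <= t ->
  `|stirling_defect t (s + n%:R) - stirling_defect t s| <= 2 / t.
Proof.
move=> s0 t2; apply: le_trans (stirling_defect_sum n s0 t2) _.
have n0 : 0 <= n%:R :> R by [].
apply: (@le_trans _ _ (t - 1)^-1); first by rewrite gerBl invr_ge0; lra.
by rewrite ler_pdivlMr ?ler_pdivrMl; lra.
Qed.

(** A shift to the right by any [n] changes the two defects by at most 2/t and 2/t'; for large [n]
    both are close to the same quantity, by [stirling_defect_far]. *)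
Lemma stirling_defect_cauchy (s t t' : R) : 0 < s -> 2 <= t -> 2 <= t' ->
  `|stirling_defect t s - stirling_defect t' s| <= 2 / t + 2 / t'.
Proof.
move=> s0 t2 t2'; apply/ler_addgt0Pr => e e0.
pose T := 9 * t ^+ 2 + 9 * t' ^+ 2.
have T0 : 0 < T by rewrite /T addr_gt0// mulr_gt0// exprn_gt0//; lra.
have p1 := sqr_ge0 t; have p2 := sqr_ge0 t'.
have Te0 : 0 <= T / e by rewrite divr_ge0 ?ltW.
(* The three summands secure 4 <= x, 7 t^2 <= x (also for t'), and a total error T/x of at most
   [e]. *)
have [n hn] := natr_ge_exists (4 + T + T / e).
set x := s + n%:R; have x0 : 0 < x by rewrite /x; lra.
have x4 : 4 <= x by rewrite /x; lra.
have f1 := @stirling_defect_far R t x (ltac:(lra)) x4 (ltac:(rewrite /x; move: hn; rewrite {1}/T; lra)).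
have f2 := @stirling_defect_far R t' x (ltac:(lra)) x4 (ltac:(rewrite /x; move: hn; rewrite {1}/T; lra)).
have s1 := stirling_defect_le n s0 t2; have s2 := stirling_defect_le n s0 t2'.
have Te : 9 * t ^+ 2 / x + 9 * t' ^+ 2 / x <= e.
  rewrite -mulrDl -/T ler_pdivrMr// mulrC -ler_pdivrMr// /x; lra.
move: f1 f2 s1 s2 Te; rewrite -/x !ler_norml; clear.
set a := stirling_defect t x; set b := stirling_defect t' x.
set c := stirling_defect t s; set d := stirling_defect t' s.
set q := ln _ - _ + _; set k := 9 * t ^+ 2 / x; set k' := 9 * t' ^+ 2 / x.
set m := 2 / t; set m' := 2 / t'.
move=> /andP[? ?] /andP[? ?] /andP[? ?] /andP[? ?] ?.
by apply/andP; split; lra.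
Qed.

(** Since atan(t/s) = pi/2 - atan(s/t) and t atan(s/t) is close to s, the term -s cancels and
    -(pi/2) t appears. *)
Lemma stirling_main_near (s t : R) : 0 < s -> 2 <= t ->
  `|stirling_main t s - ((s - 1 / 2) * ln t - pi / 2 * t)| <=
  ((s + 1) * s ^+ 2 + s ^+ 2) / t.
Proof.
move=> s0 t2; have t0 : 0 < t by lra.
pose w := s ^+ 2 / t ^+ 2.
have w0 : 0 <= w by rewrite divr_ge0 ?sqr_ge0.
have l1 : 0 <= lognorm t s - ln t <= w / 2.
  have -> : lognorm t s - ln t = ln (1 + w) / 2.
    have -> : 1 + w = (s ^+ 2 + t ^+ 2) / t ^+ 2 by rewrite /w; field; rewrite gt_eqF.
    by rewrite ln_div ?posrE ?sqrD_gt0 ?exprn_gt0// lnXn// /lognorm [ln t *+ 2]mulr2n; field.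
  apply/andP; split; first by rewrite divr_ge0// ln_ge0// lerDl.
  by rewrite ler_pM2r ?invr_gt0// le_ln1Dx// (lt_le_trans _ w0).
have wt : w <= s ^+ 2 / t.
  rewrite /w ler_wpM2l ?sqr_ge0// lef_pV2 ?posrE ?exprn_gt0// expr2 ler_peMl//; lra.
have st : 0 < s / t by rewrite divr_gt0.
have a1 : - (s ^+ 2 / t) <= t * atan (s / t) - s <= 0.
  have /andP[b1 b2] := atan_bounds (ltW st); apply/andP; split; last first.
    rewrite subr_le0; apply: le_trans (ler_wpM2l (ltW t0) b2) _.
    by rewrite mulrCA divff ?mulr1// gt_eqF.
  have -> : - (s ^+ 2 / t) = - (s * (s / t)) by rewrite mulrA.
  rewrite lerBrDr; apply: le_trans (ler_wpM2l (ltW t0) b1).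
  have -> : t * (s / t / (1 + (s / t) ^+ 2)) = s / (1 + (s / t) ^+ 2).
    by field; rewrite !gt_eqF// ltr_pwDl// ?exprn_gt0// sqr_ge0.
  set y := s / t in st *; have h : 0 < 1 + y ^+ 2 by rewrite ltr_pwDl// sqr_ge0.
  rewrite ler_pdivlMr//.
  have -> : (- (s * y) + s) * (1 + y ^+ 2) = s * ((1 - y) * (1 + y ^+ 2)) by ring.
  by rewrite ler_piMr ?(ltW s0)//; nra.
have -> : stirling_main t s - ((s - 1 / 2) * ln t - pi / 2 * t) =
    (s - 1 / 2) * (lognorm t s - ln t) + (t * atan (s / t) - s).
  have -> : atan (s / t) = pi / 2 - atan (t / s).
    by rewrite -atanV ?divr_gt0// invf_div.
  by rewrite /stirling_main; field.
apply: le_trans (ler_normD _ _) _; rewrite [leRHS]mulrDl; apply: lerD; last first.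
  by case/andP: a1 => a1 a1'; rewrite ler_norml a1 (le_trans a1')// divr_ge0 ?sqr_ge0 ?ltW.
rewrite normrM -mulrA; apply: ler_pM => //.
  by rewrite ler_norml; apply/andP; split; lra.
case/andP: l1 => l1 l1'; rewrite ger0_norm//.
by apply: le_trans l1' _; apply: le_trans wt; rewrite ler_pdivrMr//; lra.
Qed.

(** The intervals of radius C/t about [Q t], t >= 2, meet pairwise, so the supremum of their left
    ends lies in all of them; it is the constant c. Negative t follow by evenness. *)
Lemma gmod2_asymptotics (s : R) : 0 < s -> exists c C : R, 0 <= C /\
  forall t : R, 2 <= `|t| ->
  `|ln (gmod2 s t) / 2 - ((s - 1 / 2) * ln `|t| - pi / 2 * `|t| + c)| <= C / `|t|.
Proof.
move=> s0; pose C := 2 + ((s + 1) * s ^+ 2 + s ^+ 2).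
have C0 : 0 <= C by have := sqr_ge0 s; rewrite /C; nra.
pose Q t := ln (gmod2 s t) / 2 - ((s - 1 / 2) * ln t - pi / 2 * t).
have cauchy t t' : 2 <= t -> 2 <= t' -> Q t - C / t <= Q t' + C / t'.
  move=> t2 t2'.
  have h := stirling_defect_cauchy s0 t2 t2'.
  have n1 := stirling_main_near s0 t2; have n2 := stirling_main_near s0 t2'.
  move: h n1 n2; rewrite /Q /C /stirling_defect !mulrDl !ler_norml.
  set a := ln _ / 2; set b := ln _ / 2; set m := stirling_main t s; set m' := stirling_main t' s.
  set p := pi / 2 * t; set p' := pi / 2 * t'.
  move=> /andP[? ?] /andP[? ?] /andP[? ?]; lra.
pose A : set R := [set Q t - C / t | t in [set t | 2 <= t]].
have A0 : A !=set0 by exists (Q 2 - C / 2); exists 2 => /=.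
have ubA t' : 2 <= t' -> ubound A (Q t' + C / t').
  by move=> t2' _ [t t2 <-]; exact: cauchy.
exists (sup A), C; split => // t t2.
have key : `|Q `|t| - sup A| <= C / `|t|.
  have u1 : sup A <= Q `|t| + C / `|t| by apply: ge_sup => //; exact: ubA.
  have u2 : Q `|t| - C / `|t| <= sup A.
    by apply: ub_le_sup; [exists (Q 2 + C / 2); exact: ubA|exists `|t|].
  by rewrite ler_norml; apply/andP; split; lra.
have -> : gmod2 s t = gmod2 s `|t|.
  have [t0|t0] := leP 0 t; first by rewrite ger0_norm.
  by rewrite ltr0_norm// gmod2N.
by rewrite opprD addrA.
Qed.

End GammaVertical.

(** * Light-cone coordinates on the Lorentz group *)

Section LorentzCoordinates.
Context {R : realType}.
Variable d : nat.
Local Notation M := (mat R d).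

Definition idx_z (i : 'I_d.-1) : 'I_(d.-1 + 1 + 1) := lshift 1 (lshift 1 i).
Local Notation ia := (idx_d d).
Local Notation ib := (idx_d1 d).

Lemma sum_lorentz (F : 'I_(d.-1 + 1 + 1) -> R) :
  \sum_i F i = \sum_i F (idx_z i) + F ia + F ib.
Proof. by rewrite !big_split_ord /= !big_ord1. Qed.

Lemma idx_lorentzP (P : 'I_(d.-1 + 1 + 1) -> Prop) :
  (forall i, P (idx_z i)) -> P ia -> P ib -> forall i, P i.
Proof.
move=> hz ha hb i; rewrite -(fintype.splitK i); case: (fintype.split i) => [j|j] /=.
  rewrite -(fintype.splitK j); case: (fintype.split j) => [k|k] /=; first exact: hz.
  by rewrite (ord1 k).
by rewrite (ord1 j).
Qed.

Lemma eq_idx_z i j : (idx_z i == idx_z j) = (i == j).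
Proof. by rewrite !eq_lshift. Qed.

Lemma idx_za i : (idx_z i == ia) = false.
Proof. by rewrite eq_lshift eq_lrshift. Qed.

Lemma idx_az i : (ia == idx_z i) = false.
Proof. by rewrite eq_sym idx_za. Qed.

Lemma idx_zb i : (idx_z i == ib) = false.
Proof. by rewrite eq_lrshift. Qed.

Lemma idx_bz i : (ib == idx_z i) = false.
Proof. by rewrite eq_sym idx_zb. Qed.

Lemma idx_ab : (ia == ib) = false.
Proof. by rewrite eq_lrshift. Qed.

Lemma idx_ba : (ib == ia) = false.
Proof. by rewrite eq_sym idx_ab. Qed.

Definition idxE := (eq_idx_z, idx_za, idx_az, idx_zb, idx_bz, idx_ab, idx_ba, eqxx).

Lemma nmxE (x : 'cV[R]_d.-1) :
  ((forall i j, nmx x (idx_z i) (idx_z j) = (i == j)%:R) *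
   (forall i, nmx x (idx_z i) ia = - x i 0)%R *
   (forall i, nmx x (idx_z i) ib = x i 0) *
   (forall j, nmx x ia (idx_z j) = x j 0) *
   (forall j, nmx x ib (idx_z j) = x j 0) *
   (nmx x ia ia = 1 - normsq x / 2)%R * (nmx x ia ib = normsq x / 2)%R *
   (nmx x ib ia = - (normsq x / 2))%R * (nmx x ib ib = 1 + normsq x / 2)%R)%type.
Proof.
rewrite /nmx /idx_z /idx_d /idx_d1.
by refine (_, _, _, _, _, _, _, _, _); try (move=> ? ?); try (move=> ?);
  rewrite ?(block_mxEul, block_mxEur, block_mxEdl, block_mxEdr,
            col_mxEu, col_mxEd, row_mxEl, row_mxEr) ?mxE ?mulr1n.
Qed.

Lemma JmxE : ((forall i j, Jmx d (idx_z i) (idx_z j) = (i == j)%:R :> R) *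
   (forall i, Jmx d (idx_z i) ia = 0 :> R) *
   (forall i, Jmx d (idx_z i) ib = 0 :> R) *
   (forall j, Jmx d ia (idx_z j) = 0 :> R) *
   (forall j, Jmx d ib (idx_z j) = 0 :> R) *
   (Jmx d ia ia = 1 :> R) * (Jmx d ia ib = 0 :> R) *
   (Jmx d ib ia = 0 :> R) * (Jmx d ib ib = -1 :> R))%type.
Proof.
rewrite /Jmx /idx_z /idx_d /idx_d1.
by refine (_, _, _, _, _, _, _, _, _); try (move=> ? ?); try (move=> ?);
  rewrite ?(block_mxEul, block_mxEur, block_mxEdl, block_mxEdr) !mxE
    ?(eq_lshift, eq_lrshift, eq_rlshift) ?eqxx ?mulr1n.
Qed.

(** Light-cone rows, kept for every column so that matrix identities can be checked column by column
    through [lorentz_rowsP]. In these rows N acts unipotently and A diagonally. *)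
Definition zrow (m : nat) (g : 'M[R]_(d.-1 + 1 + 1, m)) i j : R := g (idx_z i) j.
Definition prow (m : nat) (g : 'M[R]_(d.-1 + 1 + 1, m)) j : R := g ib j - g ia j.
Definition qrow (m : nat) (g : 'M[R]_(d.-1 + 1 + 1, m)) j : R := g ib j + g ia j.

Lemma lorentz_rowsP (m : nat) (g h : 'M[R]_(d.-1 + 1 + 1, m)) :
  (forall i j, zrow g i j = zrow h i j) -> (forall j, prow g j = prow h j) ->
  (forall j, qrow g j = qrow h j) -> g = h.
Proof.
move=> ez ep eq; apply/matrixP; apply: idx_lorentzP => [i j|j|j].
- exact: ez.
- by have := ep j; have := eq j; rewrite /prow /qrow => h1 h2; lra.
- by have := ep j; have := eq j; rewrite /prow /qrow => h1 h2; lra.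
Qed.

Section NilpotentAction.
Variables (m : nat) (x : 'cV[R]_d.-1) (g : 'M[R]_(d.-1 + 1 + 1, m)).

Lemma zrow_nmx i j : zrow (nmx x *m g) i j = zrow g i j + x i 0 * prow g j.
Proof.
rewrite /zrow !mxE sum_lorentz !nmxE /prow.
rewrite (bigD1 i)//= big1 => [|k ki]; last by rewrite nmxE eq_sym (negbTE ki) mul0r.
by rewrite nmxE eqxx mulr1n; ring.
Qed.

Lemma prow_nmx j : prow (nmx x *m g) j = prow g j.
Proof.
rewrite /prow !mxE !sum_lorentz !nmxE.
under eq_bigr do rewrite nmxE.
under [X in _ - (X + _ + _)]eq_bigr do rewrite nmxE.
by ring.
Qed.

Lemma qrow_nmx j : qrow (nmx x *m g) j =
  qrow g j + 2 * (\sum_i x i 0 * zrow g i j) + normsq x * prow g j.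
Proof.
rewrite /prow /qrow /zrow !mxE !sum_lorentz !nmxE.
under eq_bigr do rewrite nmxE.
under [X in _ + (X + _ + _)]eq_bigr do rewrite nmxE.
by field.
Qed.

End NilpotentAction.

Lemma HmxE : ((forall i j, Hmx d (idx_z i) j = 0 :> R) *
   (forall i j, Hmx d i (idx_z j) = 0 :> R) *
   (Hmx d ia ia = 0 :> R) * (Hmx d ia ib = 1 :> R) *
   (Hmx d ib ia = 1 :> R) * (Hmx d ib ib = 0 :> R))%type.
Proof.
by rewrite /Hmx; refine (_, _, _, _, _, _); try (move=> ? ?); rewrite !mxE !idxE ?andbF ?andFb /= ?addr0 ?add0r//.
Qed.

Lemma scaleHmxE (t : R) i j : (t *: Hmx d) i j = t * Hmx d i j.
Proof. by rewrite mxE. Qed.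

Lemma Hmx_powS (t : R) (k : nat) i :
  ((forall j, ((t *: Hmx d) ^+ k.+1) i (idx_z j) = 0)%R *
   (((t *: Hmx d) ^+ k.+1) i ia = t * ((t *: Hmx d) ^+ k) i ib)%R *
   (((t *: Hmx d) ^+ k.+1) i ib = t * ((t *: Hmx d) ^+ k) i ia)%R)%type.
Proof.
rewrite exprSr; set A := _ ^+ k; split; [split => [j|]|].
- by rewrite !mxE big1// => l _; rewrite scaleHmxE HmxE !mulr0.
- rewrite mxE sum_lorentz big1 => [|l _]; last by rewrite scaleHmxE HmxE !mulr0.
  by rewrite !scaleHmxE !HmxE; ring.
- rewrite mxE sum_lorentz big1 => [|l _]; last by rewrite scaleHmxE HmxE !mulr0.
  by rewrite !scaleHmxE !HmxE; ring.
Qed.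

Lemma Hmx_powE (t : R) (k : nat) :
  [/\ forall i j, ((t *: Hmx d) ^+ k) (idx_z i) (idx_z j) = (i == j)%:R * 0 ^+ k,
      forall i, ((t *: Hmx d) ^+ k) (idx_z i) ia = 0 /\ ((t *: Hmx d) ^+ k) (idx_z i) ib = 0,
      forall j, ((t *: Hmx d) ^+ k) ia (idx_z j) = 0 /\ ((t *: Hmx d) ^+ k) ib (idx_z j) = 0,
      ((t *: Hmx d) ^+ k) ia ia = (t ^+ k + (- t) ^+ k) / 2 /\
      ((t *: Hmx d) ^+ k) ib ib = (t ^+ k + (- t) ^+ k) / 2 &
      ((t *: Hmx d) ^+ k) ia ib = (t ^+ k - (- t) ^+ k) / 2 /\
      ((t *: Hmx d) ^+ k) ib ia = (t ^+ k - (- t) ^+ k) / 2].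
Proof.
elim: k => [|k [_ h2 h3 [h4 h4'] [h5 h5']]].
  rewrite !expr0 subrr mul0r; split => [i j|i|j||]; rewrite ?mxE !idxE ?mulr1//.
  by rewrite mulr1n; split; field.
split => [i j|i|j||]; rewrite ?Hmx_powS.
- by rewrite exprS mul0r mulr0.
- by have [-> ->] := h2 i; rewrite mulr0.
- by [].
- by rewrite h5 h5' !exprS; split; field.
- by rewrite h4 h4' !exprS; split; field.
Qed.

Lemma cvg_expR_series (t : R) :
  (\sum_(k < m) t ^+ k / k`!%:R) @[m --> \oo] --> expR t.
Proof.
have := @is_cvg_series_exp_coeff R t; rewrite /expR; move/cvg_ex => [l hl].
rewrite (cvg_lim _ hl)//; rewrite seriesEord in hl.
exact: hl.
Qed.

Lemma cvg_expmx_entry (u v t : R) (F : nat -> R) :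
  (forall k, F k = u * t ^+ k + v * (- t) ^+ k) ->
  limn (fun m : nat => \sum_(k < m) F k / (k`!)%:R) = u * expR t + v * expR (- t).
Proof.
move=> FE; apply/cvg_lim => //.
have -> : (fun m : nat => \sum_(k < m) F k / (k`!)%:R) =
    (fun m => u * (\sum_(k < m) t ^+ k / k`!%:R) + v * (\sum_(k < m) (- t) ^+ k / k`!%:R)).
  apply/funext => m; rewrite !mulr_sumr -big_split; apply: eq_bigr => k _ /=.
  by rewrite FE; ring.
by apply: cvgD; apply: cvgM; [exact: cvg_cst|exact: cvg_expR_series|
  exact: cvg_cst|exact: cvg_expR_series].
Qed.

Lemma expmxE (t : R) :
  ((forall i j, expmx (t *: Hmx d) (idx_z i) (idx_z j) = (i == j)%:R) *
   (forall i, expmx (t *: Hmx d) (idx_z i) ia = 0) *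
   (forall i, expmx (t *: Hmx d) (idx_z i) ib = 0) *
   (forall j, expmx (t *: Hmx d) ia (idx_z j) = 0) *
   (forall j, expmx (t *: Hmx d) ib (idx_z j) = 0) *
   (expmx (t *: Hmx d) ia ia = (expR t + expR (- t)) / 2)%R *
   (expmx (t *: Hmx d) ib ib = (expR t + expR (- t)) / 2)%R *
   (expmx (t *: Hmx d) ia ib = (expR t - expR (- t)) / 2)%R *
   (expmx (t *: Hmx d) ib ia = (expR t - expR (- t)) / 2)%R)%type.
Proof.
have P k := Hmx_powE t k.
have Ent u v s i j : (forall k, ((t *: Hmx d) ^+ k) i j = u * s ^+ k + v * (- s) ^+ k) ->
    limn (fun m : nat => \sum_(k < m) ((t *: Hmx d) ^+ k) i j / (k`!)%:R) =
    u * expR s + v * expR (- s).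
  exact: (@cvg_expmx_entry u v s (fun k => ((t *: Hmx d) ^+ k) i j)).
have Z (F : nat -> R) : (forall k, F k = 0) ->
    limn (fun m : nat => \sum_(k < m) F k / (k`!)%:R) = 0.
  by move=> F0; rewrite (@cvg_expmx_entry 0 0 t)// => [|k]; rewrite ?F0 !mul0r addr0.
refine (_, _, _, _, _, _, _, _, _) => [i j|i|i|j|j||||]; rewrite /expmx mxE.
(* The z-block is the case of exponent 0: [0 ^+ k] is 1 for k = 0 and 0 otherwise. *)
- rewrite (Ent ((i == j)%:R) 0 0) => [|k].
    by rewrite expR0 mul0r addr0 mulr1.
  by have [-> _ _ _ _] := P k; rewrite mul0r addr0.
- by apply: (Z (fun k => ((t *: Hmx d) ^+ k) _ _)) => k; have [_ h _ _ _] := P k; have [] := h i.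
- by apply: (Z (fun k => ((t *: Hmx d) ^+ k) _ _)) => k; have [_ h _ _ _] := P k; have [] := h i.
- by apply: (Z (fun k => ((t *: Hmx d) ^+ k) _ _)) => k; have [_ _ h _ _] := P k; have [] := h j.
- by apply: (Z (fun k => ((t *: Hmx d) ^+ k) _ _)) => k; have [_ _ h _ _] := P k; have [] := h j.
- rewrite (Ent (2^-1) (2^-1) t) => [|k]; first by field.
  by have [_ _ _ [-> _] _] := P k; field.
- rewrite (Ent (2^-1) (2^-1) t) => [|k]; first by field.
  by have [_ _ _ [_ ->] _] := P k; field.
- rewrite (Ent (2^-1) (- 2^-1) t) => [|k]; first by field.
  by have [_ _ _ _ [-> _]] := P k; field.
- rewrite (Ent (2^-1) (- 2^-1) t) => [|k]; first by field.
  by have [_ _ _ _ [_ ->]] := P k; field.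
Qed.

Section BoostAction.
Variables (m : nat) (t : R) (g : 'M[R]_(d.-1 + 1 + 1, m)).

Lemma zrow_expmx i j : zrow (expmx (t *: Hmx d) *m g) i j = zrow g i j.
Proof.
rewrite /zrow mxE sum_lorentz !expmxE.
rewrite (bigD1 i)//= big1 => [|k ki]; last by rewrite expmxE eq_sym (negbTE ki) mul0r.
by rewrite expmxE eqxx mulr1n; ring.
Qed.

Lemma prow_expmx j : prow (expmx (t *: Hmx d) *m g) j = expR (- t) * prow g j.
Proof.
rewrite /prow [X in X - _]mxE [X in _ - X]mxE !sum_lorentz !expmxE.
rewrite !big1 => [|i _|i _]; [|by rewrite expmxE mul0r|by rewrite expmxE mul0r].
by field.
Qed.

Lemma qrow_expmx j : qrow (expmx (t *: Hmx d) *m g) j = expR t * qrow g j.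
Proof.
rewrite /qrow [X in X + _]mxE [X in _ + X]mxE !sum_lorentz !expmxE.
rewrite !big1 => [|i _|i _]; [|by rewrite expmxE mul0r|by rewrite expmxE mul0r].
by field.
Qed.

End BoostAction.

End LorentzCoordinates.

(** * Invariance of the Lorentz form under N and A *)

Section LorentzGroupFacts.
Context {R : realType}.
Variable d : nat.
Local Notation M := (mat R d).
Local Notation ia := (idx_d d).
Local Notation ib := (idx_d1 d).
Local Notation A t := (expmx (t *: Hmx d)).
Local Notation J := (@Jmx R d).

(** Polarisation of |z|^2 + a^2 - b^2 = |z|^2 - pq. *)
Lemma lorentz_formE (m : nat) (g : 'M[R]_(d.-1 + 1 + 1, m)) j k :
  (g^T *m J *m g) j k = \sum_i zrow g i j * zrow g i k
    - (prow g j * qrow g k + qrow g j * prow g k) / 2.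
Proof.
rewrite mxE; under eq_bigr => l _ do rewrite mxE.
have E l : \sum_j0 g^T j j0 * J j0 l =
    \sum_i zrow g i j * J (idx_z i) l + g ia j * J ia l + g ib j * J ib l.
  by rewrite sum_lorentz !mxE; under eq_bigr do rewrite mxE.
under eq_bigr => l _ do rewrite E.
rewrite sum_lorentz !JmxE.
have -> : \sum_i (\sum_i0 zrow g i0 j * J (idx_z i0) (idx_z i) + g ia j * J ia (idx_z i)
    + g ib j * J ib (idx_z i)) * g (idx_z i) k = \sum_i zrow g i j * zrow g i k.
  apply: eq_bigr => i _; rewrite !JmxE !mulr0 !addr0 (bigD1 i)//= big1 => [|l li].
    by rewrite JmxE eqxx addr0 mulr1.
  by rewrite JmxE (negbTE li) mulr0.
have -> : \sum_i zrow g i j * J (idx_z i) ia = 0 by rewrite big1// => i _; rewrite JmxE mulr0.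
have -> : \sum_i zrow g i j * J (idx_z i) ib = 0 by rewrite big1// => i _; rewrite JmxE mulr0.
by rewrite /prow /qrow; field.
Qed.

Lemma nmx_form (m : nat) (x : 'cV[R]_d.-1) (g : 'M[R]_(d.-1 + 1 + 1, m)) :
  (nmx x *m g)^T *m J *m (nmx x *m g) = g^T *m J *m g.
Proof.
apply/matrixP => j k; rewrite !lorentz_formE !prow_nmx !qrow_nmx.
under eq_bigr do rewrite !zrow_nmx.
set p := prow g j; set p' := prow g k.
have -> : \sum_i (zrow g i j + x i 0 * p) * (zrow g i k + x i 0 * p') =
    \sum_i zrow g i j * zrow g i k + (\sum_i x i 0 * zrow g i j) * p' +
    (\sum_i x i 0 * zrow g i k) * p + normsq x * (p * p').
  by rewrite /normsq !mulr_suml -!big_split; apply: eq_bigr => i _ /=; ring.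
by field.
Qed.

Lemma expmx_form (m : nat) (t : R) (g : 'M[R]_(d.-1 + 1 + 1, m)) :
  (A t *m g)^T *m J *m (A t *m g) = g^T *m J *m g.
Proof.
apply/matrixP => j k; rewrite !lorentz_formE !prow_expmx !qrow_expmx.
under eq_bigr do rewrite !zrow_expmx.
have e1 : expR (- t) * expR t = 1 by rewrite -expRD addNr expR0.
congr (_ - _ / 2).
have -> : expR (- t) * prow g j * (expR t * qrow g k) + expR t * qrow g j * (expR (- t) * prow g k)
  = (expR (- t) * expR t) * (prow g j * qrow g k + qrow g j * prow g k) by ring.
by rewrite e1 mul1r.
Qed.

Lemma nmxD (x y : 'cV[R]_d.-1) : nmx x *m nmx y = nmx (x + y).
Proof.
rewrite -[nmx y]mulmx1 -[RHS]mulmx1; apply: lorentz_rowsP => [i j|j|j].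
- by rewrite !zrow_nmx prow_nmx mxE; ring.
- by rewrite !prow_nmx.
- rewrite !qrow_nmx !prow_nmx.
  pose z i := zrow (1%:M : M) i j; pose p := prow (1%:M : M) j.
  have -> : \sum_i x i 0 * zrow (nmx y *m 1%:M) i j =
      \sum_i x i 0 * z i + (\sum_i x i 0 * y i 0) * p.
    rewrite mulr_suml -big_split; apply: eq_bigr => i _ /=; rewrite zrow_nmx -/p -/(z i).
    by ring.
  have -> : \sum_i (x + y) i 0 * zrow 1%:M i j =
      \sum_i x i 0 * z i + \sum_i y i 0 * z i.
    by rewrite -big_split; apply: eq_bigr => i _ /=; rewrite mxE -/(z i); ring.
  have -> : normsq (x + y) = normsq x + normsq y + 2 * \sum_i x i 0 * y i 0.
    rewrite /normsq mulr_sumr -!big_split; apply: eq_bigr => i _ /=.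
    by rewrite mxE; ring.
  by rewrite -/p; ring.
Qed.

Lemma nmx0 : nmx (0 : 'cV[R]_d.-1) = 1%:M.
Proof.
rewrite -[LHS]mulmx1; apply: lorentz_rowsP => [i j|j|j].
- by rewrite zrow_nmx mxE mul0r addr0.
- by rewrite prow_nmx.
- rewrite qrow_nmx /normsq !big1 => [|i _|i _]; rewrite ?mxE ?expr0n ?mul0r//.
  by rewrite mulr0 !addr0.
Qed.

Lemma nmxNK (x : 'cV[R]_d.-1) : nmx (- x) *m nmx x = 1%:M.
Proof. by rewrite nmxD addNr nmx0. Qed.

Lemma expmxD (s t : R) : A s *m A t = A (s + t).
Proof.
rewrite -[A t]mulmx1 -[RHS]mulmx1; apply: lorentz_rowsP => [i j|j|j].
- by rewrite !zrow_expmx.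
- by rewrite !prow_expmx mulrA -expRD opprD.
- by rewrite !qrow_expmx mulrA -expRD.
Qed.

Lemma expmx0 : A (0 : R) = 1%:M.
Proof.
rewrite -[LHS]mulmx1; apply: lorentz_rowsP => [i j|j|j].
- by rewrite zrow_expmx.
- by rewrite prow_expmx oppr0 expR0 mul1r.
- by rewrite qrow_expmx expR0 mul1r.
Qed.

Lemma expmxNK (t : R) : A (- t) *m A t = 1%:M.
Proof. by rewrite expmxD addNr expmx0. Qed.

Lemma Jmx_sqr : J *m J = 1%:M.
Proof.
rewrite /Jmx mulmx_block !mulmx0 !mul0mx !addr0 !add0r mul1mx -scalar_mxM mulrNN mulr1.
by rewrite -scalar_mx_block.
Qed.

Lemma det_lorentz_sqr (g : M) : g^T *m J *m g = J -> \det g ^+ 2 = 1.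
Proof.
move=> /(congr1 determinant); rewrite !det_mulmx det_tr => h.
have J1 : \det J * \det J = 1 by rewrite -det_mulmx Jmx_sqr det1.
have J0 : \det J != 0 by apply/eqP => j0; move: J1; rewrite j0 mul0r => /eqP; rewrite eq_sym oner_eq0.
by apply: (mulIf J0); rewrite mul1r -[RHS]h; ring.
Qed.

(** Avoids computing determinants: invariance gives det g = 1 or -1, and a square cannot have
    determinant -1. Both n(x) and exp(tH) are squares. *)
Lemma SOd1_square (g h : M) : g = h *m h -> g^T *m J *m g = J -> @SOd1 R d g.
Proof.
move=> gh gJ; split => //.
have := det_lorentz_sqr gJ; rewrite gh det_mulmx => /eqP.
rewrite sqrf_eq1 => /orP[/eqP //|/eqP h1].
by have := sqr_ge0 (\det h); rewrite expr2 h1 ler0N1.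
Qed.

Lemma SOd1_nmx (x : 'cV[R]_d.-1) : @SOd1 R d (nmx x).
Proof.
apply: (@SOd1_square _ (nmx (2^-1 *: x))).
  by rewrite nmxD -scalerDl (_ : 2^-1 + 2^-1 = 1) ?scale1r//; field.
by rewrite -[nmx x]mulmx1 nmx_form trmx1 mul1mx mulmx1.
Qed.

Lemma SOd1_expmx (t : R) : @SOd1 R d (A t).
Proof.
apply: (@SOd1_square _ (A (t / 2))).
  by rewrite expmxD; congr expmx; congr (_ *: _); field.
by rewrite -[A t]mulmx1 expmx_form trmx1 mul1mx mulmx1.
Qed.

Lemma SOd1M (g h : M) : @SOd1 R d g -> @SOd1 R d h -> @SOd1 R d (g *m h).
Proof.
move=> [dg gJ] [dh hJ]; split; first by rewrite det_mulmx dg dh mulr1.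
by rewrite trmx_mul -!mulmxA (mulmxA J) (mulmxA g^T) (mulmxA g^T) gJ mulmxA.
Qed.

Lemma SOd1_1 : @SOd1 R d (1%:M : M).
Proof. by split; rewrite ?det1// trmx1 mul1mx mulmx1. Qed.

Lemma prow_qrow_SO (g : M) : @SOd1 R d g ->
  prow g ib * qrow g ib = 1 + \sum_i zrow g i ib ^+ 2.
Proof.
move=> [_ gJ]; have := lorentz_formE g ib ib; rewrite gJ !JmxE.
under eq_bigr do rewrite -expr2.
set S := \sum_i _; set p := prow _ _; set q := qrow _ _ => h; lra.
Qed.

Lemma sumsqr_ge0 (g : M) : 0 <= \sum_i zrow g i ib ^+ 2.
Proof. by apply: sumr_ge0 => i _; exact: sqr_ge0. Qed.

Lemma prow_neq0 (g : M) : @SOd1 R d g -> prow g ib != 0.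
Proof.
move=> /prow_qrow_SO h; apply/eqP => p0; move: h; rewrite p0 mul0r.
by have := sumsqr_ge0 g => h1 h2; lra.
Qed.

End LorentzGroupFacts.

(** * The Iwasawa decomposition and the action of w_0 *)

Section IwasawaDecomposition.
Context {R : realType}.
Variable d : nat.
Local Notation M := (mat R d).
Local Notation ia := (idx_d d).
Local Notation ib := (idx_d1 d).
Local Notation A t := (expmx (t *: Hmx d)).
Local Notation J := (@Jmx R d).

Lemma zrow1 (i : 'I_d.-1) : zrow (1%:M : M) i ib = 0.
Proof. by rewrite /zrow mxE idxE. Qed.

Lemma prow1 : prow (1%:M : M) ib = 1.
Proof. by rewrite /prow !mxE !idxE subr0. Qed.

Lemma expmx_inj (s t : R) : A s = A t -> s = t.
Proof.
move=> /(congr1 (fun g : M => prow (g *m 1%:M) ib)).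
by rewrite !prow_expmx prow1 !mulr1 => /expR_inj/oppr_inj.
Qed.

Lemma logA_expmx (t : R) : logA (A t) = t.
Proof.
rewrite /logA; apply/esym/expmx_inj.
exact: (@xgetPex R 0 [set s | A t = A s] (ex_intro _ t erefl)).
Qed.

Lemma prow_grpK (k : M) : grpK k -> `|prow k ib| = 1.
Proof.
move=> [k' [kk _ ->]]; rewrite /prow /idx_d /idx_d1 block_mxEdr block_mxEur !mxE mulr1n subr0.
have : \det k' ^+ 2 = 1 by rewrite expr2 -[X in X * _]det_tr -det_mulmx kk det1.
by move=> /eqP; rewrite sqrf_eq1 => /orP[] /eqP ->; rewrite ?normrN normr1.
Qed.

(** Uniqueness of the A-component: on the last column |p| equals 1 for elements of K, is fixed by N
    and is scaled by exp(-t) under exp(tH). *)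
Lemma in_ANK_expmx (g a : M) : in_ANK g a -> a = A (- ln `|prow g ib|).
Proof.
move=> [[t _ <-] [n [k [[x _ <-] Kk ->]]]].
rewrite -mulmxA prow_expmx prow_nmx normrM prow_grpK// mulr1.
by rewrite ger0_norm ?expR_ge0// expRK opprK.
Qed.

(* The first two factors are read off the last column of [g]; the remaining
   factor fixes the last basis vector up to sign, hence lies in [K]. *)
Lemma in_ANK_exists (g : M) : @SOd1 R d g -> ((2 < d)%N -> 0 < prow g ib) ->
  in_ANK g (A (- ln `|prow g ib|)).
Proof.
move=> SOg pg; have p0 := prow_neq0 SOg; have pq := prow_qrow_SO SOg.
set t := - ln _; set p := prow g ib in p0 pg pq t *.
(* For d > 2 this sign is 1 by hypothesis; for d = 2 it is absorbed by the corner entry of the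
   factor in K. *)
pose e : R := Num.sg p.
have pe : p = e * `|p| by rewrite /e -numEsg.
have ee : e * e = 1 by rewrite /e -expr2 sqr_sg p0.
have et : expR t * p = e.
  rewrite /t expRN lnK ?posrE ?normr_gt0// {2}pe mulrCA mulVf ?mulr1//.
  by rewrite normr_eq0.
have et' : expR t * expR (- t) = 1 by rewrite -expRD subrr expR0.
pose x : 'cV[R]_d.-1 := \col_i (e * zrow g i ib).
pose k := nmx (- x) *m (A (- t) *m g).
have gE : g = A t *m nmx x *m k.
  rewrite /k -mulmxA (mulmxA (nmx x)) nmxD subrr nmx0 mul1mx mulmxA expmxD subrr.
  by rewrite expmx0 mul1mx.
have SOk : @SOd1 R d k by apply: SOd1M (SOd1_nmx _) (SOd1M (SOd1_expmx _ _) SOg).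
have kp : prow k ib = e by rewrite /k prow_nmx prow_expmx opprK et.
have kz i : zrow k i ib = 0.
  rewrite /k zrow_nmx zrow_expmx prow_expmx opprK et mxE [x i 0]mxE.
  have -> : zrow g i ib + - (e * zrow g i ib) * e = zrow g i ib * (1 - e * e) by ring.
  by rewrite ee subrr mulr0.
have kq : qrow k ib = e.
  have := prow_qrow_SO SOk; rewrite big1 => [|i _]; last by rewrite kz expr0n.
  rewrite kp addr0 => h; rewrite -[LHS]mul1r -ee -mulrA h mulr1 //.
have kib : k ib ib = e by move: kp kq; rewrite /prow /qrow => h1 h2; lra.
have kia : k ia ib = 0 by move: kp kq; rewrite /prow /qrow => h1 h2; lra.
clearbody k.
have col0 : ursubmx k = 0.
  apply/matrixP => i j; rewrite !mxE (ord1 j) -/ib.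
  rewrite -(fintype.splitK i); case: (fintype.split i) => [l|l] /=; first exact: kz.
  by rewrite (ord1 l).
have drE : drsubmx k = e%:M.
  by apply/matrixP => i j; rewrite !mxE (ord1 i) (ord1 j) -/ib kib mulr1n.
have [detk kJ] := SOk.
have kblock : k = block_mx (ulsubmx k) 0 (dlsubmx k) e%:M by rewrite -{1}(submxK k) col0 drE.
(* With the last column known, the off-diagonal block of the invariance relation kills the rest of
   the last row, and the upper left block becomes orthogonal. *)
have := kJ; rewrite {1 2}kblock /Jmx tr_block_mx !mulmx_block !(mulmx0, mul0mx, trmx0, addr0, add0r).
rewrite !mulmx1 tr_scalar_mx => /eq_block_mx[k1 _ k2 _].
have dl0 : dlsubmx k = 0.
  move: k2; rewrite -scalar_mxM mul_scalar_mx => /eqP; rewrite scaler_eq0.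
  rewrite mulrN1 oppr_eq0 => /orP[/eqP e0|/eqP //].
  by move: ee; rewrite e0 mul0r => /eqP; rewrite eq_sym oner_eq0.
have kk : (ulsubmx k)^T *m ulsubmx k = 1%:M.
  by move: k1; rewrite dl0 trmx0 !mul0mx addr0.
have kb : k = block_mx (ulsubmx k) 0 0 e%:M by rewrite {1}kblock dl0.
have dete : \det (ulsubmx k) = e.
  have : \det (ulsubmx k) * e = 1.
    by rewrite -detk {2}kb det_ublock det_scalar1.
  by move=> h; rewrite -[LHS]mulr1 -ee mulrA h mul1r.
split; first by exists t.
exists (nmx x), k; split => //; first by exists x.
exists (ulsubmx k); split => //; last by rewrite dete.
by move=> /pg pp; rewrite dete /e gtr0_sg.
Qed.

Lemma logA_iwasawaA (g : M) : @SOd1 R d g -> ((2 < d)%N -> 0 < prow g ib) ->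
  logA (iwasawaA g) = - ln `|prow g ib|.
Proof.
move=> SOg pg.
have := @xgetPex M 1%:M [set a | in_ANK g a] (ex_intro _ _ (in_ANK_exists SOg pg)).
by rewrite -/(iwasawaA g) => /in_ANK_expmx ->; rewrite logA_expmx.
Qed.

Lemma w0E (g : M) i j : (w0 d *m g) i j =
  (if (i == d.-2 :> nat) || (i == d.-1 :> nat) then -1 else 1) * g i j.
Proof. by rewrite mul_diag_mx !mxE. Qed.

Lemma w0_a (g : M) j : (w0 d *m g) ia j = - g ia j.
Proof. by rewrite w0E /= addn0 eqxx orbT mulN1r. Qed.

Lemma w0_b (g : M) j : (w0 d *m g) ib j = g ib j.
Proof.
rewrite w0E; suff -> : (ib == d.-2 :> nat) || (ib == d.-1 :> nat) = false by rewrite mul1r.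
by rewrite /= addn0 addn1 [d.-1.+1 == d.-1]gtn_eqF// orbF gtn_eqF// ltnS leq_pred.
Qed.

(** The element w_0 changes the sign of a and fixes b, so it exchanges p and q; hence the
    A-component of w_0 y is read off q. *)
Lemma prow_w0 (g : M) j : prow (w0 d *m g) j = qrow g j.
Proof. by rewrite /prow w0_a w0_b opprK. Qed.

Lemma w0_form (g : M) : (w0 d *m g)^T *m J *m (w0 d *m g) = g^T *m J *m g.
Proof.
apply/matrixP => j k; rewrite !lorentz_formE !prow_w0 /qrow !w0_a !w0_b.
congr (_ - _); last by rewrite /prow; ring.
apply: eq_bigr => i _; rewrite /zrow !w0E.
by case: ifP => _; rewrite ?mulN1r ?mulrNN ?mul1r.
Qed.

Lemma det_w0 : (2 <= d)%N -> \det (w0 d : M) = 1.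
Proof.
move=> d2; rewrite det_diag; under eq_bigr do rewrite mxE.
rewrite !big_split_ord /= !big_ord1 /= !addn0 eqxx orbT.
have -> : (d.-1 + 1 == d.-2)%N || (d.-1 + 1 == d.-1)%N = false.
  by rewrite addn1 [_ == d.-1]gtn_eqF// orbF gtn_eqF// ltnS leq_pred.
have h : (d.-2 < d.-1)%N by rewrite prednK//; case: d d2 => [|[|]].
rewrite (bigD1 (Ordinal h))//= eqxx /= big1 => [|i ih]; first by ring.
have -> : (i == d.-2 :> nat) = false by apply: contraNF ih => /eqP ih; apply/eqP/val_inj.
by rewrite ltn_eqF.
Qed.

End IwasawaDecomposition.

(** * Topology of matrix spaces and of G *)

Section MatrixTopology.
Context {R : realType}.

Lemma continuous_mx (T : topologicalType) (m n : nat) (f : T -> 'M[R]_(m, n)) :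
  (forall i j, continuous (fun x => f x i j)) -> continuous f.
Proof.
move=> cf x B [P fP PB].
have h : \forall y \near x, forall i, forall j, P i j (f y i j).
  apply: filter_forall => i; apply: filter_forall => j.
  exact: (cf i j x (P i j) (fP i j)).
by apply: filterS h => y hy; exact: PB.
Qed.

Lemma compact_mx_box (m n : nat) (B : R) :
  compact [set g : 'M[R]_(m, n) | forall i j, `|g i j| <= B].
Proof.
have c1 : compact [set v : 'rV[R]_(m * n) | forall i, `[- B, B]%classic (v ord0 i)].
  by apply: (@rV_compact _ _ (fun=> `[- B, B]%classic)) => _; exact: segment_compact.
have c2 : continuous (@vec_mx R m n).
  apply: continuous_mx => i j.
  have -> : (fun v : 'rV[R]_(m * n) => vec_mx v i j) = (fun v => v ord0 (mxvec_index i j)).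
    by apply/funext => v; rewrite mxE.
  exact: coord_continuous.
have := continuous_compact (continuous_subspaceT c2) c1.
congr compact; apply/seteqP; split => [_ [v hv <-] i j|g hg].
  by rewrite mxE; have := hv (mxvec_index i j); rewrite /= in_itv /= -ler_norml.
exists (mxvec g); last exact: mxvecK.
by move=> k /=; rewrite in_itv /= -ler_norml; case/mxvec_indexP: k => i j; rewrite mxvecE.
Qed.

Lemma continuous_add (T : topologicalType) (f g : T -> R) :
  continuous f -> continuous g -> continuous (fun x => f x + g x).
Proof. by move=> cf cg x; apply: cvgD; [exact: cf|exact: cg]. Qed.

Lemma continuous_sub (T : topologicalType) (f g : T -> R) :
  continuous f -> continuous g -> continuous (fun x => f x - g x).
Proof. by move=> cf cg x; apply: cvgB; [exact: cf|exact: cg]. Qed.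

Lemma continuous_mul (T : topologicalType) (f g : T -> R) :
  continuous f -> continuous g -> continuous (fun x => f x * g x).
Proof. by move=> cf cg x; apply: cvgM; [exact: cf|exact: cg]. Qed.

Lemma continuous_bigsum (T : topologicalType) (I : Type) (r : seq I) (P : pred I)
    (f : I -> T -> R) : (forall i, continuous (f i)) ->
  continuous (fun x => \sum_(i <- r | P i) f i x).
Proof.
move=> cf x; elim: r => [|i r IHr].
  by rewrite (_ : (fun x => _) = cst 0); [exact: cst_continuous|
    apply/funext => y; rewrite big_nil].
rewrite (_ : (fun x => _) = (fun x => (if P i then f i x else 0) +
    \sum_(i <- r | P i) f i x)); last first.
  by apply/funext => y; rewrite big_cons; case: ifP => // _; rewrite add0r.
by apply: cvgD => //; case: ifP => _; [exact: cf|exact: cvg_cst].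
Qed.

Lemma continuous_bigprod (T : topologicalType) (I : Type) (r : seq I)
    (f : I -> T -> R) : (forall i, continuous (f i)) ->
  continuous (fun x => \prod_(i <- r) f i x).
Proof.
move=> cf x; elim: r => [|i r IHr].
  by rewrite (_ : (fun x => _) = cst 1); [exact: cst_continuous|
    apply/funext => y; rewrite big_nil].
rewrite (_ : (fun x => _) = (fun x => f i x * \prod_(i <- r) f i x)); last first.
  by apply/funext => y; rewrite big_cons.
by apply: cvgM => //; exact: cf.
Qed.

Lemma continuous_det (n : nat) : continuous (fun g : 'M[R]_n => \det g).
Proof.
apply: (@continuous_bigsum 'M[R]_n 'S_n (index_enum _) xpredT
  (fun s g => (-1) ^+ s * \prod_i g i (s i))) => s.
apply: continuous_mul; first exact: cst_continuous.
by apply: (@continuous_bigprod 'M[R]_n 'I_n (index_enum _) (fun i g => g i (s i))) => i;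
  exact: coord_continuous.
Qed.

Lemma closed_level (T : topologicalType) (f : T -> R) (c : R) :
  continuous f -> closed [set x | f x = c].
Proof.
move=> cf; have -> : [set x | f x = c] = f @^-1` [set c] by [].
by apply: closed_comp => [x _|]; [exact: cf|exact: closed_eq].
Qed.

End MatrixTopology.

Section GroupTopology.
Context {R : realType}.
Variable d : nat.
Local Notation M := (mat R d).
Local Notation ia := (idx_d d).
Local Notation ib := (idx_d1 d).
Local Notation A t := (expmx (t *: Hmx d)).
Local Notation J := (@Jmx R d).
Local Notation G := (@grpG R d).

Lemma continuous_zrow i j : continuous (fun g : M => zrow g i j).
Proof. exact: coord_continuous. Qed.

Lemma continuous_prow j : continuous (fun g : M => prow g j).
Proof. by apply: continuous_sub; exact: coord_continuous. Qed.

Lemma continuous_qrow j : continuous (fun g : M => qrow g j).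
Proof. by apply: continuous_add; exact: coord_continuous. Qed.

Lemma closed_SOd1 : closed (@SOd1 R d).
Proof.
have -> : @SOd1 R d = [set g | \det g = 1] `&`
    \bigcap_(i in setT) \bigcap_(j in setT) [set g : M | (g^T *m J *m g) i j = J i j].
  apply/seteqP; split => [g [h1 h2]|g [h1 h2]]; split => //.
    by move=> i _ j _ /=; rewrite h2.
  by apply/matrixP => i j; exact: h2.
apply: closedI; first exact/closed_level/continuous_det.
apply: closed_bigI => i _; apply: closed_bigI => j _; apply: closed_level.
rewrite (_ : (fun g => _) = (fun g : M => \sum_k zrow g k i * zrow g k j
    - (prow g i * qrow g j + qrow g i * prow g j) / 2)); last first.
  by apply/funext => g; rewrite lorentz_formE.
apply: continuous_sub.
  apply: (@continuous_bigsum R M 'I_d.-1 (index_enum _) xpredT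
    (fun k g => zrow g k i * zrow g k j)) => k.
  by apply: continuous_mul; exact: continuous_zrow.
apply: continuous_mul; last exact: cst_continuous.
by apply: continuous_add; apply: continuous_mul;
  [exact: continuous_prow|exact: continuous_qrow|exact: continuous_qrow|exact: continuous_prow].
Qed.

Lemma grpG_SOd1 g : G g -> @SOd1 R d g.
Proof. by rewrite /grpG; case: ifP => // _; exact: connected_component_sub. Qed.

Lemma closed_grpG : closed G.
Proof.
rewrite /grpG; case: ifP => _; last exact: closed_SOd1.
exact/component_closed/closed_SOd1.
Qed.

Lemma grpG1 : G 1%:M.
Proof.
rewrite /grpG; case: ifP => _; last exact: SOd1_1.
exact/connected_component_refl/SOd1_1.
Qed.

(** On SO(d,1) the continuous function p never vanishes, and it equals 1 at the identity; a
    connected image cannot cross 0. *)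
Lemma grpG_prow_gt0 g : (2 < d)%N -> G g -> 0 < prow g ib.
Proof.
move=> d2; rewrite /grpG d2 => Gg; rewrite ltNge; apply/negP => p0.
have cC := @component_connected M (@SOd1 R d) 1%:M.
have cp : {within connected_component (@SOd1 R d) 1%:M, continuous (fun g : M => prow g ib)}.
  by apply: continuous_subspaceT; exact: continuous_prow.
have := connected_continuous_connected cC cp => /connected_intervalP itv.
have i1 : ((fun g : M => prow g ib) @` connected_component (@SOd1 R d) 1%:M) 1.
  by exists 1%:M; [exact/connected_component_refl/SOd1_1|exact: prow1].
have i2 : ((fun g : M => prow g ib) @` connected_component (@SOd1 R d) 1%:M) (prow g ib).
  by exists g.
have [h Gh h0] := itv _ _ i2 i1 0 (ltac:(by rewrite p0 ler01)).
by have := prow_neq0 (connected_component_sub Gh); rewrite h0 eqxx.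
Qed.

Lemma continuous_nmx_path (x : 'cV[R]_d.-1) (g : M) :
  continuous (fun r : R => nmx (r *: x) *m g).
Proof.
have cz i j : continuous (fun r : R => zrow (nmx (r *: x) *m g) i j).
  rewrite (_ : (fun r => _) = (fun r => zrow g i j + r * (x i 0 * prow g j))); last first.
    by apply/funext => r; rewrite zrow_nmx mxE mulrA.
  by move=> r; apply: cvgD; [exact: cvg_cst|apply: cvgM; [exact: cvg_id|exact: cvg_cst]].
have cp j : continuous (fun r : R => prow (nmx (r *: x) *m g) j).
  rewrite (_ : (fun r => _) = cst (prow g j)); first by move=> r; exact: cvg_cst.
  by apply/funext => r; rewrite prow_nmx.
have cq j : continuous (fun r : R => qrow (nmx (r *: x) *m g) j).
  rewrite (_ : (fun r => _) = (fun r => qrow g j + r * (2 * \sum_i x i 0 * zrow g i j)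
     + r * r * (normsq x * prow g j))); last first.
    apply/funext => r; rewrite qrow_nmx; congr (_ + _ + _).
      by rewrite mulrCA; congr (_ * _); rewrite mulr_sumr; apply: eq_bigr => i _; rewrite mxE mulrA.
    rewrite mulrA; congr (_ * _); rewrite /normsq mulr_sumr.
    by apply: eq_bigr => i _; rewrite mxE; ring.
  move=> r; apply: cvgD; last first.
    by apply: cvgM; [apply: cvgM; exact: cvg_id|exact: cvg_cst].
  by apply: cvgD; [exact: cvg_cst|apply: cvgM; [exact: cvg_id|exact: cvg_cst]].
apply: continuous_mx => i j; elim/idx_lorentzP: i.
- by move=> i; exact: cz.
- rewrite (_ : (fun r => _) = (fun r => (qrow (nmx (r *: x) *m g) j - prow (nmx (r *: x) *m g) j) / 2)).
    by move=> r; apply: cvgM; [apply: cvgB; [exact: cq|exact: cp]|exact: cvg_cst].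
  by apply/funext => r; rewrite /qrow /prow; field.
- rewrite (_ : (fun r => _) = (fun r => (qrow (nmx (r *: x) *m g) j + prow (nmx (r *: x) *m g) j) / 2)).
    by move=> r; apply: cvgM; [apply: cvgD; [exact: cq|exact: cp]|exact: cvg_cst].
  by apply/funext => r; rewrite /qrow /prow; field.
Qed.

Lemma continuous_expmx_path (t : R) (g : M) :
  continuous (fun r : R => A (r * t) *m g).
Proof.
have ce (s : R) : continuous (fun r : R => expR (r * s)).
  move=> r; apply: continuous_comp; last exact: continuous_expR.
  by apply: cvgM; [exact: cvg_id|exact: cvg_cst].
have cp j : continuous (fun r : R => prow (A (r * t) *m g) j).
  rewrite (_ : (fun r => _) = (fun r => expR (r * - t) * prow g j)).
    by move=> r; apply: cvgM; [exact: ce|exact: cvg_cst].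
  by apply/funext => r; rewrite prow_expmx mulrN.
have cq j : continuous (fun r : R => qrow (A (r * t) *m g) j).
  rewrite (_ : (fun r => _) = (fun r => expR (r * t) * qrow g j)).
    by move=> r; apply: cvgM; [exact: ce|exact: cvg_cst].
  by apply/funext => r; rewrite qrow_expmx.
apply: continuous_mx => i j; elim/idx_lorentzP: i.
- move=> i; rewrite (_ : (fun r => _) = cst (zrow g i j)); first by move=> r; exact: cvg_cst.
  by apply/funext => r; rewrite -[LHS]/(zrow _ i j) zrow_expmx.
- rewrite (_ : (fun r => _) = (fun r => (qrow (A (r * t) *m g) j - prow (A (r * t) *m g) j) / 2)).
    by move=> r; apply: cvgM; [apply: cvgB; [exact: cq|exact: cp]|exact: cvg_cst].
  by apply/funext => r; rewrite /qrow /prow; field.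
- rewrite (_ : (fun r => _) = (fun r => (qrow (A (r * t) *m g) j + prow (A (r * t) *m g) j) / 2)).
    by move=> r; apply: cvgM; [apply: cvgD; [exact: cq|exact: cp]|exact: cvg_cst].
  by apply/funext => r; rewrite /qrow /prow; field.
Qed.

(** The image of [0, 1] is a connected subset of SO(d,1) joining [f 0] to [f 1]. Applied to paths in
    N and A, it shows that left translation by these subgroups preserves G. *)
Lemma grpG_path (f : R -> M) : continuous f -> (forall r, @SOd1 R d (f r)) ->
  G (f 0) -> G (f 1).
Proof.
move=> cf SOf; rewrite /grpG; case: ifP => // _ G0.
apply: connected_component_trans G0 _.
exists (f @` `[0, 1]); last by exists 1 => //=; rewrite in_itv /= ler01 lexx.
split; first by exists 0 => //=; rewrite in_itv /= ler01 lexx.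
  by move=> _ [r _ <-].
apply: connected_continuous_connected; last exact: continuous_subspaceT.
exact: segment_connected.
Qed.

Lemma grpG_nmx (x : 'cV[R]_d.-1) (g : M) : G g -> G (nmx x *m g).
Proof.
move=> Gg; have := @grpG_path _ (@continuous_nmx_path x g).
rewrite scale0r nmx0 mul1mx scale1r; apply => // r.
exact: SOd1M (SOd1_nmx _) (grpG_SOd1 Gg).
Qed.

Lemma grpG_expmx (t : R) (g : M) : G g -> G (A t *m g).
Proof.
move=> Gg; have := @grpG_path _ (@continuous_expmx_path t g).
rewrite mul0r expmx0 mul1mx mul1r; apply => // r.
exact: SOd1M (SOd1_expmx _ _) (grpG_SOd1 Gg).
Qed.

End GroupTopology.

(** * Integration over G *)

Section FlowDisintegration.
Context {R : realType} {d : measure_display} {X : measurableType d}.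
Variable nu : {sigma_finite_measure set X -> \bar R}.
Variable D : set X.
Hypothesis mD : measurable D.
Hypothesis nuD : nu (~` D) = 0%E.
Local Notation L := (@lebesgue_measure R).
Local Open Scope ereal_scope.

Lemma eq_integral_full (f g : X -> \bar R) :
  measurable_fun setT f -> measurable_fun setT g ->
  (forall y, D y -> f y = g y) -> \int[nu]_y f y = \int[nu]_y g y.
Proof.
move=> mf mg fg; apply: ae_eq_integral => //.
exists (~` D); split => //; first exact: measurableC.
by move=> y /= nfg Dy; apply: nfg => _; exact: fg.
Qed.

Variables (T : R -> X -> X) (c : X -> R) (F W : X -> R -> R).
Hypothesis mT : forall r, measurable_fun setT (T r).
Hypothesis nuT : forall r (f : X -> \bar R), measurable_fun setT f ->
  (forall y, 0 <= f y) -> \int[nu]_y f (T r y) = \int[nu]_y f y.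
Hypothesis mc : measurable_fun setT c.
Hypothesis mF : measurable_fun setT (fun z : X * R => F z.1 z.2).
Hypothesis mW : measurable_fun setT (fun z : X * R => W z.1 z.2).
Hypothesis F_ge0 : forall y r, (0 <= F y r)%R.
Hypothesis W_ge0 : forall y r, (0 <= W y r)%R.
Hypothesis cT : forall r y, D y -> c (T r y) = (c y + r)%R.
Hypothesis FT : forall r y t, D y -> F (T r y) t = F y t.
Hypothesis WT : forall r y t, D y -> W (T r y) t = W y t.
Hypothesis W1 : forall y, D y -> \int[L]_t (W y t)%:E = 1.

(** Integrating out one orbit coordinate: insert the integral of [W y (c y + r)] over [r], which is
    1, translate by [T (- r)], and integrate over [r] first. The roles of F and W along the orbit
    are exchanged. *)
Lemma flow_disintegration :
  \int[nu]_y (F y (c y))%:E = \int[nu]_y ((W y (c y))%:E * \int[L]_t (F y t)%:E).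
Proof.
pose Phi (z : X * R) : R := (F z.1 (c z.1) * W z.1 (c z.1 + z.2))%R.
pose Psi (z : X * R) : R := (F z.1 (c z.1 - z.2) * W z.1 (c z.1))%R.
have mG (H : X -> R -> R) (s : X * R -> R) :
    measurable_fun setT (fun z : X * R => H z.1 z.2) -> measurable_fun setT s ->
    measurable_fun setT (fun z : X * R => H z.1 (s z)).
  move=> mH ms; apply: (measurableT_comp mH (g := fun z : X * R => (z.1, s z))).
  by mfun.
have mPhi : measurable_fun setT (fun z => (Phi z)%:E).
  by apply/measurable_EFinP; apply: measurable_funM; apply: mG => //; mfun.
have mPsi : measurable_fun setT (fun z => (Psi z)%:E).
  by apply/measurable_EFinP; apply: measurable_funM; apply: mG => //; mfun.
have Phi0 z : 0 <= (Phi z)%:E by rewrite lee_fin mulr_ge0.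
have Psi0 z : 0 <= (Psi z)%:E by rewrite lee_fin mulr_ge0.
have mFy y : measurable_fun setT (fun t => (F y t)%:E).
  apply/measurable_EFinP; apply: (measurableT_comp mF (g := fun t : R => (y, t))).
  by mfun.
have mWy y : measurable_fun setT (fun t => (W y t)%:E).
  apply/measurable_EFinP; apply: (measurableT_comp mW (g := fun t : R => (y, t))).
  by mfun.
have mFc : measurable_fun setT (fun y => (F y (c y))%:E).
  apply/measurable_EFinP; apply: (measurableT_comp mF (g := fun y : X => (y, c y))).
  by mfun.
transitivity (\int[nu]_y \int[L]_r (Phi (y, r))%:E).
  apply: eq_integral_full => //.
    exact: (@measurable_fun_fubini_tonelli_F _ _ _ _ R L _ mPhi Phi0).
  move=> y Dy; under eq_integral => r _ do rewrite /Phi /= EFinM addrC.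
  rewrite ge0_integralZl_EFin//; last 2 first.
  - by move=> t _; rewrite lee_fin.
  - by apply: (measurableT_comp (mWy y) (g := fun x : R => (x + c y)%R)); mfun.
  rewrite (@ge0_integral_shift R (c y) (fun t => (W y t)%:E))//; last first.
    by move=> t; rewrite lee_fin.
  by rewrite W1// mule1.
etransitivity; first by apply: esym; exact: (@fubini_tonelli1 _ _ _ _ R nu L _ mPhi Phi0).
etransitivity; first exact: (@fubini_tonelli2 _ _ _ _ R nu L _ mPhi Phi0).
(* Invariance under [T (- r)]: F and W are unchanged in their first argument, and [c y] becomes
   [c y - r]. *)
transitivity (\int[L]_r \int[nu]_y (Psi (y, r))%:E).
  apply: eq_integral => r _; rewrite /fubini_G.
  have mPhir : measurable_fun setT (fun y => (Phi (y, r))%:E).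
    by apply: (measurableT_comp mPhi (g := fun y : X => (y, r))); mfun.
  have mPsir : measurable_fun setT (fun y => (Psi (y, r))%:E).
    by apply: (measurableT_comp mPsi (g := fun y : X => (y, r))); mfun.
  rewrite -(nuT (- r) mPhir)//; apply: eq_integral_full => //.
    exact: (measurableT_comp mPhir (mT _)).
  by move=> y Dy; rewrite /Phi /Psi /= cT// FT// WT// subrK.
etransitivity; first by apply: esym; exact: (@fubini_tonelli2 _ _ _ _ R nu L _ mPsi Psi0).
etransitivity; first exact: (@fubini_tonelli1 _ _ _ _ R nu L _ mPsi Psi0).
apply: eq_integral => y _; rewrite /fubini_F /Psi /=.
under eq_integral => r _ do rewrite mulrC EFinM.
rewrite ge0_integralZl_EFin//; last 2 first.
- by move=> t _; rewrite lee_fin.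
- by apply: (measurableT_comp (mFy y) (g := fun x : R => (c y - x)%R)); mfun.
rewrite (@ge0_integral_reflect R (c y) (fun t => (F y t)%:E))//.
by move=> t; rewrite lee_fin.
Qed.

End FlowDisintegration.

Section GaussianIntegral.
Context {R : realType}.
Local Notation L := (@lebesgue_measure R).

Lemma integral_gauss_affine (k b : R) : 0 < k ->
  (\int[L]_x (expR (- (k * (x + b) ^+ 2)))%:E = (Num.sqrt (pi / k))%:E)%E.
Proof.
move=> k0; have s0 : 0 < Num.sqrt k by rewrite sqrtr_gt0.
have m : measurable_fun [set: R] (fun x => (gauss_fun x)%:E).
  by apply/measurable_EFinP; exact: measurable_gauss_fun.
have := @ge0_integral_affine R (Num.sqrt k) (Num.sqrt k * b) (fun x => (gauss_fun x)%:E)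
  (lt0r_neq0 s0) m (fun x => gauss_fun_ge0 x).
rewrite integralT_gauss -EFinM.
have -> : `|Num.sqrt k|^-1 * Num.sqrt pi = Num.sqrt (pi / k).
  by rewrite gtr0_norm// mulrC sqrtrM ?pi_ge0// sqrtrV// ltW.
move=> <-; apply: eq_integral => x _; congr (expR _)%:E.
by rewrite -mulrDr exprMn sqr_sqrtr// ltW.
Qed.

End GaussianIntegral.

(** * Borel measurability and the Haar measure *)

Section BorelMatrices.
Context {R : realType}.
Variable d : nat.
Local Notation M := (mat R d).
Local Notation B := (borel_mat R d).
Local Notation ib := (idx_d1 d).

Lemma open_borel (U : set M) : open U -> measurable (U : set B).
Proof. by move=> oU; exact: sub_sigma_algebra. Qed.

Lemma closed_borel (C : set M) : closed C -> measurable (C : set B).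
Proof.
by move=> cC; rewrite -[C]setCK; apply: measurableC; apply: open_borel; exact: closed_openC.
Qed.

Lemma continuous_borel (f : M -> R) : continuous f ->
  measurable_fun [set: B] (f : B -> R).
Proof.
move=> /continuousP cf; apply: (measurability _ (RGenOpens.measurableE R)).
move=> _ [_ [a [b ->] <-]]; rewrite setTI.
by apply: open_borel; apply: cf; exact: interval_open.
Qed.

Lemma measurable_mulmx (g : M) : measurable_fun [set: B] (fun y : B => (g *m y : B)).
Proof.
have cg : continuous (fun y : M => g *m y).
  apply: continuous_mx => i j.
  rewrite (_ : (fun y => _) = (fun y : M => \sum_k g i k * y k j)); last first.
    by apply/funext => y; rewrite mxE.
  apply: (@continuous_bigsum R M _ (index_enum _) xpredT (fun k y => g i k * y k j)) => k.
  by apply: continuous_mul; [exact: cst_continuous|exact: coord_continuous].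
apply: (@measurability _ _ B B _ _ open) => // _ [U oU <-]; rewrite setTI.
by apply: open_borel; move/continuousP: cg; apply.
Qed.

Lemma measurable_zrow i : measurable_fun [set: B] (fun y : B => zrow (y : M) i ib).
Proof. by apply: continuous_borel; exact: continuous_zrow. Qed.

Lemma measurable_prow : measurable_fun [set: B] (fun y : B => prow (y : M) ib).
Proof. by apply: continuous_borel; exact: continuous_prow. Qed.

Lemma measurable_qrow : measurable_fun [set: B] (fun y : B => qrow (y : M) ib).
Proof. by apply: continuous_borel; exact: continuous_qrow. Qed.

Lemma measurable_grpG : measurable (@grpG R d : set B).
Proof. by apply: closed_borel; exact: closed_grpG. Qed.

End BorelMatrices.

Section HaarMeasure.
Context {R : realType}.
Variables (d : nat) (mu : {measure set (borel_mat R d) -> \bar R}).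
Local Notation M := (mat R d).
Local Notation B := (borel_mat R d).
Local Notation G := (@grpG R d).

Lemma compact_box_grpG (b : R) : compact ([set g : M | forall i j, `|g i j| <= b] `&` G).
Proof. by apply: compact_closedI; [exact: compact_mx_box|exact: closed_grpG]. Qed.

(** Restriction to G turns integrals over G into integrals over the whole type, where Tonelli's
    theorem is used. The proof of [is_haar mu] is an argument so that sigma-finiteness can be
    attached to this measure. *)
Definition haarG of is_haar mu : set B -> \bar R := mrestr mu (@measurable_grpG R d).

Hypothesis hmu : is_haar mu.
Local Notation nu := (haarG hmu).

HB.instance Definition _ := Measure.on nu.

Lemma sigma_finite_haarG : sigma_finite setT nu.
Proof.
have [_ fin _] := hmu.
exists (fun n : nat => [set g : M | forall i j, `|g i j| <= n%:R]) => [|n].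
  apply/seteqP; split => // g _.
  pose s := \sum_i \sum_j `|g i j|.
  have [n sn] := natr_ge_exists s.
  exists n => // i j; apply: le_trans sn; rewrite /s.
  rewrite (bigD1 i)//= (bigD1 j)//= -addrA lerDl addr_ge0//.
    exact: sumr_ge0.
  by apply: sumr_ge0 => k _; exact: sumr_ge0.
split; last by apply: fin; [exact: compact_box_grpG|exact: subIsetr].
apply: closed_borel; apply: compact_closed; last exact: compact_mx_box.
exact: norm_hausdorff.
Qed.

HB.instance Definition _ :=
  Measure_isSigmaFinite.Build _ _ _ nu sigma_finite_haarG.

Lemma haarG_setC : nu (~` G) = 0%E.
Proof. by rewrite /haarG /mrestr setICl measure0. Qed.

Lemma integral_haarG (f : B -> \bar R) : measurable_fun setT f ->
  (\int[nu]_y f y = \int[mu]_(y in G) f y)%E.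
Proof.
move=> mf; have mG := @measurable_grpG R d.
rewrite -(@eq_measure_integral _ B R G mu nu); last first.
  by move=> A mA AG; rewrite -[LHS]/(mu (A `&` G)) setIidl.
rewrite [RHS]integral_mkcond; apply: (eq_integral_full mG haarG_setC) => //.
  by apply/(measurable_restrictT f mG); exact: (measurable_funTS mf).
by move=> y Gy; rewrite patchE mem_set.
Qed.

Lemma integrable_haarG (f : B -> \bar R) :
  nu.-integrable setT f -> mu.-integrable G f.
Proof.
move=> /integrableP[mf foo]; apply/integrableP; split; first exact: measurable_funTS.
by rewrite -integral_haarG//; exact: measurableT_comp.
Qed.

(** The preimage of a set under translation by [g] is its image under translation by the inverse
    [h], so invariance of sets under [h] gives invariance of integrals under [g]. *)
Lemma haarG_mulmx (g h : M) : h *m g = 1%:M -> G h ->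
  (forall y, G y -> G (g *m y)) -> (forall y, G y -> G (h *m y)) ->
  forall f : B -> \bar R, measurable_fun setT f -> (forall y, 0 <= f y)%E ->
  (\int[nu]_y f (g *m y) = \int[nu]_y f y)%E.
Proof.
move=> hg Gh Gg GK f mf f0; have [inv _ _] := hmu.
have gh : g *m h = 1%:M by apply: mulmx1C.
have mg := measurable_mulmx g.
have := @ge0_integral_pushforward _ _ _ _ R (fun y : B => g *m y : B) mg nu setT f
  measurableT mf (fun y _ => f0 y).
rewrite preimage_setT => <-; apply: eq_measure_integral => A mA _.
rewrite -[LHS]/(mu ((fun y : B => g *m y : B) @^-1` A `&` G)) -[RHS]/(mu (A `&` G)).
rewrite -[RHS](inv h) //; last first.
  by apply: measurableI => //; exact: measurable_grpG.
congr (mu _); apply/seteqP; split => [y [Ay Gy]|_ [y [Ay Gy] <-]].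
  by exists (g *m y); [split => //; exact: Gg|rewrite mulmxA hg mul1mx].
by split; [rewrite /preimage /= mulmxA gh mul1mx|exact: GK].
Qed.

End HaarMeasure.

(** * Horospherical coordinates on G *)

Section HorosphericalCoordinates.
Context {R : realType}.
Variable d : nat.
Local Notation M := (mat R d).
Local Notation B := (borel_mat R d).
Local Notation ib := (idx_d1 d).
Local Notation A t := (expmx (t *: Hmx d)).
Local Notation G := (@grpG R d).
Implicit Types (y : M) (i : 'I_d.-1).

(* For [y] in G these are the coordinates of [y = n(x) exp(tH) k]; the formula
   for [xcoord] is z / p with p^-2 written as exp(2t), so that it is visibly
   measurable. *)
Definition tcoord y : R := - ln `|prow y ib|.
Definition xcoord y i : R := zrow y i ib * prow y ib * expR (2 * tcoord y).

Lemma grpG_prow_neq0 y : G y -> prow y ib != 0.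
Proof. by move=> /grpG_SOd1; exact: prow_neq0. Qed.

Lemma norm_prow_grpG y : G y -> `|prow y ib| = expR (- tcoord y).
Proof. by move=> /grpG_prow_neq0 p0; rewrite /tcoord opprK lnK// posrE normr_gt0. Qed.

Lemma sqr_prow_grpG y : G y -> prow y ib ^+ 2 = expR (- (2 * tcoord y)).
Proof.
move=> Gy; rewrite -[LHS]ger0_norm ?sqr_ge0// normrX.
by rewrite norm_prow_grpG// expr2 -expRD; congr expR; ring.
Qed.

Lemma zrow_grpG y i : G y -> zrow y i ib = xcoord y i * prow y ib.
Proof.
move=> Gy; have := sqr_prow_grpG Gy; rewrite expr2 => p2.
by rewrite /xcoord mulrAC -(mulrA _ _ (prow y ib)) p2 -mulrA -expRD addNr expR0 mulr1.
Qed.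

Lemma tcoord_nmx (x : 'cV[R]_d.-1) y : tcoord (nmx x *m y) = tcoord y.
Proof. by rewrite /tcoord prow_nmx. Qed.

Lemma xcoord_nmx (x : 'cV[R]_d.-1) y i : G y ->
  xcoord (nmx x *m y) i = xcoord y i + x i 0.
Proof.
move=> Gy; rewrite /xcoord tcoord_nmx prow_nmx zrow_nmx.
rewrite (mulrDl _ _ (prow y ib)) (mulrDl _ _ (expR _)); congr (_ + _).
by rewrite -2!mulrA (mulrA (prow y ib)) -expr2 sqr_prow_grpG// -expRD addNr expR0 mulr1.
Qed.

Lemma tcoord_expmx (r : R) y : G y -> tcoord (A r *m y) = tcoord y + r.
Proof.
move=> /grpG_prow_neq0 p0.
rewrite /tcoord prow_expmx normrM gtr0_norm ?expR_gt0// lnM ?posrE ?expR_gt0 ?normr_gt0//.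
by rewrite expRK opprD opprK addrC.
Qed.

Lemma xcoord_expmx (r : R) y i : G y -> xcoord (A r *m y) i = xcoord y i * expR r.
Proof.
move=> Gy; rewrite /xcoord tcoord_expmx// prow_expmx zrow_expmx.
rewrite (_ : expR (2 * (tcoord y + r)) = expR (2 * tcoord y) * (expR r * expR r)); last first.
  by rewrite -!expRD; congr expR; ring.
have e1 : expR (- r) * expR r = 1 by rewrite -expRD addNr expR0.
transitivity (zrow y i ib * prow y ib * expR (2 * tcoord y) * expR r * (expR (- r) * expR r)).
  by ring.
by rewrite e1 mulr1.
Qed.

(** From pq = 1 + |z|^2 with z = xp and |p| = exp(-t). *)
Lemma norm_qrow_grpG y : G y ->
  `|qrow y ib| = expR (tcoord y) + (\sum_i xcoord y i ^+ 2) * expR (- tcoord y).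
Proof.
move=> Gy; have pq := prow_qrow_SO (grpG_SOd1 Gy); have p0 := grpG_prow_neq0 Gy.
have np := norm_prow_grpG Gy.
have s0 : 0 <= \sum_i zrow y i ib ^+ 2 by exact: sumsqr_ge0.
have : expR (- tcoord y) * `|qrow y ib| = 1 + \sum_i zrow y i ib ^+ 2.
  by rewrite -np -normrM pq ger0_norm// addr_ge0.
move=> /(congr1 (fun z => expR (tcoord y) * z)); rewrite mulrA -expRD subrr expR0 mul1r => ->.
rewrite mulrDr mulr1; congr (_ + _).
under eq_bigr => i _ do rewrite zrow_grpG// exprMn sqr_prow_grpG//.
by rewrite -mulr_suml mulrCA -expRD; congr (_ * expR _); ring.
Qed.

Lemma measurable_tcoord : measurable_fun [set: B] (tcoord : B -> R).
Proof.
have mp := @measurable_prow R d; apply: measurable_funN.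
apply: (measurableT_comp (@measurable_ln R)).
exact: (measurableT_comp (@normr_measurable R setT) mp).
Qed.

Lemma measurable_xcoord i : measurable_fun [set: B] (fun y : B => xcoord y i).
Proof.
have mp := @measurable_prow R d; have mz := @measurable_zrow R d i.
have mt := measurable_tcoord.
by rewrite /xcoord; mfun.
Qed.

End HorosphericalCoordinates.

(** * Integrating out the coordinates one at a time *)

Section Disintegration.
Context {R : realType}.
Variables (d : nat) (mu : {measure set (borel_mat R d) -> \bar R}).
Hypothesis hmu : is_haar mu.
Local Notation M := (mat R d).
Local Notation B := (borel_mat R d).
Local Notation A t := (expmx (t *: Hmx d)).
Local Notation G := (@grpG R d).
Local Notation L := (@lebesgue_measure R).
Local Notation nu := (haarG hmu).
Implicit Types (y : M) (i j : 'I_d.-1).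

Definition unitind : R -> R := \1_(`[0, 1[%classic : set R).

Lemma unitind_ge0 (x : R) : 0 <= unitind x.
Proof. by rewrite /unitind indicE ler0n. Qed.

Lemma measurable_unitind : measurable_fun setT unitind.
Proof. by apply: measurable_indic. Qed.

Lemma integral_unitind : (\int[L]_x (unitind x)%:E = 1)%E.
Proof.
rewrite integral_indic// setIT.
by have := @lebesgue_measure_itv R `[0, 1[; rewrite /= lte01 oppr0 adde0.
Qed.

(** A probability density in x supported on [0, exp t). The ratio x exp(-t) is invariant under left
    translation by A, so the indicator is untouched when t is integrated out afterwards. *)
Definition xweight (t x : R) : R := unitind (x * expR (- t)) * expR (- t).

Lemma xweight_ge0 t x : 0 <= xweight t x.
Proof. by rewrite /xweight mulr_ge0 ?unitind_ge0 ?expR_ge0. Qed.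

Lemma integral_xweight t : (\int[L]_x (xweight t x)%:E = 1)%E.
Proof.
have m1 : measurable_fun [set: R] (fun x => (unitind x)%:E).
  by apply/measurable_EFinP; exact: measurable_unitind.
have p1 (x : R) : (0 <= (unitind x)%:E)%E by rewrite lee_fin unitind_ge0.
have := @ge0_integral_affine R (expR (- t)) 0 (fun x => (unitind x)%:E)
  (lt0r_neq0 (expR_gt0 _)) m1 p1.
rewrite integral_unitind mule1 ger0_norm ?expR_ge0// => h.
transitivity ((expR (- t))%:E * \int[L]_x (unitind (expR (- t) * x + 0))%:E)%E.
  rewrite -ge0_integralZl_EFin ?expR_ge0//; last first.
    apply/measurable_EFinP.
    apply: (measurableT_comp measurable_unitind (g := fun x : R => expR (- t) * x + 0)).
    by mfun.
  by apply: eq_integral => x _; rewrite /xweight addr0 mulrC [x * _]mulrC EFinM.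
by rewrite h -EFinM divff// gt_eqF// expR_gt0.
Qed.

Section PeelX.
Variables (h : R -> R) (psi : 'I_d.-1 -> R -> R -> R) (I : 'I_d.-1 -> R -> R).
Hypothesis mh : measurable_fun setT h.
Hypothesis h_ge0 : forall t, 0 <= h t.
Hypothesis mI : forall i, measurable_fun setT (I i).
Hypothesis psi_ge0 : forall i t x, 0 <= psi i t x.
Hypothesis mpsi : forall i, measurable_fun setT (fun z : R * R => psi i z.1 z.2).

(** [flow_disintegration] for the flow of left translations by n(r e_j), which moves only the
    coordinate x_j and fixes t. *)
Lemma integral_peel_xcoord j :
  (forall t, \int[L]_x (psi j t x)%:E = (I j t)%:E)%E ->
  (\int[nu]_y (h (tcoord y) * \prod_i psi i (tcoord y) (xcoord y i))%:E =
   \int[nu]_y (h (tcoord y) * \prod_i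
     (if i == j then xweight (tcoord y) (xcoord y i) * I i (tcoord y)
      else psi i (tcoord y) (xcoord y i)))%:E)%E.
Proof.
move=> Ij; pose ej : 'cV[R]_d.-1 := \col_i (i == j)%:R.
pose T (r : R) (y : B) : B := nmx (r *: ej) *m y.
pose F (y : B) (r : R) := h (tcoord y) *
  \prod_i psi i (tcoord y) (if i == j then r else xcoord y i).
pose W (y : B) (r : R) := xweight (tcoord y) r.
have mt := @measurable_tcoord R d; have mx := @measurable_xcoord R d.
have mF : measurable_fun setT (fun z : B * R => F z.1 z.2).
  apply: measurable_funM; first by mfun.
  apply: measurable_prod => i _.
  apply: (measurableT_comp (mpsi i)
    (g := fun z : B * R => (tcoord z.1, if i == j then z.2 else xcoord z.1 i))).
  by case: (i == j); mfun; exact: (measurableT_comp (mx i)).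
have mW : measurable_fun setT (fun z : B * R => W z.1 z.2).
  by rewrite /W /xweight; have mu1 := measurable_unitind; mfun.
have F0 y r : 0 <= F y r by rewrite mulr_ge0// prodr_ge0.
have inv r (f : B -> \bar R) : measurable_fun setT f -> (forall y, 0 <= f y)%E ->
    (\int[nu]_y f (T r y) = \int[nu]_y f y)%E.
  apply: (haarG_mulmx hmu (h := nmx (- (r *: ej)))); first exact: nmxNK.
  - by rewrite -[nmx _]mulmx1; apply: grpG_nmx; exact: grpG1.
  - by move=> y; exact: grpG_nmx.
  - by move=> y; exact: grpG_nmx.
have cT r y : G y -> xcoord (T r y) j = xcoord y j + r.
  by move=> Gy; rewrite xcoord_nmx// !mxE eqxx mulr1.
have FT r y t : G y -> F (T r y) t = F y t.
  move=> Gy; rewrite /F tcoord_nmx; congr (_ * _); apply: eq_bigr => i _; congr psi.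
  by case: ifPn => // ij; rewrite xcoord_nmx// !mxE (negbTE ij) mulr0 addr0.
have WT r y t : G y -> W (T r y) t = W y t by move=> Gy; rewrite /W tcoord_nmx.
have W1 y : G y -> (\int[L]_t (W y t)%:E = 1)%E by move=> _; exact: integral_xweight.
have := flow_disintegration (@measurable_grpG R d) (haarG_setC hmu) (T := T)
  (fun r => measurable_mulmx _) inv (mx j) mF mW F0 (fun y r => xweight_ge0 _ _) cT FT WT W1.
have -> : (fun y : B => (F y (xcoord y j))%:E) =
    (fun y : B => (h (tcoord y) * \prod_i psi i (tcoord y) (xcoord y i))%:E).
  by apply/funext => y; congr (_ * _)%:E; apply: eq_bigr => i _; case: eqP => // ->.
move=> ->; apply: eq_integral => y _.
pose c := h (tcoord y) * \prod_(i | i != j) psi i (tcoord y) (xcoord y i).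
have c0 : 0 <= c by rewrite mulr_ge0// prodr_ge0.
transitivity ((W y (xcoord y j))%:E * (c%:E * \int[L]_t (psi j (tcoord y) t)%:E))%E.
  congr (_ * _)%E; rewrite -ge0_integralZl_EFin//; last 2 first.
  - by move=> t _; rewrite lee_fin.
  - apply/measurable_EFinP; apply: (measurableT_comp (mpsi j) (g := fun t : R => (tcoord y, t))).
    by mfun.
  apply: eq_integral => t _; rewrite -EFinM /F /c (bigD1 j)//= eqxx; congr EFin.
  rewrite -mulrA [X in _ = _ * X]mulrC; congr (_ * (_ * _)).
  by apply: eq_bigr => i /negbTE ->.
rewrite Ij -!EFinM (bigD1 j)//= eqxx /c /W; congr EFin.
rewrite [X in _ = _ * (_ * X)](eq_bigr (fun i => psi i (tcoord y) (xcoord y i))); last first.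
  by move=> i /negbTE ->.
by ring.
Qed.

End PeelX.

Lemma measurable_xweight : measurable_fun setT (fun z : R * R => xweight z.1 z.2).
Proof. by rewrite /xweight; have mu1 := measurable_unitind; mfun. Qed.

Lemma integral_peel_xcoords (h : R -> R) (psi : 'I_d.-1 -> R -> R -> R)
    (I : 'I_d.-1 -> R -> R) :
  measurable_fun setT h -> (forall t, 0 <= h t) ->
  (forall i, measurable_fun setT (I i)) -> (forall i t, 0 <= I i t) ->
  (forall i t x, 0 <= psi i t x) ->
  (forall i, measurable_fun setT (fun z : R * R => psi i z.1 z.2)) ->
  (forall i t, \int[L]_x (psi i t x)%:E = (I i t)%:E)%E ->
  (\int[nu]_y (h (tcoord y) * \prod_i psi i (tcoord y) (xcoord y i))%:E =
   \int[nu]_y (h (tcoord y) * \prod_i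
     (xweight (tcoord y) (xcoord y i) * I i (tcoord y)))%:E)%E.
Proof.
move=> mh h0 mI I0 psi0 mpsi psiI.
(* The state after the first [k] coordinates have been integrated out. *)
pose psik (k : nat) i (t x : R) := if (i < k)%N then xweight t x * I i t else psi i t x.
have step (k : nat) : (k <= d.-1)%N ->
    (\int[nu]_y (h (tcoord y) * \prod_i psi i (tcoord y) (xcoord y i))%:E =
     \int[nu]_y (h (tcoord y) * \prod_i psik k i (tcoord y) (xcoord y i))%:E)%E.
  elim: k => [_|k IHk kd]; first by [].
  rewrite (IHk (ltnW kd)); pose j := Ordinal kd.
  etransitivity.
    apply: (@integral_peel_xcoord h (psik k) I mh h0 _ _ j).
    - by move=> i t x; rewrite /psik; case: ifP => // _; rewrite mulr_ge0// xweight_ge0.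
    - move=> i; rewrite /psik; case: (i < k)%N; last exact: mpsi.
      apply: measurable_funM; first exact: measurable_xweight.
      by have mIi := mI i; mfun.
    - by move=> t; rewrite /psik ltnn.
  apply: eq_integral => y _; congr (_ * _)%:E; apply: eq_bigr => i _; rewrite /psik.
  have -> : (i < k.+1)%N = (i == j) || (i < k)%N by rewrite ltnS leq_eqVlt.
  by case: (i == j).
rewrite (step d.-1 (leqnn _)); apply: eq_integral => y _; congr (_ * _)%:E.
by apply: eq_bigr => i _; rewrite /psik ltn_ord.
Qed.

Definition unitbox (y : M) : R :=
  unitind (tcoord y) * \prod_i unitind (xcoord y i * expR (- tcoord y)).

Lemma unitbox_ge0 y : 0 <= unitbox y.
Proof. by rewrite mulr_ge0 ?unitind_ge0// prodr_ge0// => i _; exact: unitind_ge0. Qed.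

Lemma measurable_unitbox : measurable_fun [set: B] (unitbox : B -> R).
Proof.
have mt := @measurable_tcoord R d; have mu1 := measurable_unitind.
apply: measurable_funM; first exact: (measurableT_comp mu1 mt).
apply: measurable_prod => i _; have mx := @measurable_xcoord R d i.
by mfun.
Qed.

(** The flow along exp(rH) shifts t and preserves the indicator factors; afterwards the Haar measure
    enters only through the mass of [unitbox]. *)
Lemma integral_peel_tcoord (H : R -> R) :
  measurable_fun setT H -> (forall t, 0 <= H t) ->
  (\int[nu]_y (H (tcoord y) * \prod_i unitind (xcoord y i * expR (- tcoord y)))%:E =
   \int[nu]_y (unitbox y)%:E * \int[L]_t (H t)%:E)%E.
Proof.
move=> mH H0; pose T (r : R) (y : B) : B := A r *m y.
pose P (y : B) : R := \prod_i unitind (xcoord y i * expR (- tcoord y)).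
pose F (y : B) (r : R) := H r * P y.
pose W (y : B) (r : R) := unitind r.
have mt := @measurable_tcoord R d; have mu1 := measurable_unitind.
have mP : measurable_fun setT P.
  by apply: measurable_prod => i _; have mx := @measurable_xcoord R d i; mfun.
have P0 y : 0 <= P y by rewrite prodr_ge0// => i _; exact: unitind_ge0.
have mF : measurable_fun setT (fun z : B * R => F z.1 z.2) by rewrite /F; mfun.
have mW : measurable_fun setT (fun z : B * R => W z.1 z.2) by rewrite /W; mfun.
have F0 y r : 0 <= F y r by rewrite mulr_ge0.
have inv r (f : B -> \bar R) : measurable_fun setT f -> (forall y, 0 <= f y)%E ->
    (\int[nu]_y f (T r y) = \int[nu]_y f y)%E.
  apply: (haarG_mulmx hmu (h := A (- r))); first exact: expmxNK.
  - by rewrite -[expmx _]mulmx1; apply: grpG_expmx; exact: grpG1.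
  - by move=> y; exact: grpG_expmx.
  - by move=> y; exact: grpG_expmx.
have cT r y : G y -> tcoord (T r y) = tcoord y + r by exact: tcoord_expmx.
have FT r y t : G y -> F (T r y) t = F y t.
  move=> Gy; congr (_ * _); apply: eq_bigr => i _; congr unitind.
  by rewrite /T tcoord_expmx// xcoord_expmx// -mulrA -expRD; congr (_ * expR _); ring.
have WT r y t : G y -> W (T r y) t = W y t by [].
have W1 y : G y -> (\int[L]_t (W y t)%:E = 1)%E by move=> _; exact: integral_unitind.
have := flow_disintegration (@measurable_grpG R d) (haarG_setC hmu) (T := T)
  (fun r => measurable_mulmx _) inv mt mF mW F0 (fun y r => unitind_ge0 _) cT FT WT W1.
rewrite /F /= => ->.
have Hy0 : (0 <= \int[L]_t (H t)%:E)%E by apply: integral_ge0 => t _; rewrite lee_fin.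
have mU : measurable_fun [set: B] (fun y : B => (unitbox y)%:E).
  by apply/measurable_EFinP; exact: measurable_unitbox.
have mHE : measurable_fun [set: R] (fun t : R => (H t)%:E) by apply/measurable_EFinP.
have U0 y : (0 <= (unitbox y)%:E)%E by rewrite lee_fin unitbox_ge0.
rewrite -(@ge0_integralZr _ B R nu setT measurableT _ mU _ (fun y _ => U0 y) Hy0).
apply: eq_integral => y _; rewrite /unitbox -[\prod_i _]/(P y) EFinM -muleA.
congr (_ * _)%E.
have H0' (t : R) : setT t -> (0 <= (H t)%:E)%E by rewrite lee_fin.
etransitivity; last exact: (@ge0_integralZl_EFin _ _ R L setT measurableT _ H0' mHE _ (P0 y)).
by apply: eq_integral => t _; rewrite -EFinM mulrC.
Qed.

End Disintegration.

(** * The mass of the unit box is finite and positive *)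

Section HaarConstant.
Context {R : realType}.
Variables (d : nat) (mu : {measure set (borel_mat R d) -> \bar R}).
Hypothesis hmu : is_haar mu.
Local Notation M := (mat R d).
Local Notation B := (borel_mat R d).
Local Notation A t := (expmx (t *: Hmx d)).
Local Notation G := (@grpG R d).
Local Notation J := (@Jmx R d).
Local Notation ia := (idx_d d).
Local Notation ib := (idx_d1 d).
Local Notation nu := (haarG hmu).
Implicit Types (y : M) (i j : 'I_d.-1).

Lemma SOd1_tr y : @SOd1 R d y -> y *m J *m y^T = J.
Proof.
move=> [_ yJ]; have h : J *m y^T *m J *m y = 1%:M.
  by rewrite -!mulmxA (mulmxA y^T) yJ Jmx_sqr.
have := mulmx1C h; rewrite !mulmxA => /(congr1 (fun z => z *m J)).
by rewrite mul1mx -[LHS]mulmxA Jmx_sqr mulmx1.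
Qed.

(* In each row, the sum of the squares of the first d entries differs from the
   square of the last entry by 1, so the last column controls everything. *)
Lemma SOd1_entries_le y (b : R) : @SOd1 R d y -> 0 <= b ->
  (forall k, `|y k ib| <= b) -> forall k l, `|y k l| <= b + 1.
Proof.
move=> SOy b0 yb k; have := congr1 (fun z : M => z k k) (SOd1_tr SOy).
have J1 : J k k <= 1.
  by elim/idx_lorentzP: k; move=> *; rewrite JmxE ?eqxx ?lerr//; lra.
have := lorentz_formE y^T k k; rewrite trmxK => ->.
have yk2 : y k ib ^+ 2 <= b ^+ 2.
  by rewrite -[leLHS]ger0_norm ?sqr_ge0// normrX ler_pXn2r ?nnegrE.
set S := \sum_i _ => hS.
have S0 : 0 <= S by apply: sumr_ge0 => i _; rewrite -expr2 sqr_ge0.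
have Sa : S + y k ia ^+ 2 = J k k + y k ib ^+ 2.
  by rewrite -hS /prow /qrow !mxE; field.
have fin2 l : y k l ^+ 2 <= 1 + b ^+ 2 -> `|y k l| <= b + 1.
  move=> h; rewrite -(@ler_pXn2r _ 2)// ?nnegrE ?addr_ge0// -normrX ger0_norm ?sqr_ge0//.
  by rewrite sqrrD1; nra.
have a2 := sqr_ge0 (y k ia); have b2 := sqr_ge0 (y k ib).
elim/idx_lorentzP => [i||]; apply: fin2; [|lra|lra].
have : y k (idx_z i) ^+ 2 <= S.
  rewrite /S (bigD1 i)//= /zrow mxE -expr2 lerDl.
  by apply: sumr_ge0 => l _; rewrite -expr2 sqr_ge0.
by move=> ?; lra.
Qed.

Lemma unitind_le1 (x : R) : unitind x <= 1.
Proof. by rewrite /unitind indicE lern1; case: (_ \in _). Qed.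

Lemma unitind_neq0 (x : R) : unitind x != 0 -> 0 <= x < 1.
Proof.
rewrite /unitind indicE; case: (boolP (x \in _)) => [|_]; last by rewrite eqxx.
by rewrite inE /= in_itv.
Qed.

Lemma unitind1 (x : R) : 0 <= x < 1 -> unitind x = 1.
Proof. by move=> x01; rewrite /unitind indicE mem_set//= in_itv. Qed.

Lemma unitbox_bounded : exists b : R, forall y, G y -> unitbox y != 0 ->
  forall k l, `|y k l| <= b.
Proof.
(* On the box |z_i| < 1, |p| <= 1, and |q| = e^t (1 + sum (x_i e^(-t))^2) is at most e (1 + (d -
   1)); together these bound the last column by [b]. *)
pose b : R := 1 + expR 1 * (1 + (d.-1)%:R).
have b0 : 0 <= b by rewrite addr_ge0// mulr_ge0 ?expR_ge0// addr_ge0.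
exists (b + 1) => y Gy U0; apply: SOd1_entries_le => //; first exact: grpG_SOd1.
move: U0; rewrite mulf_eq0 negb_or => /andP[/unitind_neq0/andP[t0 t1] /prodf_neq0 x01].
have p1 : `|prow y ib| <= 1 by rewrite norm_prow_grpG// expR_le1 oppr_le0.
have q1 : `|qrow y ib| <= expR 1 * (1 + (d.-1)%:R).
  rewrite norm_qrow_grpG//.
  have -> : expR (tcoord y) + (\sum_i xcoord y i ^+ 2) * expR (- tcoord y) =
      expR (tcoord y) * (1 + \sum_i (xcoord y i * expR (- tcoord y)) ^+ 2).
    rewrite mulrDr mulr1; congr (_ + _).
    under [in RHS]eq_bigr do rewrite exprMn.
    rewrite -mulr_suml mulrCA; congr (_ * _).
    by rewrite expr2 mulrA -expRD subrr expR0 mul1r.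
  apply: ler_pM; rewrite ?expR_ge0//.
  - by rewrite addr_ge0// sumr_ge0// => i _; exact: sqr_ge0.
  - by rewrite ler_expR ltW.
  rewrite lerD2l; apply: le_trans (_ : \sum_(i < d.-1) 1 <= _).
    apply: ler_sum => i _; have /andP[h0 h1] := unitind_neq0 (x01 i isT).
    by rewrite exprn_ile1// ltW.
  by rewrite sumr_const card_ord.
have half_le (n1 n2 n3 e : R) : 0 <= n1 -> n1 <= e -> n2 <= 1 -> n3 <= n1 + n2 ->
    n3 / 2 <= 1 + e by clear=> *; lra.
apply: idx_lorentzP => [i||].
- rewrite -[y _ _]/(zrow y i ib) zrow_grpG// normrM norm_prow_grpG//.
  rewrite -[X in _ * X]ger0_norm ?expR_ge0// -normrM.
  have /andP[h0 h1] := unitind_neq0 (x01 i isT).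
  rewrite ger0_norm//; apply: le_trans (ltW h1) _.
  by rewrite lerDl mulr_ge0 ?expR_ge0// addr_ge0.
- have -> : y ia ib = (qrow y ib - prow y ib) / 2 by rewrite /qrow /prow; field.
  have := ler_normB (qrow y ib) (prow y ib); rewrite normrM (ger0_norm (x := 2^-1)) ?invr_ge0//.
  exact: (half_le _ _ _ _ (normr_ge0 _) q1 p1).
- have -> : y ib ib = (qrow y ib + prow y ib) / 2 by rewrite /qrow /prow; field.
  have := ler_normD (qrow y ib) (prow y ib); rewrite normrM (ger0_norm (x := 2^-1)) ?invr_ge0//.
  exact: (half_le _ _ _ _ (normr_ge0 _) q1 p1).
Qed.

Lemma unitbox_le1 y : unitbox y <= 1.
Proof.
rewrite /unitbox mulr_ile1 ?unitind_ge0 ?unitind_le1 ?prodr_ge0//.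
by apply: prodr_ile1 => i _; rewrite unitind_ge0 unitind_le1.
Qed.

Let mU : measurable_fun [set: B] (fun y : B => (unitbox y)%:E).
Proof. by apply/measurable_EFinP; exact: measurable_unitbox. Qed.

Lemma integral_unitbox_lty : (\int[nu]_y (unitbox y)%:E < +oo)%E.
Proof.
have [_ fin _] := hmu; have [b yb] := unitbox_bounded.
have mG := @measurable_grpG R d.
pose C : set B := [set g : M | forall k l, `|g k l| <= b].
have mC : measurable C.
  by apply: closed_borel; apply: compact_closed; [exact: norm_hausdorff|exact: compact_mx_box].
apply: (@le_lt_trans _ _ (mu (C `&` G))); last first.
  by apply: fin; [exact: compact_box_grpG|exact: subIsetr].
rewrite integral_haarG// -integral_indic//; apply: ge0_le_integral => //.
- by move=> y _; rewrite lee_fin unitbox_ge0.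
- exact: measurable_funTS.
- by apply/measurable_EFinP; exact: measurable_indic.
move=> y Gy; rewrite lee_fin indicE; have [yC|yC] := boolP (y \in C).
  exact: unitbox_le1.
have [->//|/(yb y Gy) h] := eqVneq (unitbox y) 0.
by move/negP: yC; case; exact/mem_set.
Qed.

Lemma integral_unitbox_gt0 : (0 < \int[nu]_y (unitbox y)%:E)%E.
Proof.
have [_ _ pos] := hmu; have mG := @measurable_grpG R d.
(* For p > 0 one has x_i exp(-t) = z_i, so [unitbox] equals 1 on the part of this open set in G. *)
pose U : set M := [set y | expR (- 1) < prow y ib < 1 /\ forall i, 0 < zrow y i ib < 1].
have oU : open U.
  have near_itv (f : M -> R) (a b : R) y : continuous f -> a < f y < b ->
      \forall x \near y, a < f x < b.
    move=> /continuousP/(_ `]a, b[%classic) cf yab; apply: open_nbhs_nbhs; split => //.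
    by have := cf (itv_open _ _); congr open; apply/funext => x; rewrite /= in_itv.
  rewrite openE => y [p01 z01]; near=> x; split; near: x.
    by apply: (near_itv (fun y : M => prow y ib)) => //; exact: continuous_prow.
  apply: filter_forall => i.
  by apply: (near_itv (fun y : M => zrow y i ib)) => //; exact: continuous_zrow.
have UG : U `&` G !=set0.
  exists (A (2^-1) *m (nmx (const_mx 2^-1) *m 1%:M)); split; last first.
    exact/grpG_expmx/grpG_nmx/grpG1.
  split=> [|i].
    by rewrite prow_expmx prow_nmx prow1 mulr1 ltr_expR expR_lt1; lra.
  by rewrite zrow_expmx zrow_nmx zrow1 prow1 mxE; lra.
apply: (@lt_le_trans _ _ (mu (U `&` G))); first exact: pos.
have mUo : measurable (U : set B) by exact: open_borel.
rewrite integral_haarG// -integral_indic//; apply: ge0_le_integral => //.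
- by apply/measurable_EFinP; exact: measurable_indic.
- exact: measurable_funTS.
move=> y Gy; rewrite lee_fin indicE; have [|yU] := boolP (y \in (U : set B)); last first.
  exact: unitbox_ge0.
rewrite inE => -[/andP[p0 p1] z01]; have pp : 0 < prow y ib by apply: lt_trans p0; exact: expR_gt0.
have pE : expR (- tcoord y) = prow y ib by rewrite -norm_prow_grpG// gtr0_norm.
rewrite /unitbox unitind1 ?mul1r; last first.
  by move: p0 p1; rewrite -pE ltr_expR expR_lt1 => h1 h2; apply/andP; split; lra.
rewrite big1// => i _; rewrite pE -zrow_grpG// unitind1//.
by have /andP[h1 h2] := z01 i; rewrite (ltW h1) h2.
Unshelve. all: by end_near.
Qed.

Lemma haar_constP : exists2 kappa : R, 0 < kappa & (\int[nu]_y (unitbox y)%:E = kappa%:E)%E.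
Proof.
exists (fine (\int[nu]_y (unitbox y)%:E)%E).
  by rewrite fine_gt0// integral_unitbox_gt0 integral_unitbox_lty.
by rewrite fineK// ge0_fin_numE ?integral_unitbox_lty// ltW// integral_unitbox_gt0.
Qed.

End HaarConstant.

(** * The Laplace transform of the Haar measure *)

Section HaarLaplace.
Context {R : realType}.
Variables (d : nat) (mu : {measure set (borel_mat R d) -> \bar R}).
Hypothesis hmu : is_haar mu.
Hypothesis d_ge2 : (2 <= d)%N.
Local Notation M := (mat R d).
Local Notation B := (borel_mat R d).
Local Notation G := (@grpG R d).
Local Notation ib := (idx_d1 d).
Local Notation L := (@lebesgue_measure R).
Local Notation nu := (haarG hmu).
Implicit Types (y : M) (i j : 'I_d.-1).

Definition log_aw0n0 y : R := - ln `|qrow (n0 d *m y) ib|.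
Definition log_aw0 y : R := - ln `|qrow y ib|.

Let c i : R := (i == 0%N :> nat)%:R.

Lemma sum_n0_coord : \sum_i c i = 1.
Proof.
have d1 : (0 < d.-1)%N by case: d d_ge2 => [|[]].
rewrite (bigD1 (Ordinal d1))//= big1 ?addr0// /c => i; rewrite -(inj_eq val_inj) /=.
by move=> /negbTE ->.
Qed.

Lemma measurable_log_aw0n0 : measurable_fun [set: B] (log_aw0n0 : B -> R).
Proof.
apply: measurable_funN; apply: (measurableT_comp (@measurable_ln R)).
apply: (measurableT_comp (@normr_measurable R setT)).
exact: (measurableT_comp (@measurable_qrow R d) (measurable_mulmx _)).
Qed.

Lemma measurable_log_aw0 : measurable_fun [set: B] (log_aw0 : B -> R).
Proof.
apply: measurable_funN; apply: (measurableT_comp (@measurable_ln R)).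
exact: (measurableT_comp (@normr_measurable R setT) (@measurable_qrow R d)).
Qed.

Lemma norm_qrow_gt0 y : G y -> 0 < `|qrow y ib|.
Proof.
move=> Gy; rewrite norm_qrow_grpG// ltr_pwDl ?expR_gt0// mulr_ge0 ?expR_ge0//.
by apply: sumr_ge0 => i _; exact: sqr_ge0.
Qed.

Lemma expR_log_aw0 (b : R) y : G y -> expR (b - log_aw0 y) =
  expR b * (expR (tcoord y) + (\sum_i xcoord y i ^+ 2) * expR (- tcoord y)).
Proof.
by move=> Gy; rewrite /log_aw0 opprK expRD lnK ?posrE ?norm_qrow_gt0// norm_qrow_grpG.
Qed.

Lemma expR_log_aw0n0 (a : R) y : G y -> expR (a - log_aw0n0 y) =
  expR a * (expR (tcoord y) + (\sum_i (xcoord y i + c i) ^+ 2) * expR (- tcoord y)).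
Proof.
move=> Gy; have Gny : G (n0 d *m y) by exact: grpG_nmx.
rewrite /log_aw0n0 opprK expRD lnK ?posrE ?norm_qrow_gt0// norm_qrow_grpG// tcoord_nmx.
by under eq_bigr => i _ do rewrite xcoord_nmx// mxE.
Qed.

Section LaplaceParams.
Variables (a b w : R).
Let k : R := expR a + expR b.
Let k_gt0 : 0 < k. Proof. by rewrite addr_gt0 ?expR_gt0. Qed.

Definition laplace_outer (t : R) : R := expR (- (k * expR t) - expR (w - t)).
Definition laplace_factor i (t x : R) : R :=
  expR (- ((expR a * (x + c i) ^+ 2 + expR b * x ^+ 2) * expR (- t))).
Definition laplace_gauss i (t : R) : R :=
  Num.sqrt pi * expR ((t - ln k) / 2) * expR (- (expR a * expR b / k * c i * expR (- t))).

(** Completing the square: with u = exp a, v = exp b, k = u + v, u (x + c)^2 + v x^2 = k (x +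
    uc/k)^2 + uvc/k, because c is 0 or 1 and so c^2 = c. *)
Lemma integral_laplace_factor i t :
  (\int[L]_x (laplace_factor i t x)%:E = (laplace_gauss i t)%:E)%E.
Proof.
pose K := k * expR (- t); have K0 : 0 < K by rewrite mulr_gt0 ?expR_gt0.
pose e := expR (- (expR a * expR b / k * c i * expR (- t))).
have e0 : 0 <= e by exact: expR_ge0.
have cc : c i ^+ 2 = c i by rewrite /c; case: (_ == _); rewrite ?expr1n ?expr0n.
have mg : measurable_fun [set: R]
    (fun x : R => (expR (- (K * (x + expR a * c i / k) ^+ 2)))%:E).
  apply/measurable_EFinP; apply: (measurableT_comp (@measurable_expR R)).
  apply: measurable_funN; apply: measurable_funM; first exact: measurable_cst.
  by apply: measurable_funX; mfun.
transitivity (e%:E * \int[L]_x (expR (- (K * (x + expR a * c i / k) ^+ 2)))%:E)%E.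
  etransitivity; last exact: (@ge0_integralZl_EFin _ _ R L setT measurableT _ _ mg _ e0).
  apply: eq_integral => x _; rewrite -EFinM /e /laplace_factor; congr EFin.
  etransitivity; last exact: expRD.
  congr expR.
  rewrite -opprD /K; congr (- _); move: cc k_gt0.
  rewrite /k; move: (expR a) (expR b) (expR (- t)) (c i) => u v s ci cc uv.
  rewrite -{2}cc; field; exact: lt0r_neq0.
rewrite integral_gauss_affine// -EFinM /laplace_gauss mulrC -/e; congr (_ * _)%:E.
have -> : pi / K = pi * expR ((t - ln k) / 2) ^+ 2.
  congr (_ * _); rewrite /K invfM -expRN opprK expr2 -expRD.
  rewrite (_ : (t - ln k) / 2 + (t - ln k) / 2 = t - ln k); last by field.
  by rewrite expRD expRN lnK ?posrE// mulrC.
by rewrite sqrtrM ?pi_ge0// sqrtr_sqr ger0_norm ?expR_ge0.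
Qed.

Lemma laplace_outerE y : G y ->
  expR (- expR (a - log_aw0n0 y) - expR (b - log_aw0 y) - expR (w - tcoord y)) =
  laplace_outer (tcoord y) * \prod_i laplace_factor i (tcoord y) (xcoord y i).
Proof.
move=> Gy; rewrite expR_log_aw0n0// expR_log_aw0// /laplace_factor -expR_sum /laplace_outer -expRD.
congr expR; rewrite sumrN -mulr_suml big_split /= -!mulr_sumr /k.
by ring.
Qed.

(** With p = t + ln k and w replaced by its exponential W, k e^t = e^p, (uv/k) e^(-t) = uv e^(-p)
    and W e^(-t) = (uW + vW) e^(-p), which produces the symmetric form. The d - 1 factors exp(-t +
    (t - ln k)/2) combine to exp(-rp) with r = (d - 1)/2. *)
Lemma laplace_innerE t :
  laplace_outer t * \prod_i (expR (- t) * laplace_gauss i t) =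
  Num.sqrt pi ^+ d.-1 * bessel_kernel ((d.-1)%:R / 2) a b w (t + ln k).
Proof.
have -> : \prod_i (expR (- t) * laplace_gauss i t) =
    Num.sqrt pi ^+ d.-1 * expR (\sum_(i < d.-1) (- (t + ln k) / 2
      - expR a * expR b / k * c i * expR (- t))).
  rewrite expR_sum -[X in _ ^+ X]card_ord -prodr_const -big_split /=.
  apply: eq_bigr => i _; rewrite /laplace_gauss.
  move: (expR a * expR b / k * c i * expR (- t)) (ln k) => z l.
  rewrite -!mulrA mulrCA; congr (_ * _); rewrite -!expRD; congr expR.
  by field.
rewrite mulrCA; congr (_ * _).
rewrite /laplace_outer /bessel_kernel; etransitivity; first by apply: esym; exact: expRD.
congr expR.
rewrite big_split /= sumr_const card_ord sumrN -mulr_suml -mulr_sumr sum_n0_coord mulr1.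
rewrite (_ : expR (t + ln k) = k * expR t); last first.
  by rewrite expRD lnK ?posrE// mulrC.
rewrite opprD (expRD (- t)) [expR (- ln k)]expRN lnK ?posrE// !expRD -[_ *+ d.-1]mulr_natr /k.
have := lt0r_neq0 k_gt0; rewrite /k.
by move: (expR a) (expR b) (expR w) (expR (- t)) (expR t) (ln _) (d.-1%:R) => *; field.
Qed.

End LaplaceParams.

Lemma haar_laplace : exists2 K : R, 0 < K & forall a b w : R,
  (\int[nu]_y (expR (- expR (a - log_aw0n0 y) - expR (b - log_aw0 y) - expR (w - tcoord y)))%:E =
   K%:E * \int[L]_p (bessel_kernel ((d.-1)%:R / 2) a b w p)%:E)%E.
Proof.
have [kappa kappa0 kappaE] := haar_constP hmu.
exists (kappa * Num.sqrt pi ^+ d.-1).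
  by rewrite mulr_gt0// exprn_gt0// sqrtr_gt0 pi_gt0.
move=> a b w; have mt := @measurable_tcoord R d; have mx := @measurable_xcoord R d.
have mLA := measurable_log_aw0n0; have mLB := measurable_log_aw0.
have mh : measurable_fun setT (laplace_outer a b w) by rewrite /laplace_outer; mfun.
have h0 t : 0 <= laplace_outer a b w t by exact: expR_ge0.
have mpsi i : measurable_fun setT (fun z : R * R => laplace_factor a b i z.1 z.2).
  rewrite /laplace_factor; apply: (measurableT_comp (@measurable_expR R)).
  apply: measurable_funN; apply: measurable_funM; last by mfun.
  by apply: measurable_funD; (apply: measurable_funM; first exact: measurable_cst);
    apply: measurable_funX; mfun.
have psi0 i t x : 0 <= laplace_factor a b i t x by exact: expR_ge0.
have mI i : measurable_fun setT (laplace_gauss a b i) by rewrite /laplace_gauss; mfun.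
have I0 i t : 0 <= laplace_gauss a b i t.
  by rewrite mulr_ge0 ?expR_ge0// mulr_ge0 ?expR_ge0// sqrtr_ge0.
transitivity (\int[nu]_y (laplace_outer a b w (tcoord y) *
    \prod_i laplace_factor a b i (tcoord y) (xcoord y i))%:E)%E.
  apply: (eq_integral_full (@measurable_grpG R d) (haarG_setC hmu)).
  - by apply/measurable_EFinP; mfun.
  - apply/measurable_EFinP; apply: measurable_funM; first exact: (measurableT_comp mh mt).
    apply: measurable_prod => i _; have mxi := mx i.
    apply: (measurableT_comp (mpsi i) (g := fun y : B => (tcoord y, xcoord y i))).
    by mfun.
  - by move=> y Gy; rewrite laplace_outerE.
rewrite (integral_peel_xcoords hmu mh h0 mI I0 psi0 mpsi); last first.
  by move=> i t; exact: integral_laplace_factor.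
pose H t := Num.sqrt pi ^+ d.-1 *
  bessel_kernel ((d.-1)%:R / 2) a b w (t + ln (expR a + expR b)).
have mbk : measurable_fun [set: R] (bessel_kernel ((d.-1)%:R / 2) a b w).
  by rewrite /bessel_kernel; mfun.
have mH : measurable_fun [set: R] H by rewrite /H; mfun.
have bk0 t : 0 <= bessel_kernel ((d.-1)%:R / 2) a b w t by exact: expR_ge0.
have c0 : 0 <= Num.sqrt pi ^+ d.-1 :> R by rewrite exprn_ge0// sqrtr_ge0.
have H0 t : 0 <= H t by rewrite mulr_ge0.
transitivity (\int[nu]_y (H (tcoord y) *
    \prod_i unitind (xcoord y i * expR (- tcoord y)))%:E)%E.
  apply: eq_integral => y _; rewrite /H -laplace_innerE; congr EFin.
  rewrite -mulrA; congr (_ * _); rewrite -big_split /=.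
  by apply: eq_bigr => i _; rewrite /xweight -mulrA mulrC.
rewrite (integral_peel_tcoord hmu mH H0) kappaE EFinM -muleA; congr (_ * _)%E.
have mbs : measurable_fun [set: R] (fun t : R =>
    (bessel_kernel ((d.-1)%:R / 2) a b w (t + ln (expR a + expR b)))%:E).
  by apply/measurable_EFinP; mfun.
have mbkE : measurable_fun [set: R]
    (fun t : R => (bessel_kernel ((d.-1)%:R / 2) a b w t)%:E).
  exact/measurable_EFinP.
have bkE t : (0 <= (bessel_kernel ((d.-1)%:R / 2) a b w t)%:E)%E by rewrite lee_fin.
rewrite -(@ge0_integral_shift R (ln (expR a + expR b)) _ mbkE bkE).
exact: (@ge0_integralZl_EFin _ _ R L setT measurableT _ (fun t _ => bkE _) mbs _ c0).
Qed.

End HaarLaplace.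

(** * The trilinear form *)

Section TrilinearIntegrand.
Context {R : realType}.
Variable d : nat.
Hypothesis d_ge2 : (2 <= d)%N.
Local Notation M := (mat R d).
Local Notation G := (@grpG R d).
Local Notation ib := (idx_d1 d).
Local Notation r := ((d.-1)%:R / 2 : R).
Local Open Scope complex_scope.

Lemma SOd1_w0M (g : M) : @SOd1 R d g -> @SOd1 R d (w0 d *m g).
Proof.
by move=> [dg gJ]; split; [rewrite det_mulmx det_w0// dg mulr1|rewrite w0_form].
Qed.

Lemma logA_iwasawaA_w0 (y : M) : G y -> logA (iwasawaA (w0 d *m y)) = - ln `|qrow y ib|.
Proof.
move=> Gy; have SOy := grpG_SOd1 Gy.
rewrite logA_iwasawaA ?prow_w0//; first exact: SOd1_w0M.
(* The product pq = 1 + |z|^2 is positive, so q has the sign of p. *)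
move=> d2; have p0 := grpG_prow_gt0 d2 Gy; rewrite -(pmulr_rgt0 _ p0) prow_qrow_SO//.
by rewrite ltr_pwDl ?sumsqr_ge0.
Qed.

Lemma cexp_rho (t tau : R) :
  cexp (t%:C * ((0 +i* tau) + rho d)) = cis (tau * t) * (expR (r * t))%:C.
Proof.
have -> : rho d = r%:C.
  by rewrite /rho rmorphM /= rmorph_nat fmorphV rmorph_nat.
rewrite /cexp /cis /= !mul0r !subr0 !addr0 add0r.
rewrite [t * tau]mulrC [t * _]mulrC; move: (expR _) (cos _) (sin _) => e x y.
by apply: complex_eqP => /=; ring.
Qed.

Lemma Tst_integrandE (y : M) (l m v : R) : G y ->
  Tst_integrand (class_one (0 +i* l)) (class_one (0 +i* m)) (class_one (0 +i* v)) y =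
  @tg_integrand R _ (borel_mat R d) (@log_aw0n0 R d) (@log_aw0 R d) (@tcoord R d) r l m v y.
Proof.
move=> Gy; rewrite /Tst_integrand /class_one /powA -mulmxA.
have Gny : G (n0 d *m y) by exact: grpG_nmx.
rewrite !logA_iwasawaA_w0// logA_iwasawaA; last 2 first.
- exact: grpG_SOd1.
- by move=> d2; exact: grpG_prow_gt0.
rewrite !cexp_rho -/(log_aw0n0 y) -/(log_aw0 y) -/(tcoord y) /tg_integrand.
rewrite !mulrDr !cisD !expRD !rmorphM /=.
by move: (cis _) (cis _) (cis _) (_%:C) (_%:C) (_%:C) => *; ring.
Qed.

End TrilinearIntegrand.

Section TrilinearGamma.
Context {R : realType}.
Variables (d : nat) (mu : {measure set (borel_mat R d) -> \bar R}).
Hypothesis d_ge2 : (2 <= d)%N.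
Hypothesis hmu : is_haar mu.
Local Notation B := (borel_mat R d).
Local Notation G := (@grpG R d).
Local Notation r := ((d.-1)%:R / 2 : R).
Local Notation nu := (haarG hmu).
Local Open Scope complex_scope.

(** Stated as a product; the three Gamma values are divided out only once [cGamma_neq0] is
    available. *)
Lemma Tst_cGamma : exists2 K : R, 0 < K & forall l m v : R,
  Tst_converges mu (0 +i* l) (0 +i* m) (0 +i* v) /\
  Tst mu (0 +i* l) (0 +i* m) (0 +i* v) *
    (cGamma (r +i* l) * (cGamma (r +i* m) * cGamma (r +i* v))) =
  K%:C *
    (cGamma ((r / 2) +i* ((l + m + v) / 2)) *
     (cGamma ((r / 2) +i* ((l + m - v) / 2)) *
      (cGamma ((r / 2) +i* ((l - m + v) / 2)) *
       cGamma ((r / 2) +i* ((- l + m + v) / 2))))).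
Proof.
have r0 : 0 < r by rewrite divr_gt0// ltr0n; case: d d_ge2 => [|[]].
have [K K0 laplace] := haar_laplace hmu d_ge2.
have mA := @measurable_log_aw0n0 R d; have mB := @measurable_log_aw0 R d.
have mC := @measurable_tcoord R d.
exists (K / 2); first by rewrite divr_gt0.
move=> l m v.
have tgi := cintegrable_tg_integrand mA mB mC r0 (ltW K0) laplace l m v.
have tgE := cintegral_tg_integrand mA mB mC r0 (ltW K0) laplace l m v.
have mG := @measurable_grpG R d.
have [tgi1 tgi2] := tgi.
have /integrableP[m1 _] := tgi1; have /integrableP[m2 _] := tgi2.
(* [tg_integrand] is measurable on all matrices, whereas the class one vectors are computed only on
   G; agreement on G is enough to transfer integrability and the integral. *)
have inG (f : R[i] -> R) : {in G, (fun y : B => (f (@tg_integrand R _ B (@log_aw0n0 R d)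
    (@log_aw0 R d) (@tcoord R d) r l m v y))%:E) =1 (fun y => (f (Tst_integrand
    (class_one (0 +i* l)) (class_one (0 +i* m)) (class_one (0 +i* v)) y))%:E)}.
  by move=> y /set_mem Gy; rewrite Tst_integrandE.
split; last rewrite -tgE; last congr (_ * _).
  by split; (apply: (eq_integrable mG); first exact: inG); exact: integrable_haarG.
rewrite /Tst /Tst_form /cintegral /Rintegral.
rewrite (integral_haarG hmu m1) (integral_haarG hmu m2).
by congr (fine _ +i* fine _); apply: eq_integral => y yG; apply/esym/inG.
Qed.

End TrilinearGamma.

(** * Asymptotics of the quotient of Gamma values *)

Section GammaAsymptotics.
Context {R : realType}.

Lemma ln1D_norm_le (u : R) : `|u| <= 1 / 2 -> `|ln (1 + u)| <= 2 * `|u|.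
Proof.
rewrite ler_norml => /andP[u1 u2]; have u0 : 0 < 1 + u by lra.
have h1 : ln (1 + u) <= u by apply: le_ln1Dx; lra.
have h2 : - ln (1 + u) <= - u / (1 + u).
  rewrite -lnV ?posrE// [X in ln X](_ : _ = 1 + - u / (1 + u)); last by field; lra.
  apply: le_ln1Dx; rewrite ltr_pdivlMr//; lra.
have h3 : - u / (1 + u) <= 2 * `|u|.
  rewrite ler_pdivrMr//; have := ler_norm (- u); rewrite normrN => h.
  by have := normr_ge0 u; nra.
by rewrite ler_norml; have := ler_norm u; have := normr_ge0 u; move=> h4 h5; apply/andP; split; lra.
Qed.

Lemma expR_sub1_norm_le (e : R) : `|e| <= 1 -> `|expR e - 1| <= expR 1 * `|e|.
Proof.
move=> e1; have h1 : 1 + e <= expR e by exact: expR_ge1Dx.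
have h2 : expR e - 1 <= e * expR e.
  have : 1 + - e <= expR (- e) by exact: expR_ge1Dx.
  rewrite -(ler_pM2r (expR_gt0 e)) -expRD addNr expR0 mulrDl mul1r mulNr; lra.
have h3 : 1 <= expR 1 :> R by have := @expR_ge1Dx R 1; lra.
have e0 := normr_ge0 e; have h5 := ler_norm e.
have h6 := ler_norm (- e); rewrite normrN in h6.
rewrite ler_norml; apply/andP; split; first by nra.
apply: le_trans h2 _; apply: le_trans (_ : `|e| * expR e <= _).
  by rewrite ler_pM2r ?expR_gt0.
by rewrite mulrC ler_wpM2r// ler_expR; lra.
Qed.

Definition lgmod (s t : R) : R := ln (gmod2 s t) / 2.

(** The threshold makes |delta/t| <= 1/2, so |t + delta| is exactly |t| + sg(t) delta, and |(t +
    delta)/2| >= |t|/4 >= 2, as [gmod2_asymptotics] requires. *)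
Lemma lgmod_shift_asymptotics (s delta : R) : 0 < s -> exists c C : R, 0 <= C /\
  forall t, 8 + 2 * `|delta| <= `|t| ->
  `|lgmod s ((t + delta) / 2) -
    ((s - 1 / 2) * ln `|t| - pi / 4 * (`|t| + Num.sg t * delta) + c)| <= C / `|t|.
Proof.
move=> s0; have [c0 [C0 [C0_ge0 H]]] := gmod2_asymptotics s0.
(* The term ln 2 comes from halving the argument, 4 C0 from |(t + delta)/2| >= |t|/4, and the rest
   from [ln1D_norm_le] applied to delta/|t| up to sign. *)
exists (c0 - (s - 1 / 2) * ln 2), (4 * C0 + `|s - 1 / 2| * (2 * `|delta|)).
have d0 := normr_ge0 delta.
split; first by have := normr_ge0 (s - 1 / 2); move=> ?; nra.
move=> t tL; have t0 : 0 < `|t| by lra.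
pose u := Num.sg t * delta / `|t|.
have tn0 : t != 0 by rewrite -normr_gt0.
have nu : `|u| = `|delta| / `|t|.
  by rewrite /u !normrM normfV normr_id normr_sg tn0 mul1r.
have u2 : `|u| <= 1 / 2 by rewrite nu ler_pdivrMr//; lra.
have tE : `|(t + delta) / 2| = `|t| * (1 + u) / 2.
  have -> : (t + delta) / 2 = Num.sg t * (`|t| * (1 + u) / 2).
    rewrite {1}[t]numEsg /u; have sg2 : Num.sg t * Num.sg t = 1.
      by rewrite -expr2 sqr_sg tn0.
    transitivity ((Num.sg t * `|t| + Num.sg t * Num.sg t * delta) / 2); first by rewrite sg2 mul1r.
    by field; exact: lt0r_neq0.
  rewrite normrM normr_sg tn0 mul1r ger0_norm//.
  by move: u2; rewrite ler_norml => /andP[? ?]; apply: divr_ge0 => //; apply: mulr_ge0; lra.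
have u1 : 1 / 2 <= 1 + u by move: u2; rewrite ler_norml => /andP[? ?]; lra.
have tge : `|t| / 4 <= `|(t + delta) / 2| by rewrite tE; nra.
have := H ((t + delta) / 2) (ltac:(lra)); rewrite -/(lgmod _ _).
have -> : ln `|(t + delta) / 2| = ln `|t| + ln (1 + u) - ln 2.
  have u0 : 0 < 1 + u by lra.
  by rewrite tE !lnM ?lnV ?posrE ?mulr_gt0.
have -> : `|(t + delta) / 2| = (`|t| + Num.sg t * delta) / 2 :> R.
  by rewrite tE /u; field; exact: lt0r_neq0.
have hC : C0 / ((`|t| + Num.sg t * delta) / 2) <= 4 * C0 / `|t|.
  have -> : (`|t| + Num.sg t * delta) / 2 = `|(t + delta) / 2|.
    by rewrite tE /u; field; exact: lt0r_neq0.
  rewrite ler_pdivlMr// mulrAC ler_pdivrMr; last by lra.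
  by move: tge; move: (`|_|) (`|_|) => *; nra.
have hL := ln1D_norm_le u2; rewrite nu in hL.
set E := lgmod _ _; set l1 := ln (1 + u) in hL *; set S := _ + _ * delta in hC *.
move=> h; have -> : E - ((s - 1 / 2) * ln `|t| - pi / 4 * S + (c0 - (s - 1 / 2) * ln 2)) =
   (E - ((s - 1 / 2) * (ln `|t| + l1 - ln 2) - pi / 2 * (S / 2) + c0)) + (s - 1 / 2) * l1.
  by field.
apply: le_trans (ler_normD _ _) _; rewrite [leRHS]mulrDl; apply: lerD; first exact: le_trans h hC.
by rewrite normrM -mulrA ler_wpM2l// -mulrA.
Qed.

Local Open Scope complex_scope.

Lemma cabs_cGamma (s t : R) : 0 < s -> cabs (cGamma (s +i* t)) = expR (lgmod s t).
Proof.
move=> s0; have g0 := gmod2_gt0 t s0.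
rewrite cGammaE /cabs /= -/(gcos s t) -/(gsin s t) -/(gmod2 s t).
have {1}-> : gmod2 s t = expR (lgmod s t) ^+ 2.
  by rewrite expr2 -expRD /lgmod -splitr lnK.
by rewrite sqrtr_sqr ger0_norm ?expR_ge0.
Qed.

Lemma cGamma_neq0 (s t : R) : 0 < s -> cGamma (s +i* t) != 0.
Proof.
move=> s0; apply/eqP => h; have := cabs_cGamma t s0; rewrite h /cabs.
rewrite ComplexField.Normc.normc0 => h0; have := expR_gt0 (lgmod s t).
by rewrite -h0 ltxx.
Qed.

(* The shifts add up to zero, so the terms linear in [t] beyond [pi/2 |t|]
   cancel. *)
Lemma lgmod_quotient_asymptotics (s m v : R) : 0 < s -> exists c C L : R,
  [/\ 0 <= C, 0 < L & forall t, L <= `|t| ->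
  `|lgmod (s / 2) ((t + m + v) / 2) + lgmod (s / 2) ((t + m - v) / 2) +
    lgmod (s / 2) ((t - m + v) / 2) + lgmod (s / 2) ((- t + m + v) / 2)
    - (lgmod s t + lgmod s m + lgmod s v) -
    ((s - 3 / 2) * ln `|t| - pi / 2 * `|t| + c)| <= C / `|t| ].
Proof.
move=> s0; have s2 : 0 < s / 2 by rewrite divr_gt0.
have [c1 [C1 [C1_ge0 H1]]] := lgmod_shift_asymptotics (m + v) s2.
have [c2 [C2 [C2_ge0 H2]]] := lgmod_shift_asymptotics (m - v) s2.
have [c3 [C3 [C3_ge0 H3]]] := lgmod_shift_asymptotics (- m + v) s2.
have [c4 [C4 [C4_ge0 H4]]] := lgmod_shift_asymptotics (- (m + v)) s2.
have [c5 [C5 [C5_ge0 H5]]] := gmod2_asymptotics s0.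
exists (c1 + c2 + c3 + c4 - c5 - lgmod s m - lgmod s v), (C1 + C2 + C3 + C4 + C5).
exists (8 + 2 * (`|m + v| + `|m - v| + `|- m + v| + `|- (m + v)|)).
have n1 := normr_ge0 (m + v); have n2 := normr_ge0 (m - v).
have n3 := normr_ge0 (- m + v); have n4 := normr_ge0 (- (m + v)).
split; [by rewrite !addr_ge0|lra|move=> t tL].
have {}H1 := H1 t (ltac:(lra)); have {}H2 := H2 t (ltac:(lra)).
have {}H3 := H3 t (ltac:(lra)); have {}H4 := H4 t (ltac:(lra)).
have {}H5 := H5 t (ltac:(lra)); rewrite -/(lgmod s t) in H5.
rewrite (_ : (t + m + v) / 2 = (t + (m + v)) / 2); last by rewrite addrA.
rewrite (_ : (t + m - v) / 2 = (t + (m - v)) / 2); last by rewrite addrA.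
rewrite (_ : (t - m + v) / 2 = (t + (- m + v)) / 2); last by rewrite addrA.
(* The modulus is even in the imaginary part, so all four arguments become shifts of t. *)
have -> : lgmod (s / 2) ((- t + m + v) / 2) = lgmod (s / 2) ((t + - (m + v)) / 2).
  by rewrite /lgmod -gmod2N//; congr (ln (gmod2 _ _) / 2); ring.
move: H1 H2 H3 H4 H5; clear tL n1 n2 n3 n4.
set E1 := lgmod _ _; set E2 := lgmod _ _; set E3 := lgmod _ _; set E4 := lgmod _ _.
set E5 := lgmod _ _; set E6 := lgmod _ _; set E7 := lgmod _ _.
set l := ln _; set x := `|t|; set g := Num.sg t.
set F1 := (X in `|X| <= C1 / _); set F2 := (X in `|X| <= C2 / _).
set F3 := (X in `|X| <= C3 / _); set F4 := (X in `|X| <= C4 / _).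
set F5 := (X in `|X| <= C5 / _) => H1 H2 H3 H4 H5.
(* Bookkeeping of exponents: 4 (s/2 - 1/2) - (s - 1/2) = s - 3/2 for ln|t|, and 4 (pi/4) - pi/2 =
   pi/2 for |t|. *)
rewrite (_ : E1 + _ + _ + _ - _ - _ = F1 + F2 + F3 + F4 - F5); last first.
  by rewrite /F1 /F2 /F3 /F4 /F5; field.
rewrite !mulrDl; apply: le_trans (ler_normB _ _) _; apply: lerD => //.
apply: le_trans (ler_normD _ _) _; apply: lerD => //.
apply: le_trans (ler_normD _ _) _; apply: lerD => //.
by apply: le_trans (ler_normD _ _) _; apply: lerD.
Qed.

End GammaAsymptotics.

Local Open Scope complex_scope.

(** * Imaginary parameters and the final formulas *)

Section GammaArguments.
Context {R : realType}.
Variables (d : nat) (z : R[i]).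
Hypothesis z_imaginary : imaginary z.

Lemma natrC (k : nat) : k%:R = k%:R%:C :> R[i].
Proof. by rewrite rmorph_nat. Qed.

Lemma natrVC (k : nat) : k%:R^-1 = k%:R^-1%:C :> R[i].
Proof. by rewrite fmorphV rmorph_nat. Qed.

Lemma gamma_arg4 :
  (2 * z + d%:R) / 4 = ((d%:R / 2 / 2) +i* (complex.Im z / 2) : R[i]).
Proof.
rewrite (natrC d) (natrC 2) (natrVC 4).
by move: z_imaginary; rewrite /imaginary; case: (z) => a b /= ->; apply: complex_eqP => /=; field.
Qed.

Lemma gamma_arg2 : (2 * z + d%:R) / 2 = ((d%:R / 2) +i* complex.Im z : R[i]).
Proof.
rewrite (natrC d) (natrVC 2) (natrC 2).
by move: z_imaginary; rewrite /imaginary; case: (z) => a b /= ->; apply: complex_eqP => /=; field.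
Qed.

Lemma imaginary_eq : z = 0 +i* complex.Im z.
Proof. by move: z_imaginary; rewrite /imaginary; case: (z) => a b /= ->. Qed.

Lemma cabs_imaginary : cabs z = `|complex.Im z|.
Proof.
by rewrite {1}imaginary_eq /cabs /= expr0n add0r sqrtr_sqr.
Qed.

End GammaArguments.

Lemma cabs_expR_quotient (R : realType) (K x1 x2 x3 y1 y2 y3 y4 : R)
    (T g1 g2 g3 h1 h2 h3 h4 : R[i]) : 0 < K ->
  T * (g1 * (g2 * g3)) = K%:C * (h1 * (h2 * (h3 * h4))) ->
  cabs g1 = expR x1 -> cabs g2 = expR x2 -> cabs g3 = expR x3 ->
  cabs h1 = expR y1 -> cabs h2 = expR y2 -> cabs h3 = expR y3 -> cabs h4 = expR y4 ->
  cabs T = K * expR (y1 + y2 + y3 + y4 - (x1 + x2 + x3)).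
Proof.
move=> K0 /(congr1 cabs) E G1 G2 G3 H1 H2 H3 H4.
have cabsM (x y : R[i]) : cabs (x * y) = cabs x * cabs y.
  exact: ComplexField.Normc.normcM.
have KE : cabs K%:C = K by rewrite /cabs /= expr0n addr0 sqrtr_sqr gtr0_norm.
rewrite !cabsM KE G1 G2 G3 H1 H2 H3 H4 -!expRD in E.
apply: (mulIf (lt0r_neq0 (expR_gt0 (x1 + (x2 + x3))))); rewrite E -mulrA -expRD.
by congr (_ * expR _); ring.
Qed.

Theorem theorem3p1 (R : realType) (d : nat) (hd : (2 <= d)%N)
    (mu : {measure set (borel_mat R d) -> \bar R}) (hmu : is_haar mu) :
  let n : R[i] := (d.-1)%:R in
  (exists kappa : R, 0 < kappa /\
     forall l m v : R[i], imaginary l -> imaginary m -> imaginary v ->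
       Tst_converges mu l m v /\
       Tst mu l m v =
         kappa%:C *
         ((cGamma ((2 * (l + m - v) + n) / 4) *
           cGamma ((2 * (l - m + v) + n) / 4) *
           cGamma ((2 * (- l + m + v) + n) / 4) *
           cGamma ((2 * (l + m + v) + n) / 4)) /
          (cGamma ((2 * l + n) / 2) *
           cGamma ((2 * m + n) / 2) *
           cGamma ((2 * v + n) / 2)))) /\
  (forall m v : R[i], imaginary m -> imaginary v ->
     exists c : R, 0 < c /\
     exists B L : R, 0 < L /\
     forall l : R[i], imaginary l -> L <= cabs l ->
       exists e : R, `|e| <= B / cabs l /\
         cabs (Tst mu l m v) =
           c * expR (- (pi / 2 * cabs l)) *
           (cabs l `^ (d%:R / 2 - 2)) * (1 + e)).
Proof.
move=> n; set r : R := (d.-1)%:R / 2.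
have r0 : 0 < r by rewrite divr_gt0// ltr0n ltn_predRL.
have r20 : 0 < r / 2 by rewrite divr_gt0.
have [K K0 HK] := Tst_cGamma hd hmu.
have imD (x y : R[i]) : imaginary x -> imaginary y -> imaginary (x + y).
  by rewrite /imaginary; case: x y => [a b] [a' b'] /= -> ->; rewrite addr0.
have imN (x : R[i]) : imaginary x -> imaginary (- x).
  by rewrite /imaginary; case: x => [a b] /= ->; rewrite oppr0.
have formula (l m v : R[i]) : imaginary l -> imaginary m -> imaginary v ->
    Tst_converges mu l m v /\
    Tst mu l m v = K%:C *
      ((cGamma ((2 * (l + m - v) + n) / 4) *
        cGamma ((2 * (l - m + v) + n) / 4) *
        cGamma ((2 * (- l + m + v) + n) / 4) *
        cGamma ((2 * (l + m + v) + n) / 4)) /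
       (cGamma ((2 * l + n) / 2) *
        cGamma ((2 * m + n) / 2) *
        cGamma ((2 * v + n) / 2))).
  move=> il im iv; have [conv E] := HK (complex.Im l) (complex.Im m) (complex.Im v).
  rewrite -(imaginary_eq il) -(imaginary_eq im) -(imaginary_eq iv) in conv E.
  split=> //; rewrite !gamma_arg4; [|by auto..].
  rewrite !gamma_arg2// !raddfD !raddfN /= -/r.
  have gl := cGamma_neq0 (complex.Im l) r0; have gm := cGamma_neq0 (complex.Im m) r0.
  have gv := cGamma_neq0 (complex.Im v) r0.
  have D0 := mulf_neq0 gl (mulf_neq0 gm gv).
  apply: (mulIf D0); rewrite E; move: gl gm gv {E D0}.
  move: (cGamma (r +i* _)) (cGamma (r +i* _)) (cGamma (r +i* _)) => a b c a0 b0 c0.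
  by field; rewrite a0 b0 c0.
split; first by exists K.
move=> m v im iv.
have [c [C [L [C0 L0 H]]]] := lgmod_quotient_asymptotics (complex.Im m) (complex.Im v) r0.
exists (K * expR c); split; first by rewrite mulr_gt0 ?expR_gt0.
(* Adding C to the threshold makes the logarithmic error C/|t| at most 1, where |exp e - 1| <=
   exp(1) |e| applies. *)
exists (expR 1 * C), (L + C); split; first by rewrite ltr_pwDl.
move=> l il; rewrite (cabs_imaginary il); set t := complex.Im l => tL.
have t0 : 0 < `|t| by lra.
have := H t (ltac:(lra)).
set q := (X in X - _); set e := (X in `|X|) => He.
exists (expR e - 1); split.
  apply: le_trans (expR_sub1_norm_le _) _.
    by apply: le_trans He _; rewrite ler_pdivrMr//; lra.
  by rewrite -mulrA ler_wpM2l ?expR_ge0.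
have -> : cabs (Tst mu l m v) = K * expR q.
  have [_] := HK t (complex.Im m) (complex.Im v).
  rewrite -(imaginary_eq il) -(imaginary_eq im) -(imaginary_eq iv) => E.
  exact: (cabs_expR_quotient K0 E (cabs_cGamma _ r0) (cabs_cGamma _ r0) (cabs_cGamma _ r0)
    (cabs_cGamma _ r20) (cabs_cGamma _ r20) (cabs_cGamma _ r20) (cabs_cGamma _ r20)).
have dE : d%:R / 2 - 2 = r - 3 / 2 :> R.
  have -> : d%:R = d.-1%:R + 1 :> R by rewrite natr1 prednK// ltnW.
  by rewrite /r; field.
have tp : `|t| `^ (d%:R / 2 - 2) = expR ((r - 3 / 2) * ln `|t|).
  by rewrite dE /powR (gt_eqF t0).
rewrite tp (_ : 1 + (expR e - 1) = expR e); last by rewrite addrC subrK.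
have -> : q = c + - (pi / 2 * `|t|) + (r - 3 / 2) * ln `|t| + e by rewrite /e; ring.
by rewrite !expRD !mulrA.
Qed.
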